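(* Let $m,k,d\in\mathbb{N}$, let $A,B,D$ be real matrices of sizes $m\times m$, $m\times k$, $m\times d$ respectively, let $W$ be a Wiener process in $\mathbb{R}^k$, and let $Z$ be the $\mathbb{R}^d$-valued Lévy process, independent of $W$, $$Z(t)=\int_0^t\int_{\|u\|_{\mathbb{R}^d}>1}u\,\nu(ds,du)+\int_0^t\int_{\|u\|_{\mathbb{R}^d}\le1}u\,\tilde\nu(ds,du),\quad t\ge0,$$ whose Lévy measure $\Pi$ is essentially linearly non-degenerated. Let $X$ be the solution of $$X(t)=\int_0^tAX(s)\,ds+BW(t)+DZ(t),\quad t\ge0.$$ Suppose that $$\left[\varepsilon^2\ln\frac1\varepsilon\right]^{-1}\inf_{l\in S^d}\int_{\{u\in\mathbb{R}^d:\,|(u,l)_{\mathbb{R}^d}|\le\varepsilon\}}(u,l)_{\mathbb{R}^d}^2\,\Pi(du)\to+\infty,\quad\varepsilon\to0+,$$ and that $$\mathrm{Rank}\,[B,AB,\ldots,A^{m-1}B,D,AD,\ldots,A^{m-1}D]=m.$$ Then for every $t>0$ the law of $X(t)$ possesses a density from the class $C_b^\infty(\mathbb{R}^m)$.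
   Context: $S^d=\{l\in\mathbb{R}^d:\|l\|_{\mathbb{R}^d}=1\}$ is the unit sphere in $\mathbb{R}^d$; $(\cdot,\cdot)_{\mathbb{R}^d}$ is the Euclidean inner product. $[B,AB,\ldots,A^{m-1}B,D,AD,\ldots,A^{m-1}D]$ is the $m\times m(k+d)$ block matrix obtained by placing the listed matrices side by side. A Lévy measure $\Pi$ on $\mathbb{R}^d$ is a Borel measure with $\Pi(\{0\})=0$ and $\int(\|u\|^2\wedge1)\,\Pi(du)<\infty$. It is called essentially linearly non-degenerated (Yamazato condition) if $\Pi(\mathbb{R}^d\setminus L)=+\infty$ for every proper linear subspace $L\subsetneq\mathbb{R}^d$; equivalently, its essential linear support, i.e. the smallest linear subspace $L$ with $\Pi(\mathbb{R}^d\setminus L)<+\infty$, equals $\mathbb{R}^d$. $\nu$ is the Poisson random point measure on $[0,\infty)\times\mathbb{R}^d$ with intensity $dt\times\Pi(du)$, independent of $W$, and $\tilde\nu(ds,du)=\nu(ds,du)-ds\,\Pi(du)$. The equation is solved pathwise; its unique solution with locally bounded trajectories is $$X(t)=\int_0^te^{(t-s)A}B\,dW(s)+\int_0^t\int_{\|u\|>1}e^{(t-s)A}Du\,\nu(ds,du)+\int_0^t\int_{\|u\|\le1}e^{(t-s)A}Du\,\tilde\nu(ds,du).$$ $C_b^\infty(\mathbb{R}^m)$ is the class of infinitely differentiable functions bounded together with all their derivatives. *)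

(* Defs.v *)
From HB Require Import structures.
From mathcomp Require Import all_boot all_order all_algebra.
From mathcomp Require Import all_classical all_reals all_analysis.
From mathcomp Require Import measurable_realfun.

Set Implicit Arguments.
Unset Strict Implicit.
Unset Printing Implicit Defensive.

Import Order.TTheory GRing.Theory Num.Theory.
Import numFieldNormedType.Exports.

Local Open Scope classical_set_scope.
Local Open Scope ring_scope.

(* Matrices, in particular column vectors, carry the Borel sigma-algebra of the
   library's topology; it is also the product one, see [measurable_mxP]. *)
Section borel_matrix.
Context (R : realType) (m n : nat).

Let borel : set (set 'M[R]_(m, n)) := <<s @open 'M[R]_(m, n) >>.

Let borel0 : borel set0.
Proof. exact: sigma_algebra0. Qed.

Let borelC A : borel A -> borel (~` A).
Proof. exact: sigma_algebraC. Qed.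

Let borel_bigcup (F : (set 'M[R]_(m, n))^nat) :
  (forall i, borel (F i)) -> borel (\bigcup_i F i).
Proof. exact: sigma_algebra_bigcup. Qed.

HB.instance Definition _ :=
  @isMeasurable.Build (sigma_display (@open 'M[R]_(m, n)))
    'M[R]_(m, n) borel borel0 borelC borel_bigcup.

End borel_matrix.

Lemma measurable_coord (R : realType) m n (i : 'I_m) (j : 'I_n) :
  measurable_fun [set: 'M[R]_(m, n)] (fun M : 'M[R]_(m, n) => M i j).
Proof.
apply: (measurability _ (RGenOpens.measurableE R)).
move=> _ [_ [a [b ->] <-]]; rewrite setTI; apply: sub_sigma_algebra.
have /continuousP := @coord_continuous R m n i j.
by apply; exact: interval_open.
Qed.

Lemma measurable_mxP (R : realType) m n d (T : measurableType d)
    (f : T -> 'M[R]_(m, n)) :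
  measurable_fun [set: T] f <->
  forall i j, measurable_fun [set: T] (fun x => f x i j).
Proof.
split=> [mf i j|mf].
  exact: (measurableT_comp (@measurable_coord R m n i j)).
apply: (measurability (@open 'M[R]_(m, n))) => // _ [U oU <-].
rewrite setTI.
pose F (qe : 'M[rat]_(m, n) * nat) : set 'M[R]_(m, n) :=
  ball (map_mx ratr qe.1 : 'M[R]_(m, n)) qe.2.+1%:R^-1.
have mF qe : measurable (f @^-1` F qe).
  have -> : f @^-1` F qe = \bigcap_(ij in [set: 'I_m * 'I_n])
      (fun x => f x ij.1 ij.2) @^-1` ball (ratr (qe.1 ij.1 ij.2) : R) qe.2.+1%:R^-1.
    apply/seteqP; split=> [x [_ +] [i j] _|x h]; first by move=> /(_ i j); rewrite mxE.
    by split=> // i j; rewrite mxE; exact: (h (i, j) Logic.I).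
  apply: fin_bigcap_measurable => // -[i j] _; rewrite -[X in measurable X]setTI.
  by apply: mf => //; apply: open_measurable; exact: ball_open.
have -> : f @^-1` U =
    \bigcup_(qe in [set: 'M[rat]_(m, n) * nat])
      (if `[< F qe `<=` U >] then f @^-1` F qe else set0).
  apply/seteqP; split=> [x /= Ux|x [qe _]]; last first.
    by case: ifP => // /asboolP; exact.
  have : nbhs (f x) U by exact: open_nbhs_nbhs.
  move=> /nbhs_ballP[e /= e0 eU].
  have e20 : 0 < e / 2 by rewrite divr_gt0.
  have [N _ /(_ N (leqnn N)) /= eN] := near_infty_natSinv_lt (PosNum e20).
  pose dl : R := N.+1%:R^-1; have dl0 : 0 < dl by rewrite invr_gt0.
  have /choice[q /= qP] : forall ij : 'I_m * 'I_n, exists q : rat,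
      ratr q \in `]f x ij.1 ij.2 - dl, f x ij.1 ij.2 + dl[.
    move=> ij; have /rat_in_itvoo[q qP] : f x ij.1 ij.2 - dl < f x ij.1 ij.2 + dl.
      by rewrite ltrD2l gtrN.
    by exists q.
  have xF : F (\matrix_(i, j) q (i, j), N) (f x).
    split=> // i j; rewrite !mxE /ball /= ltr_distlC.
    by have := qP (i, j); rewrite in_itv /= => /andP[? ?]; apply/andP; split;
       rewrite ?ltrBlDr // -ltrBlDr.
  exists (\matrix_(i, j) q (i, j), N) => //; case: asboolP => //; case.
  apply: subset_trans eU => y Fy; have -> : e = e / 2 + e / 2 by rewrite -splitr.
  apply: (@ball_triangle _ _ (map_mx ratr (\matrix_(i, j) q (i, j)) : 'M[R]_(m, n))).
    by apply/ball_sym; apply: le_ball xF; exact/ltW.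
  by apply: le_ball Fy; exact/ltW.
apply: countable_bigcupT_measurable => [|qe]; first exact: countableP.
by case: ifP.
Qed.

Section lebesgue_step.
Context (R : realType) (n : nat) (mu : {sigma_finite_measure set 'cV[R]_n -> \bar R}).

Definition cV_cons (p : R * 'cV[R]_n) : 'cV[R]_n.+1 :=
  col_mx (p.1)%:M p.2 : 'cV[R]_(1 + n).

Definition cV_uncons (v : 'cV[R]_n.+1) : R * 'cV[R]_n :=
  (v ord0 ord0, dsubmx (v : 'cV[R]_(1 + n))).

Lemma cV_consK : cancel cV_cons cV_uncons.
Proof.
move=> [x v]; rewrite /cV_cons /cV_uncons /= col_mxKd; congr (_, _).
transitivity ((col_mx x%:M v : 'cV[R]_(1 + n)) (lshift n ord0) ord0).
  by congr (col_mx _ _ _ _); exact/val_inj.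
by rewrite col_mxEu mxE.
Qed.

Lemma measurable_cV_cons : measurable_fun setT cV_cons.
Proof.
have E1 (p : R * 'cV[R]_n) (k j : 'I_1) : p.1 = cV_cons p (lshift n k) j.
  by apply/esym; rewrite [LHS](@col_mxEu _ 1 n 1) !ord1 mxE.
have E2 (p : R * 'cV[R]_n) (k : 'I_n) (j : 'I_1) : p.2 k j = cV_cons p (rshift 1 k) j.
  by apply/esym; rewrite [LHS](@col_mxEd _ 1 n 1).
apply/measurable_mxP => i j.
case: (split_ordP (i : 'I_(1 + n))) => k ->.
- under eq_fun do rewrite -E1; exact: measurable_fst.
- under eq_fun do rewrite -E2.
  exact: (measurableT_comp (@measurable_coord R n 1 k j) measurable_snd).
Qed.

Lemma measurable_cV_uncons : measurable_fun setT cV_uncons.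
Proof.
apply: measurable_fun_pair; first exact: measurable_coord.
apply/measurable_mxP => i j.
apply: (eq_measurable_fun (fun v : 'cV[R]_n.+1 => v (rshift 1 i) j)).
  by move=> v _; rewrite mxE.
exact: measurable_coord.
Qed.

Definition lebesgue_cV_step : set 'cV[R]_n.+1 -> \bar R :=
  pushforward (lebesgue_measure \x mu)%E cV_cons.

Let step_preimage A : measurable A -> measurable (cV_cons @^-1` A).
Proof. by move=> mA; rewrite -[X in measurable X]setTI; exact: measurable_cV_cons. Qed.

Let step0 : lebesgue_cV_step set0 = 0%E.
Proof. by rewrite /lebesgue_cV_step /pushforward preimage_set0 measure0. Qed.

Let step_ge0 A : (0 <= lebesgue_cV_step A)%E.
Proof. by rewrite /lebesgue_cV_step /pushforward; exact: measure_ge0. Qed.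

Let step_sigma_additive : semi_sigma_additive lebesgue_cV_step.
Proof.
move=> F mF tF mUF; rewrite /lebesgue_cV_step /pushforward preimage_bigcup.
apply: measure_semi_sigma_additive => [i||]; first exact: step_preimage.
- apply/trivIsetP => i j _ _ ij; rewrite -preimage_setI.
  by move/trivIsetP : tF => /(_ _ _ _ _ ij) -> //; rewrite preimage_set0.
- by rewrite -preimage_bigcup; exact: step_preimage.
Qed.

HB.instance Definition _ := isMeasure.Build _ _ _ lebesgue_cV_step
  step0 step_ge0 step_sigma_additive.

Let step_sigma_finite : sigma_finite setT lebesgue_cV_step.
Proof.
have /sigma_finiteP[F [TF ndF Foo]] := sigma_finiteT (@lebesgue_measure R).
have /sigma_finiteP[G [TG ndG Goo]] := sigma_finiteT mu.
exists (fun i => cV_uncons @^-1` (F i `*` G i)).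
  apply/seteqP; split=> // v _.
  have [i _ Fi] : (\bigcup_i F i) (cV_uncons v).1 by rewrite -TF.
  have [j _ Gj] : (\bigcup_i G i) (cV_uncons v).2 by rewrite -TG.
  exists (maxn i j) => //; split.
  - exact: (subsetPset _ _ (ndF _ _ (leq_maxl i j))).
  - exact: (subsetPset _ _ (ndG _ _ (leq_maxr i j))).
move=> i; have [mF Fioo] := Foo i; have [mG Gioo] := Goo i; split.
  rewrite -[X in measurable X]setTI; apply: measurable_cV_uncons => //.
  exact: measurableX.
rewrite /lebesgue_cV_step /pushforward -comp_preimage.
rewrite (_ : cV_uncons \o cV_cons = id); last by apply/funext => p; exact: cV_consK.
by rewrite preimage_id product_measure1E // lte_mul_pinfty // ge0_fin_numE.
Qed.

HB.instance Definition _ := Measure_isSigmaFinite.Build _ _ _ lebesgue_cV_step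
  step_sigma_finite.

End lebesgue_step.

(* Lebesgue measure on R^n, as an iterated product; see [lebesgue_cV_box]. *)
Fixpoint lebesgue_cV (R : realType) (n : nat) :
    {sigma_finite_measure set 'cV[R]_n -> \bar R} :=
  match n with
  | 0 => \d_(0 : 'cV[R]_0)
  | n'.+1 => lebesgue_cV_step (lebesgue_cV R n')
  end.

Lemma lebesgue_cV_box (R : realType) n (U : 'I_n -> set R) :
  (forall i, measurable (U i)) ->
  lebesgue_cV R n [set v | forall i, U i (v i ord0)] =
  (\prod_(i < n) lebesgue_measure (U i))%E.
Proof.
elim: n U => [|n IHn] U mU /=.
  by rewrite big_ord0 diracE mem_set // => -[].
have E0 (p : R * 'cV[R]_n) : cV_cons p ord0 ord0 = p.1.
  by have := congr1 fst (cV_consK p).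
have E1 (p : R * 'cV[R]_n) i : cV_cons p (lift ord0 i) ord0 = p.2 i ord0.
  have := congr1 (fun q : R * 'cV[R]_n => q.2 i ord0) (cV_consK p).
  by rewrite /= mxE => <-; congr (cV_cons p _ _); exact/val_inj.
rewrite /lebesgue_cV_step /pushforward big_ord_recl -IHn //.
have mB : measurable [set v : 'cV[R]_n | forall i, U (lift ord0 i) (v i ord0)].
  have -> : [set v : 'cV[R]_n | forall i, U (lift ord0 i) (v i ord0)] =
      \bigcap_(i in [set: 'I_n])
        (fun v : 'cV[R]_n => v i ord0) @^-1` U (lift ord0 i).
    by apply/seteqP; split=> v /= h i; [move=> _; exact: h|exact: (h i Logic.I)].
  apply: fin_bigcap_measurable => // i _; rewrite -[X in measurable X]setTI.
  exact: measurable_coord.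
apply: (etrans _ (product_measure1E lebesgue_measure (lebesgue_cV R n) (mU ord0) mB)).
congr (_ _).
apply/seteqP; split=> [p /= h|p /= [h0 h] i].
- by split=> [|i]; [rewrite -E0|rewrite -E1]; exact: h.
- by have [j ->|->] := unliftP ord0 i; [rewrite E1|rewrite E0]; [exact: h|].
Qed.

Section euclidean.
Context (R : realType) (n : nat).
Implicit Types u v : 'cV[R]_n.

Definition dotp u v : R := \sum_(i < n) u i ord0 * v i ord0.

(* The norm [`|u|] of the library is the sup norm. *)
Definition enorm u : R := Num.sqrt (dotp u u).

Definition sphere : set 'cV[R]_n := [set l | enorm l = 1].

End euclidean.

Definition cV_integral (R : realType) d (T : measurableType d) n
    (mu : {measure set T -> \bar R}) (D : set T) (f : T -> 'cV[R]_n) : 'cV[R]_n :=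
  \col_i (\int[mu]_(x in D) (f x i ord0))%R.

Section levy_measure.
Context (R : realType) (d : nat) (Pi : {measure set 'cV[R]_d -> \bar R}).

Definition levy_measure : Prop :=
  Pi [set 0] = 0%E /\
  (\int[Pi]_u (Num.min (enorm u ^+ 2) 1)%:E < +oo)%E.

Definition ess_lin_nondegenerate : Prop :=
  forall L : {vspace 'cV[R]_d}, L != fullv -> Pi [set u | u \notin L] = +oo%E.

Definition directional_moment (e : R) (l : 'cV[R]_d) : \bar R :=
  (\int[Pi]_(u in [set u | (`|dotp u l| <= e)%R]) (dotp u l ^+ 2)%:E)%E.

Definition directional_moment_condition : Prop :=
  (((e ^+ 2 * ln e^-1)^-1)%:E *
     ereal_inf [set directional_moment e l | l in @sphere R d])%E
  @[e --> 0^'+] --> +oo%E.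

End levy_measure.

Section independence.
Context (R : realType) d (Omega : measurableType d) (P : probability Omega R).

(* Sub-families are covered by taking some of the [U i] equal to [setT]. *)
Definition independent_rvs n d' (T : measurableType d')
    (Y : 'I_n -> Omega -> T) : Prop :=
  forall U : 'I_n -> set T, (forall i, measurable (U i)) ->
    P [set w | forall i, U i (Y i w)] = (\prod_(i < n) P (Y i @^-1` U i))%E.

Definition independent_systems (F G : set (set Omega)) : Prop :=
  forall E E', F E -> G E' -> P (E `&` E') = (P E * P E')%E.

End independence.

Section processes.
Context (R : realType) d (Omega : measurableType d) (P : probability Omega R).

(* Processes are indexed by [R]; only their values at times [t >= 0] matter. *)

Definition process_sigma n (Y : R -> Omega -> 'cV[R]_n) : set (set Omega) :=
  <<s [set E | exists t U, [/\ 0 <= t, measurable U & E = Y t @^-1` U]] >>.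

Definition cadlag n (f : R -> 'cV[R]_n) : Prop :=
  (forall t, 0 <= t -> f x @[x --> t^'+] --> f t) /\
  (forall t, 0 < t -> cvg (f x @[x --> t^'-])).

Definition wiener_process k (W : R -> Omega -> 'cV[R]_k) : Prop :=
  [/\ forall t, 0 <= t -> measurable_fun setT (W t),
      {ae P, forall w, W 0 w = 0 /\
                       {within `[0, +oo[, continuous (fun t => W t w)}},
      forall s t, 0 <= s -> s < t ->
        independent_rvs P (fun (i : 'I_k) w => (W t w - W s w) i ord0 : R) /\
        forall (i : 'I_k) (U : set R), measurable U ->
          P [set w | U ((W t w - W s w) i ord0)] =
          normal_prob 0 (Num.sqrt (t - s)) U
    & forall n (t : nat -> R), 0 <= t 0%N ->
        {homo t : i j / (i <= j)%N >-> i <= j} ->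
        independent_rvs P (fun (i : 'I_n) w => W (t i.+1) w - W (t i) w)].

Definition random_measure_sigma d' (T : measurableType d')
    (nu : R.-ker Omega ~> T) : set (set Omega) :=
  <<s [set E | exists A (U : set \bar R),
        [/\ measurable A, measurable U & E = (nu ^~ A) @^-1` U]] >>.

(* The second argument of [poisson_prob] is a dummy. *)
Definition poisson_random_measure d' (T : measurableType d')
    (mu : set T -> \bar R) (nu : R.-ker Omega ~> T) : Prop :=
  [/\ forall A n, measurable A -> (mu A < +oo)%E ->
        P [set w | nu w A = n%:R%:E] = poisson_prob (fine (mu A)) 0 [set n],
      forall A, measurable A -> mu A = +oo%E ->
        P [set w | nu w A = +oo%E] = 1%E
    & forall n (A : 'I_n -> set T), (forall i, measurable (A i)) ->
        trivIset setT A -> independent_rvs P (fun i w => nu w (A i))].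

Section levy_ito.
Context (dim : nat) (Pi : {measure set 'cV[R]_dim -> \bar R})
        (nu : R.-ker Omega ~> (R * 'cV[R]_dim)%type).

(* [dt x Pi(du)] on [0, +oo[ x R^d, viewed as a measure on R x R^d. *)
Definition jump_intensity (A : set (R * 'cV[R]_dim)) : \bar R :=
  (lebesgue_measure \x Pi)%E (A `&` [set p | 0 <= p.1]).

Definition large_jumps (t : R) (w : Omega) : 'cV[R]_dim :=
  cV_integral (nu w) (`]0, t] `*` [set u | 1 < enorm u]) snd.

Definition compensated_jumps (e t : R) (w : Omega) : 'cV[R]_dim :=
  cV_integral (nu w) (`]0, t] `*` [set u | e < enorm u <= 1]) snd
  - t *: cV_integral Pi [set u | e < enorm u <= 1] id.

(* [Y] is (a version of) the integral of [u] over [0, t] x {|u| <= 1} with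
   respect to the compensated measure: since [u] need not be integrable near
   the origin, this is a limit in L^2(P), not a Lebesgue integral. *)
Definition small_jumps (t : R) (Y : Omega -> 'cV[R]_dim) : Prop :=
  measurable_fun setT Y /\
  (\int[P]_w (enorm (Y w - compensated_jumps e t w) ^+ 2)%:E)%E
    @[e --> 0^'+] --> 0%E.

Definition jump_levy_process (Z : R -> Omega -> 'cV[R]_dim) : Prop :=
  [/\ forall t, 0 <= t -> measurable_fun setT (Z t),
      {ae P, forall w, cadlag (fun t => Z t w)}
    & forall t, 0 <= t -> exists2 Y, small_jumps t Y &
        {ae P, forall w, Z t w = large_jumps t w + Y w}].

End levy_ito.

(* Solutions are random processes with locally bounded (and Borel, so that the
   integral makes sense) trajectories. *)
Definition linear_sde_solution m k d (A : 'M[R]_m) (B : 'M[R]_(m, k))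
    (D : 'M[R]_(m, d)) (W : R -> Omega -> 'cV[R]_k)
    (Z : R -> Omega -> 'cV[R]_d) (X : R -> Omega -> 'cV[R]_m) : Prop :=
  (forall t, 0 <= t -> measurable_fun setT (X t)) /\
  {ae P, forall w,
    [/\ forall t : R, 0 <= t -> [bounded X s w | s in `[0, t]],
        forall t : R, 0 <= t -> measurable_fun (`[0, t] : set R) (fun s => X s w)
      & forall t, 0 <= t ->
          X t w = cV_integral lebesgue_measure `[0, t] (fun s => A *m X s w)
                  + B *m W t w + D *m Z t w]}.

End processes.

Definition controllability_mx (R : realType) m k d (A : 'M[R]_m)
    (B : 'M[R]_(m, k)) (D : 'M[R]_(m, d)) :=
  row_mx (\mxrow_(j < m) (A ^+ j *m B)) (\mxrow_(j < m) (A ^+ j *m D)).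

Definition iter_partial (R : realType) m (s : seq 'I_m) (f : 'cV[R]_m -> R) :
    'cV[R]_m -> R :=
  foldr (fun i g => 'D_(delta_mx i ord0) g) f s.

(* Frechet differentiability of all iterated partial derivatives; the library's
   derivative is total, so differentiability has to be asked for explicitly. *)
Definition Cb_infty (R : realType) m (f : 'cV[R]_m -> R) : Prop :=
  forall s : seq 'I_m,
    (forall x, differentiable (iter_partial s f) x) /\
    bounded_fun (iter_partial s f).

Definition has_density (R : realType) m (mu : set 'cV[R]_m -> \bar R)
    (p : 'cV[R]_m -> R) : Prop :=
  (forall x, 0 <= p x) /\
  forall U, measurable U -> mu U = (\int[lebesgue_cV R m]_(x in U) (p x)%:E)%E.

(* Main.v *)
Require Import Defs.
From HB Require Import structures.
From mathcomp Require Import all_boot all_order all_algebra.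
From mathcomp Require Import all_classical all_reals all_analysis.
From mathcomp Require Import measurable_realfun.
From mathcomp Require Import ring lra.

Set Implicit Arguments.
Unset Strict Implicit.
Unset Printing Implicit Defensive.

Import Order.TTheory GRing.Theory Num.Theory.
Import numFieldNormedType.Exports.

Local Open Scope classical_set_scope.
Local Open Scope ring_scope.

(* Idea: the characteristic function of X(t) decays faster than every power, and
   Fourier inversion then gives a density all of whose derivatives are bounded.
   Gronwall's inequality makes the Euler scheme with n steps converge pathwise to
   X(t). Tested against z, the scheme is a finite sum of increments of W and Z
   with weights B^T E^j z and D^T E^j z, where E = 1 + (t/n) A^T, so its
   characteristic function is a product, computed from the Gaussian law of W and
   from compound Poisson approximations of Z. The rank condition forces at least a
   fixed proportion of these weights to be of size at least c |z|. Each large weight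
   contributes to the exponent at least K ln|z|, for every K: from W even a
   quadratic amount, and from Z by the condition on the directional moments, which
   bounds the integral of 1 - cos(q, u) below by K ln|q|. *)

(** The process Z is given only through its values at fixed times, with the small jumps as an L^2
    limit, and W only through its increments. The time discretisation reduces everything to finitely
    many increments, so that no stochastic integral of the matrix exponential is needed. The price
    is uniformity: for each n the cutoff of small jumps is removed first, then n tends to infinity,
    and the bound must not depend on n. It does not, because a fixed proportion of the n terms, each
    of weight t/n, contributes. The rank condition speaks of the vectors A^p z (transposed), whereas
    the weights involve E^j z; finite differences of the latter recover the former up to a small
    error. Squared moduli are multiplicative over independent terms and insensitive to deterministic
    shifts, hence to the compensating drift, which may diverge as the cutoff tends to 0. A
    logarithmic exponent suffices because exp(-K ln|z|) = |z|^(-K), and K is chosen after the power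
    of decay that is sought. Inversion only produces a candidate density; a Gaussian mollification
    of the law identifies it. *)

(** * Squared modulus of characteristic functions *)

Lemma bounded_integrable (R : realType) d (T : measurableType d)
    (mu : {finite_measure set T -> \bar R}) (f : T -> R) (C : R) :
  measurable_fun setT f -> (forall x, `|f x| <= C) ->
  mu.-integrable setT (EFin \o f).
Proof.
move=> mf fC; apply: measurable_bounded_integrable => //.
  exact: fin_num_fun_lty.
exists C; split; first exact: num_real.
by move=> y Cy x _; exact: le_trans (fC x) (ltW Cy).
Qed.

Lemma Rintegral_cvg_bounded (R : realType) d (T : measurableType d)
    (mu : {finite_measure set T -> \bar R}) (f_ : nat -> T -> R) (f : T -> R) (C : R) :
  (forall n, measurable_fun setT (f_ n)) -> measurable_fun setT f ->
  (forall n x, `|f_ n x| <= C) ->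
  {ae mu, forall x, f_ n x @[n --> \oo] --> f x} ->
  \int[mu]_x f_ n x @[n --> \oo] --> \int[mu]_x f x.
Proof.
move=> mf_ mf fC ff.
have := @dominated_convergence _ T R mu setT measurableT
  (fun n x => (f_ n x)%:E) (EFin \o f) (cst C%:E).
case.
- by move=> n; apply/measurable_EFinP.
- exact/measurable_EFinP.
- by apply: filterS ff => x fx _; apply: cvg_EFin => //; exact: nearW.
- exact: (@bounded_integrable _ _ _ mu (cst C) `|C|).
- by apply: aeW => x n _; rewrite lee_fin.
move=> intf _ H.
apply: fine_cvg; rewrite fineK //.
by apply: integrable_fin_num.
Qed.

(** The range of [f] is cut into bands of height [e]. The number of pieces depends on [K] and [e]
    only, so that partitions made for different functions share one index type. *)
Lemma step_partition (R : realType) d (T : measurableType d) (D : set T)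
    (f : T -> R) (K e : R) :
  measurable D -> measurable_fun setT f -> (forall x, D x -> `|f x| <= K) -> 0 < e ->
  exists (A : 'I_(Num.truncn ((K + K) / e)).+1 -> set T) (a : 'I_(Num.truncn ((K + K) / e)).+1 -> R),
    [/\ forall i, measurable (A i), trivIset setT A, \bigcup_i A i = D
      & forall i x, A i x -> `|f x - a i| <= e].
Proof.
move=> mD mf fK e0.
pose N := (Num.truncn ((K + K) / e)).+1.
pose a (i : 'I_N) := - K + e * i%:R.
pose A (i : 'I_N) := D `&` (f @^-1` `[a i, a i + e[).
have E (i : 'I_N) x : a i <= f x < a i + e -> (i : nat) = Num.truncn ((f x + K) / e).
  rewrite /a => /andP[h1 h2]; apply/esym/eqP; rewrite truncn_eq; last first.
    rewrite divr_ge0 ?(ltW e0) //; have : 0 <= e * i%:R by rewrite mulr_ge0 ?(ltW e0).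
    lra.
  rewrite ler_pdivlMr // ltr_pdivrMr // -natr1; apply/andP; split; lra.
exists A, a; split => [i|||].
- apply: measurableI => //; rewrite -[X in measurable X]setTI; exact: mf.
- apply/trivIsetP => i j _ _ ij; rewrite -subset0 => x.
  rewrite /A /= !in_itv /= => -[[_ /E hi] [_ /E hj]].
  by move/eqP: ij; apply; apply: val_inj; rewrite /= hi hj.
- apply/seteqP; split => [x [i _ []] //|x Dx].
  have := fK _ Dx; rewrite ler_norml => /andP[l1 l2].
  have h0 : 0 <= (f x + K) / e by rewrite divr_ge0 ?(ltW e0)//; lra.
  have iN : (Num.truncn ((f x + K) / e) < N)%N.
    rewrite ltnS; apply: le_truncn; rewrite ler_pM2r ?invr_gt0 //; lra.
  exists (Ordinal iN) => //; split=> //=; rewrite in_itv /= /a /=.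
  have /andP[] := truncn_itv h0.
  rewrite ler_pdivlMr // ltr_pdivrMr // -natr1 => u1 u2; apply/andP; split; lra.
- move=> i x [_] /=; rewrite in_itv /= => /andP[h1 h2].
  rewrite ler_norml; apply/andP; split; lra.
Qed.

Lemma step_approx (R : realType) d (T : measurableType d) (f : T -> R) (K e : R) :
  measurable_fun setT f -> (forall x, `|f x| <= K) -> 0 < e ->
  exists N (A : 'I_N -> set T) (a : 'I_N -> R), (forall i, measurable (A i)) /\
    forall x, `|f x - \sum_(i < N) a i * \1_(A i) x| <= e.
Proof.
move=> mf fK e0.
have [A [a [mA tA AT Aa]]] := step_partition measurableT mf (fun x _ => fK x) e0.
exists _, A, a; split=> // x.
have : (\bigcup_i A i) x by rewrite AT.
move=> [i _ Aix]; rewrite (bigD1 i) //= big1 ?addr0; last first.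
  move=> j ji; rewrite indicE memNset ?mulr0 // => Ajx.
  by have := tA j i I I (ex_intro _ x (conj Ajx Aix)) => /eqP; rewrite (negbTE ji).
by rewrite indicE mem_set // mulr1; exact: Aa.
Qed.

Lemma ler0_eps (R : realFieldType) (x C : R) :
  (forall e, 0 < e -> `|x| <= C * e) -> x = 0.
Proof.
move=> h; apply/eqP; rewrite -normr_le0; apply/ler_addgt0Pr => e e0; rewrite add0r.
have C0 : 0 < `|C| + 1 by rewrite ltr_wpDl.
apply: le_trans (h (e / (`|C| + 1)) _) _; first by rewrite divr_gt0.
rewrite mulrCA ler_piMr ?(ltW e0) // ler_pdivrMr // mul1r.
by apply: le_trans (ler_norm C) _; rewrite lerDl.
Qed.

Lemma Rintegral_sum (R : realType) d (T : measurableType d)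
    (mu : {measure set T -> \bar R}) (D : set T) (N : nat) (g : 'I_N -> T -> R) :
  measurable D -> (forall i, mu.-integrable D (EFin \o g i)) ->
  \int[mu]_(x in D) (\sum_(i < N) g i x) = \sum_(i < N) \int[mu]_(x in D) g i x.
Proof.
move=> mD Ig; rewrite /Rintegral; under eq_integral do rewrite -sumEFin.
rewrite integral_sum // sum_fine // => i _.
by apply: integrable_fin_num => //; exact: Ig.
Qed.

Section expectation.
Context (R : realType) d (Omega : measurableType d) (P : probability Omega R).

Lemma Rint_dist (f g : Omega -> R) (e C : R) :
  measurable_fun setT f -> measurable_fun setT g ->
  (forall x, `|f x| <= C) -> (forall x, `|g x| <= C) ->
  (forall x, `|f x - g x| <= e) ->
  `|\int[P]_x f x - \int[P]_x g x| <= e.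
Proof.
move=> mf mg fC gC fg.
have If := bounded_integrable P mf fC.
have Ig := bounded_integrable P mg gC.
have Ifg : P.-integrable setT (EFin \o (fun x => f x - g x)).
  exact: (integrableB measurableT If Ig).
rewrite -RintegralB //; apply: le_trans (le_normr_Rintegral _ _) _ => //.
have -> : e = \int[P]_x (cst e x).
  by transitivity (e * fine (P setT));
    [rewrite probability_setT mulr1|rewrite -Rintegral_cst].
apply: le_Rintegral => //.
- exact: integrable_norm.
- exact: finite_measure_integrable_cst.
Qed.

(** Independence enters only as a factorisation against indicators of [Y]; uniform approximation of
    [f] by step functions extends it. [H] may be any bounded function, which lets [mod2_sum] use a
    trigonometric function of a partial sum times an indicator. *)
Lemma Rint_indep d' (T : measurableType d') (Y : Omega -> T) (H : Omega -> R) (C : R)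
    (f : T -> R) (K : R) :
  measurable_fun setT Y -> measurable_fun setT H -> (forall w, `|H w| <= C) ->
  (forall U, measurable U -> \int[P]_w (\1_U (Y w) * H w) =
                             fine (P (Y @^-1` U)) * \int[P]_w H w) ->
  measurable_fun setT f -> (forall x, `|f x| <= K) ->
  \int[P]_w (f (Y w) * H w) = \int[P]_w f (Y w) * \int[P]_w H w.
Proof.
move=> mY mH HC HU mf fK.
apply/eqP; rewrite -subr_eq0; apply/eqP.
have C0 : 0 <= C by apply: le_trans (HC point).
have K0 : 0 <= K by apply: le_trans (fK point).
(* Replacing [f] by a step function costs [C * e] under the joint integral and [e] times the
   integral of [H] in the product. *)
apply: (@ler0_eps _ _ (C + `|\int[P]_w H w|)) => e e0.
have [N [A [a [mA fs]]]] := step_approx mf fK e0.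
pose s x := \sum_(i < N) a i * \1_(A i) x.
have ms : measurable_fun setT s.
  apply: measurable_sum => i; apply: measurable_funM => //.
have sK x : `|s x| <= K + e.
  have -> : s x = f x - (f x - s x) by rewrite opprB addrCA subrr addr0.
  apply: le_trans (ler_normB _ _) _; exact: lerD.
have mfY : measurable_fun setT (f \o Y) by exact: measurableT_comp.
have msY : measurable_fun setT (s \o Y) by exact: measurableT_comp.
have Ii i : P.-integrable setT (EFin \o (fun w => \1_(A i) (Y w) * H w)).
  apply: (@bounded_integrable _ _ _ _ _ C).
    apply: measurable_funM => //; exact: measurableT_comp.
  move=> x; rewrite normrM -[leRHS]mul1r ler_pM // indicE.
  by case: (_ \in _); rewrite ?normr1 ?normr0.
have Ii' i : P.-integrable setT (EFin \o (fun w => \1_(A i) (Y w))).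
  apply: (@bounded_integrable _ _ _ _ _ 1); first exact: measurableT_comp.
  by move=> x; rewrite indicE; case: (_ \in _); rewrite ?normr1 ?normr0.
have Rsum (g : 'I_N -> Omega -> R) : (forall i, P.-integrable setT (EFin \o g i)) ->
    \int[P]_w (\sum_(i < N) a i * g i w) = \sum_(i < N) a i * \int[P]_w (g i w).
  move=> Ig; rewrite Rintegral_sum // => [|i].
    by apply: eq_bigr => i _; rewrite RintegralZl.
  exact: (integrableZl measurableT (a i) (Ig i)).
have sH : \int[P]_w (s (Y w) * H w) = \int[P]_w s (Y w) * \int[P]_w H w.
  have -> : (fun w => s (Y w) * H w) =
      (fun w => \sum_(i < N) a i * (\1_(A i) (Y w) * H w)).
    by apply/funext => w; rewrite /s mulr_suml; apply: eq_bigr => i _; rewrite mulrA.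
  rewrite Rsum // /s Rsum // mulr_suml; apply: eq_bigr => i _; rewrite HU // mulrA.
  congr (_ * _ * _); rewrite /Rintegral; congr fine.
  have := integral_indic P measurableT (_ : measurable (Y @^-1` A i)).
  rewrite setIT => <- //; rewrite -[X in measurable X]setTI; exact: mY.
have -> : \int[P]_w (f (Y w) * H w) - \int[P]_w f (Y w) * \int[P]_w H w =
   (\int[P]_w (f (Y w) * H w) - \int[P]_w (s (Y w) * H w)) -
   (\int[P]_w f (Y w) - \int[P]_w s (Y w)) * \int[P]_w H w.
  rewrite sH; ring.
apply: le_trans (ler_normB _ _) _; rewrite [leRHS]mulrDl lerD //.
  apply: (@Rint_dist _ _ _ ((K + e) * C)).
  - exact: measurable_funM.
  - exact: measurable_funM.
  - by move=> w; rewrite normrM ler_pM // (le_trans (fK _))// lerDl ltW.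
  - by move=> w; rewrite normrM ler_pM.
  - by move=> w; rewrite -mulrBl normrM mulrC ler_pM.
rewrite normrM mulrC ler_wpM2l //; apply: (@Rint_dist _ _ _ (K + e)) => //.
by move=> w; rewrite (le_trans (fK _))// lerDl ltW.
Qed.

(* The squared modulus of E[exp(iX)], split into cosine and sine so that all
   integrals are real. *)
Definition mod2 (X : Omega -> R) : R :=
  (\int[P]_w cos (X w)) ^+ 2 + (\int[P]_w sin (X w)) ^+ 2.

End expectation.

Section mod2_theory.
Context (R : realType) d (Omega : measurableType d) (P : probability Omega R).

Lemma normr_cos_le1 (x : R) : `|cos x| <= 1.
Proof. by rewrite ler_norml cos_geN1 cos_le1. Qed.

Lemma normr_sin_le1 (x : R) : `|sin x| <= 1.
Proof. by rewrite ler_norml sin_geN1 sin_le1. Qed.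

Lemma measurable_cos_comp d' (T : measurableType d') (X : T -> R) : measurable_fun setT X ->
  measurable_fun setT (fun w => cos (X w)).
Proof.
move=> mX; apply: (measurableT_comp _ mX).
by apply: continuous_measurable_fun; exact: continuous_cos.
Qed.

Lemma measurable_sin_comp d' (T : measurableType d') (X : T -> R) : measurable_fun setT X ->
  measurable_fun setT (fun w => sin (X w)).
Proof.
move=> mX; apply: (measurableT_comp _ mX).
by apply: continuous_measurable_fun; exact: continuous_sin.
Qed.

Lemma normr_indic_le1 T (A : set T) (x : T) : `|\1_A x : R| <= 1.
Proof. by rewrite indicE; case: (_ \in _); rewrite ?normr1 ?normr0. Qed.

Lemma Rintegral_indic (A : set Omega) : measurable A ->
  \int[P]_w \1_A w = fine (P A).
Proof. by move=> mA; rewrite /Rintegral integral_indic // setIT. Qed.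

Lemma Rint_cst (r : R) : \int[P]_(w in setT) r = r.
Proof.
by transitivity (r * fine (P setT));
  [rewrite -Rintegral_cst|rewrite probability_setT mulr1].
Qed.

(** The spare factor [Z] makes room for the indicator carried along in the induction of
    [mod2_sum]. *)
Lemma Rint_cosD (X Y Z : Omega -> R) : measurable_fun setT X -> measurable_fun setT Y ->
  measurable_fun setT Z -> (forall w, `|Z w| <= 1) ->
  \int[P]_w (cos (X w + Y w) * Z w) =
  \int[P]_w (cos (Y w) * (cos (X w) * Z w)) - \int[P]_w (sin (Y w) * (sin (X w) * Z w)).
Proof.
move=> mX mY mZ Z1; rewrite -RintegralB //.
- by apply: eq_Rintegral => w _; rewrite cosD; ring.
- apply: (@bounded_integrable _ _ _ _ _ 1) => [|w].
    by repeat apply: measurable_funM => //; apply: measurable_cos_comp.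
  by rewrite normrM mulr_ile1 ?normr_cos_le1 // normrM mulr_ile1 ?normr_cos_le1.
- apply: (@bounded_integrable _ _ _ _ _ 1) => [|w].
    by repeat apply: measurable_funM => //; apply: measurable_sin_comp.
  by rewrite normrM mulr_ile1 ?normr_sin_le1 // normrM mulr_ile1 ?normr_sin_le1.
Qed.

Lemma Rint_sinD (X Y Z : Omega -> R) : measurable_fun setT X -> measurable_fun setT Y ->
  measurable_fun setT Z -> (forall w, `|Z w| <= 1) ->
  \int[P]_w (sin (X w + Y w) * Z w) =
  \int[P]_w (cos (Y w) * (sin (X w) * Z w)) + \int[P]_w (sin (Y w) * (cos (X w) * Z w)).
Proof.
move=> mX mY mZ Z1; rewrite -RintegralD //.
- by apply: eq_Rintegral => w _; rewrite sinD; ring.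
- apply: (@bounded_integrable _ _ _ _ _ 1) => [|w].
    repeat apply: measurable_funM => //.
      exact: measurable_cos_comp.
    exact: measurable_sin_comp.
  by rewrite normrM mulr_ile1 ?normr_cos_le1 // normrM mulr_ile1 ?normr_sin_le1.
- apply: (@bounded_integrable _ _ _ _ _ 1) => [|w].
    repeat apply: measurable_funM => //.
      exact: measurable_sin_comp.
    exact: measurable_cos_comp.
  by rewrite normrM mulr_ile1 ?normr_sin_le1 // normrM mulr_ile1 ?normr_cos_le1.
Qed.

Lemma mod2_ae_eq (X Y : Omega -> R) : measurable_fun setT X -> measurable_fun setT Y ->
  {ae P, forall w, X w = Y w} -> mod2 P X = mod2 P Y.
Proof.
move=> mX mY XY; rewrite /mod2 /Rintegral; congr (fine _ ^+ 2 + fine _ ^+ 2);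
  apply: ae_eq_integral => //; try (apply/measurable_EFinP);
  try exact: measurable_cos_comp; try exact: measurable_sin_comp;
  by apply: filterS XY => w -> .
Qed.

Lemma mod2_cvg (X_ : nat -> Omega -> R) (X : Omega -> R) :
  (forall n, measurable_fun setT (X_ n)) -> measurable_fun setT X ->
  {ae P, forall w, X_ n w @[n --> \oo] --> X w} ->
  mod2 P (X_ n) @[n --> \oo] --> mod2 P X.
Proof.
move=> mX_ mX XX; rewrite /mod2; apply: cvgD;
  apply: (@cvg_comp _ _ _ _ (fun x : R => x ^+ 2) _ _ _ _ (@exprn_continuous _ 2 _));
  apply: (@Rintegral_cvg_bounded _ _ _ _ _ _ 1).
- by move=> n; exact: measurable_cos_comp.
- exact: measurable_cos_comp.
- by move=> n w; exact: normr_cos_le1.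
- by apply: filterS XX => w Xw; apply: (cvg_comp _ _ Xw); exact: continuous_cos.
- by move=> n; exact: measurable_sin_comp.
- exact: measurable_sin_comp.
- by move=> n w; exact: normr_sin_le1.
- by apply: filterS XX => w Xw; apply: (cvg_comp _ _ Xw); exact: continuous_sin.
Qed.

(** The expectations factor by two uses of [Rint_indep], first against an indicator of [Y], then
    against a function of [Y]; the addition formulas and the identity (cC - sS)^2 + (sC + cS)^2 =
    (c^2 + s^2)(C^2 + S^2) conclude. *)
Lemma mod2_indep (X Y : Omega -> R) : measurable_fun setT X -> measurable_fun setT Y ->
  (forall U V : set R, measurable U -> measurable V ->
    P (X @^-1` U `&` Y @^-1` V) = (P (X @^-1` U) * P (Y @^-1` V))%E) ->
  mod2 P (fun w => X w + Y w) = mod2 P X * mod2 P Y.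
Proof.
move=> mX mY XY.
have mXU (U : set R) : measurable U -> measurable (X @^-1` U).
  by move=> mU; rewrite -[X in measurable X]setTI; exact: mX.
have mYU (U : set R) : measurable U -> measurable (Y @^-1` U).
  by move=> mU; rewrite -[X in measurable X]setTI; exact: mY.
have st1 (f : R -> R) (V : set R) : measurable_fun setT f -> (forall x, `|f x| <= 1) -> measurable V ->
    \int[P]_w (f (X w) * \1_V (Y w)) = \int[P]_w f (X w) * \int[P]_w \1_V (Y w).
  move=> mf f1 mV; apply: (@Rint_indep _ _ _ P _ _ X (fun w => \1_V (Y w)) 1 f 1) => //.
  - exact: measurableT_comp.
  - by move=> w; exact: normr_indic_le1.
  move=> U mU.
  have -> : (fun w => \1_U (X w) * \1_V (Y w) : R) = \1_(X @^-1` U `&` Y @^-1` V).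
    by apply/funext => w; rewrite indicI.
  rewrite Rintegral_indic; last by apply: measurableI; auto.
  rewrite XY // fineM ?fin_num_measure //; auto.
  by congr (_ * _); rewrite -Rintegral_indic; auto.
have st2 (f g : R -> R) : measurable_fun setT f -> (forall x, `|f x| <= 1) ->
    measurable_fun setT g -> (forall x, `|g x| <= 1) ->
    \int[P]_w (g (Y w) * f (X w)) = \int[P]_w g (Y w) * \int[P]_w f (X w).
  move=> mf f1 mg g1; apply: (@Rint_indep _ _ _ P _ _ Y (fun w => f (X w)) 1 g 1) => //.
  - exact: measurableT_comp.
  move=> U mU; under eq_Rintegral do rewrite mulrC.
  rewrite st1 // mulrC; congr (_ * _).
  by rewrite -Rintegral_indic; auto.
have mc : measurable_fun setT (@cos R) by exact: (@measurable_cos_comp _ _ id).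
have ms : measurable_fun setT (@sin R) by exact: (@measurable_sin_comp _ _ id).
have m1 : measurable_fun setT (cst 1 : Omega -> R) by [].
have n1 (w : Omega) : `|cst 1 w : R| <= 1 by rewrite normr1.
have := @Rint_cosD X Y (cst 1) mX mY m1 n1.
have := @Rint_sinD X Y (cst 1) mX mY m1 n1.
rewrite /mod2 /=.
under eq_Rintegral do rewrite mulr1.
under [X in _ = X + _]eq_Rintegral do rewrite mulr1.
under [X in _ = _ + X]eq_Rintegral do rewrite mulr1.
move=> ->.
under eq_Rintegral do rewrite mulr1.
under [X in _ = X - _]eq_Rintegral do rewrite mulr1.
under [X in _ = _ - X]eq_Rintegral do rewrite mulr1.
move=> ->.
rewrite !st2 //; try exact: normr_cos_le1; try exact: normr_sin_le1.
ring.
Qed.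

(** A constant is independent of everything and has modulus 1. This discards the compensating drift
    later. *)
Lemma mod2D_cst (X : Omega -> R) (c : R) : measurable_fun setT X ->
  mod2 P (fun w => X w + c) = mod2 P X.
Proof.
move=> mX; rewrite (@mod2_indep X (cst c)) //.
  by rewrite {2}/mod2 /= !Rint_cst cos2Dsin2 mulr1.
move=> U V mU mV; rewrite preimage_cst; case: ifPn => _.
  by rewrite setIT probability_setT mule1.
by rewrite setI0 !measure0 mule0.
Qed.

(** Independence is stated for the whole family at once, so partial sums are never separated from
    the remaining variables: the induction tests them against events on those variables. *)
Lemma mod2_sum n d' (T : measurableType d') (Y : 'I_n -> Omega -> T) (g : 'I_n -> T -> R) :
  independent_rvs P Y -> (forall i, measurable_fun setT (Y i)) ->
  (forall i, measurable_fun setT (g i)) ->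
  mod2 P (fun w => \sum_(i < n) g i (Y i w)) = \prod_(i < n) mod2 P (fun w => g i (Y i w)).
Proof.
move=> ind mY mg.
pose S k w := \sum_(i < n | (i < k)%N) g i (Y i w).
pose E (U : 'I_n -> set T) := [set w | forall i, U i (Y i w)].
have mYU i (U : set T) : measurable U -> measurable (Y i @^-1` U).
  by move=> mU; rewrite -[X in measurable X]setTI; exact: mY.
have mS k : measurable_fun setT (S k).
  have -> : S k = (fun w => \sum_(i < n) if (i < k)%N then g i (Y i w) else 0).
    by apply/funext => w; rewrite /S big_mkcond.
  by apply: measurable_sum => i; case: (i < k)%N => //; exact: measurableT_comp.
have mE U : (forall i, measurable (U i)) -> measurable (E U).
  move=> mU; have -> : E U = \bigcap_(i in [set: 'I_n]) Y i @^-1` U i.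
    by apply/seteqP; split=> w /= h i; [move=> _; exact: h|exact: (h i Logic.I)].
  by apply: fin_bigcap_measurable => // i _; exact: mYU.
have m1E U : (forall i, measurable (U i)) -> measurable_fun setT (\1_(E U) : Omega -> R).
  by move=> mU; apply: measurable_indic; exact: mE.
(* A coordinate whose constraint is [setT] can be given any constraint [V], at the cost of a
   factor. *)
have PE k (V : set T) U (kn : (k < n)%N) : measurable V -> (forall i, measurable (U i)) ->
    U (Ordinal kn) = setT ->
    fine (P (E (fun i => if i == Ordinal kn then V else U i))) =
    fine (P (Y (Ordinal kn) @^-1` V)) * fine (P (E U)).
  move=> mV mU UT; rewrite -fineM ?fin_num_measure //; [|exact: mYU|exact: mE].
  have mU' i : measurable (if i == Ordinal kn then V else U i) by case: ifP.
  rewrite /E (ind _ mU) (ind _ mU').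
  rewrite [in LHS](bigD1 (Ordinal kn)) //= eqxx [in RHS](bigD1 (Ordinal kn)) //=.
  rewrite UT preimage_setT probability_setT mul1e; congr (fine (_ * _)%E).
  by apply: eq_bigr => i /negbTE ->.
(* The pair (c, s) is the characteristic function of the first [k] terms as a complex number; the
   events that may be tested leave these [k] variables free. *)
have key k : (k <= n)%N -> exists c s : R,
    c ^+ 2 + s ^+ 2 = \prod_(i < n | (i < k)%N) mod2 P (fun w => g i (Y i w)) /\
    forall U, (forall i, measurable (U i)) -> (forall i : 'I_n, (i < k)%N -> U i = setT) ->
    \int[P]_w (cos (S k w) * \1_(E U) w) = c * fine (P (E U)) /\
    \int[P]_w (sin (S k w) * \1_(E U) w) = s * fine (P (E U)).
  elim: k => [_|k IH kn].
    exists 1, 0; rewrite big_pred0 //; split; first by rewrite expr0n /= addr0 expr1n.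
    move=> U mU _; have S0 w : S 0%N w = 0 by rewrite /S big_pred0.
    split; first by under eq_Rintegral do rewrite S0 cos0 mul1r;
      rewrite mul1r Rintegral_indic //; exact: mE.
    under eq_Rintegral do rewrite S0 sin0 mul0r.
    by rewrite mul0r Rintegral_cst // mul0r.
  have [c [s [cs H]]] := IH (ltnW kn).
  pose i0 := Ordinal kn; pose y w := g i0 (Y i0 w).
  pose C := \int[P]_w cos (y w); pose D := \int[P]_w sin (y w).
  have iE (i : 'I_n) : ((i < k.+1)%N && (i != i0)) = (i < k)%N.
    by rewrite ltnS -val_eqE /= ltn_neqAle andbC.
  exists (c * C - s * D), (s * C + c * D); split.
    rewrite (bigD1 i0) //= (eq_bigl _ _ iE) -cs /mod2 -/C -/D; ring.
  move=> U mU UT.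
  have SE : S k.+1 = (fun w => S k w + y w).
    apply/funext => w; rewrite /S (bigD1 i0) //= addrC; congr (_ + _).
    by apply: eq_bigl.
  (* The term number [k] is split off: an indicator of [Y i0] is absorbed into the event, whose
     constraint at [i0] is still [setT], and the induction hypothesis applies to the new event. *)
  have mid (h : R -> R) (e : R) : measurable_fun setT h -> (forall x, `|h x| <= 1) ->
      (forall U, (forall i, measurable (U i)) -> (forall i : 'I_n, (i < k)%N -> U i = setT) ->
        \int[P]_w (h (S k w) * \1_(E U) w) = e * fine (P (E U))) ->
      forall f : R -> R, measurable_fun setT f -> (forall x, `|f x| <= 1) ->
      \int[P]_w (f (y w) * (h (S k w) * \1_(E U) w)) = \int[P]_w f (y w) * (e * fine (P (E U))).
    move=> mh h1 He f mf f1.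
    have UTk (i : 'I_n) : (i < k)%N -> U i = setT by move=> ik; apply: UT; exact: ltnW.
    rewrite -He //.
    apply: (@Rint_indep _ _ _ P _ _ (Y i0) (fun w => h (S k w) * \1_(E U) w) 1 (f \o g i0) 1) => //.
    - by apply: measurable_funM; [exact: measurableT_comp|exact: m1E].
    - by move=> w; rewrite normrM mulr_ile1 ?normr_indic_le1.
    - move=> V mV; rewrite He // mulrCA -PE //; last by apply: UT => /=.
      rewrite -He; first last.
      + by move=> i ik; rewrite ifN ?UTk // -val_eqE /= ltn_eqF.
      + by move=> i; case: ifP.
      apply: eq_Rintegral => w _; rewrite mulrCA; congr (_ * _).
      rewrite -[LHS]/(((\1_(Y i0 @^-1` V)) w * \1_(E U) w) : R).
      transitivity (\1_(Y i0 @^-1` V `&` E U) w : R); first by rewrite indicI.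
      congr (\1_ _ w); apply/seteqP; split=> [w' /= [Vw Uw] i|w' /= Uw].
        by case: eqP => [->|].
      split; first by have := Uw i0; rewrite eqxx.
      by move=> i; have := Uw i; case: eqP => // -> _; rewrite (UT i0) /=.
    - exact: measurableT_comp.
    - by move=> x; exact: f1.
  have mc : measurable_fun setT (@cos R) by exact: (@measurable_cos_comp _ _ id).
  have ms : measurable_fun setT (@sin R) by exact: (@measurable_sin_comp _ _ id).
  have midc := mid _ c mc normr_cos_le1 (fun U a b => (H U a b).1).
  have mids := mid _ s ms normr_sin_le1 (fun U a b => (H U a b).2).
  have my : measurable_fun setT y by exact: measurableT_comp.
  split.
    rewrite SE Rint_cosD //; [|exact: m1E|exact: normr_indic_le1].
    rewrite midc // ?mids //; [rewrite -/C -/D; ring|exact: normr_sin_le1|exact: normr_cos_le1].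
  rewrite SE Rint_sinD //; [|exact: m1E|exact: normr_indic_le1].
  rewrite midc // ?mids //; [rewrite -/C -/D; ring|exact: normr_cos_le1|exact: normr_sin_le1].
have [c [s [cs H]]] := key n (leqnn n).
have [|//|H1 H2] := H (fun=> setT) => //.
have SE : (fun w => \sum_(i < n) g i (Y i w)) = S n.
  by apply/funext => w; apply: eq_bigl => i; rewrite ltn_ord.
have ET : E (fun=> setT) = setT by apply/seteqP; split.
have -> : \prod_(i < n) mod2 P (fun w => g i (Y i w)) = c ^+ 2 + s ^+ 2.
  by rewrite cs; apply: eq_bigl => i; rewrite ltn_ord.
move: H1 H2; rewrite ET probability_setT !mulr1 SE /mod2 => <- <-.
congr (_ ^+ 2 + _ ^+ 2); apply: eq_Rintegral => w _; rewrite indicE in_setT mulr1 //.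
Qed.

End mod2_theory.

(** * Characteristic functions of Poisson, Gaussian and Wiener variables *)

Section poisson_characteristic.
Context (R : realType) (a : R).

(** With phase 0 the series of [fc] is the real part of exp(x e^(ia)), with phase pi/2 it is minus
    the imaginary part. Differentiating in x shifts the phase by [a], which keeps the whole
    computation real. *)
Let fc (th : R) (n : nat) : R := cos (n%:R * a + th) / n`!%:R.

Let is_cvg_fc th x : cvgn (pseries (fc th) x).
Proof.
apply: normed_cvg; apply: (@series_le_cvg _ _ (exp_coeff `|x|)) => [n|n|n|].
- exact: normr_ge0.
- by rewrite /exp_coeff divr_ge0 ?exprn_ge0.
- rewrite /exp_coeff /fc /= normrM normf_div normrX (ger0_norm (ler0n _ _)).
  rewrite mulrAC -mulrA ler_piMl ?normr_cos_le1 //.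
- exact: is_cvg_series_exp_coeff.
Qed.

Let diffs_fc th : pseries_diffs (fc th) = fc (th + a).
Proof.
apply/funext => n; rewrite /pseries_diffs /fc factS natrM invfM mulrCA.
rewrite mulVKf ?mulrA; last by rewrite pnatr_eq0.
by congr (cos _ / _); rewrite -natr1; ring.
Qed.

Let F th x := limn (pseries (fc th) x).

Let is_derive_F th x : is_derive x (1 : R) (F th) (F (th + a) x).
Proof.
have := @pseries_snd_diffs R (fc th) (`|x| + 1) x.
rewrite !diffs_fc; apply => //.
by rewrite [ltRHS]ger0_norm ?ltrDl // addr_ge0.
Qed.

Let FD th x : F (th + a) x = cos a * F th x + sin a * F (th + pi / 2) x.
Proof.
rewrite /F; transitivity (limn (cos a *: pseries (fc th) x
    + sin a *: pseries (fc (th + pi / 2)) x)).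
  congr (limn _); apply/funext => n.
  rewrite !fctE /pseries /series /= !scaler_sumr -big_split /=; apply: eq_bigr => i _.
  rewrite /fc !addrA cosDpihalf cosD [in RHS]/GRing.scale /=; ring.
apply: cvg_lim => //; apply: cvgD; apply: cvgZr; exact: is_cvg_fc.
Qed.

Let F0 th : F th 0 = cos th.
Proof.
apply: cvg_lim => //; rewrite /pseries; apply: cvg_near_cst.
exists 1%N => // n /= n0; rewrite /series /= big_ltn // big1_seq ?addr0.
  by rewrite /fc mul0r add0r fact0 expr0 mulr1 divr1.
move=> i; rewrite mem_index_iota => /andP[_ /andP[i0 _]].
by rewrite expr0n gtn_eqF // mulr0.
Qed.

(** Expected to be constant, as |exp(x e^(ia))|^2 = exp(2 x cos a). *)
Let Q x := (F 0 x ^+ 2 + F (pi / 2) x ^+ 2) * expR (- (2 * cos a) * x).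

Let FpiD x : F (pi / 2 + a) x = - sin a * F 0 x + cos a * F (pi / 2) x.
Proof.
rewrite FD -[pi / 2 + pi / 2]splitr addrC; congr (_ + _).
rewrite mulNr -mulrN; congr (_ * _).
rewrite /F -limN; last exact: is_cvg_fc.
congr (limn _); apply/funext => n.
rewrite !fctE /pseries /series /= -sumrN; apply: eq_bigr => i _.
by rewrite /fc addr0 cosDpi !mulNr.
Qed.

Let QE x : Q x = 1.
Proof.
have dQ y : is_derive y (1 : R) Q 0.
  have d1 := is_derive_F 0 y; have d2 := is_derive_F (pi / 2) y.
  apply: is_derive_eq.
  rewrite add0r -[X in F X]addr0 -/(F _ _) /GRing.scale /= ?FpiD.
  rewrite -[a]add0r FD !add0r.
  ring.
rewrite (is_derive_0_is_cst x 0 dQ) /Q !F0 cos_pihalf cos0 mulr0 expR0; ring.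
Qed.

Lemma pseries_cos_sin (x : R) :
  limn (pseries (fun n => cos (n%:R * a) / n`!%:R) x) ^+ 2 +
  limn (pseries (fun n => sin (n%:R * a) / n`!%:R) x) ^+ 2 = expR (2 * cos a * x).
Proof.
have H := QE x; rewrite /Q mulNr expRN in H.
have e0 : expR (2 * cos a * x) != 0 by rewrite gt_eqF ?expR_gt0.
apply: (mulIf (invr_neq0 e0)); rewrite divff //; apply: etrans H; congr (_ / _).
congr (_ ^+ 2 + _).
  rewrite /F; congr (limn (pseries _ _)); apply/funext => n.
  by rewrite /fc addr0.
rewrite -[LHS]sqrrN; congr (_ ^+ 2).
rewrite /F -limN; last first.
  have -> : (fun n => sin (n%:R * a) / n`!%:R) = - fc (pi / 2).
    by apply/funext => n; rewrite fctE /fc cosDpihalf mulNr opprK.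
  have -> : pseries (- fc (pi/2)) x = - pseries (fc (pi/2)) x.
    apply/funext => n; rewrite !fctE /pseries /series /= -sumrN.
    by apply: eq_bigr => i _; rewrite mulNr.
  by apply: is_cvgN; exact: is_cvg_fc.
congr (limn _); apply/funext => n.
rewrite !fctE /pseries /series /= -sumrN; apply: eq_bigr => i _.
by rewrite /fc cosDpihalf !mulNr.
Qed.

Lemma is_cvg_pseries_cos (x : R) : cvgn (pseries (fun n => cos (n%:R * a) / n`!%:R) x).
Proof.
have -> : (fun n => cos (n%:R * a) / n`!%:R) = fc 0.
  by apply/funext => n; rewrite /fc addr0.
exact: is_cvg_fc.
Qed.

Lemma is_cvg_pseries_sin (x : R) : cvgn (pseries (fun n => sin (n%:R * a) / n`!%:R) x).
Proof.
have -> : (fun n => sin (n%:R * a) / n`!%:R) = - fc (pi / 2).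
  by apply/funext => n; rewrite fctE /fc cosDpihalf mulNr opprK.
have -> : pseries (- fc (pi/2)) x = - pseries (fc (pi/2)) x.
  apply/funext => n; rewrite !fctE /pseries /series /= -sumrN.
  by apply: eq_bigr => i _; rewrite mulNr.
by apply: is_cvgN; exact: is_cvg_fc.
Qed.

End poisson_characteristic.

Section poisson_variable.
Context (R : realType) d (Omega : measurableType d) (P : probability Omega R).
Context (N : Omega -> \bar R) (l : R).
Hypothesis mN : measurable_fun setT N.
Hypothesis l0 : 0 <= l.
Hypothesis PN : forall n : nat, P [set w | N w = n%:R%:E] = poisson_prob l 0 [set n].

Lemma poisson_prob1 (n : nat) : poisson_prob l 0 [set n] = (l ^+ n / n`!%:R * expR (- l))%:E.
Proof.
rewrite /poisson_prob; case: ifPn => [h|].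
  by rewrite esum_set1 ?lee_fin ?poisson_pmf_ge0 // /poisson_pmf h.
(* At rate 0 the distribution is by definition the Dirac mass at 0, in agreement with the formula
   since 0^0 = 1. *)
rewrite -leNgt => h; have -> : l = 0 by apply/eqP; rewrite eq_le h l0.
rewrite oppr0 expR0 mulr1 expr0n diracE.
case: n => [|n]; first by rewrite mem_set // fact0 invr1 mulr1.
by rewrite memNset //= mul0r.
Qed.

Let B (n : nat) := [set w | N w = n%:R%:E].

Let mB n : measurable (B n).
Proof.
by have := mN measurableT (@emeasurable_set1 _ n%:R%:E); rewrite setTI.
Qed.

Let tB : trivIset setT B.
Proof.
apply/trivIsetP => i j _ _ ij; rewrite -subset0 => w [Bi Bj].
have : N w = i%:R%:E by []; rewrite (_ : N w = j%:R%:E) // => -[] /eqP.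
by rewrite eqr_nat eq_sym (negbTE ij).
Qed.

(** The masses of the integers already add up to 1, so infinite and non-integer values have
    probability 0. *)
Lemma poisson_ae_nat : {ae P, forall w, exists n, N w = n%:R%:E}.
Proof.
have P1 : P (\bigcup_n B n) = 1%E.
  rewrite measure_bigcup //=.
  under eq_eseriesr do rewrite PN.
  transitivity (poisson_prob l 0 (\bigcup_n [set n])).
    rewrite measure_bigcup //=; apply/trivIsetP => i j _ _ ij; rewrite -subset0.
    by move=> k [/= -> /eqP]; rewrite (negbTE ij).
  rewrite (_ : \bigcup_n _ = setT) ?probability_setT //.
  by apply/seteqP; split=> // n _; exists n.
exists (~` \bigcup_n B n); split.
- by apply: measurableC; apply: bigcup_measurable.
- by rewrite probability_setC ?P1 ?subee //; apply: bigcup_measurable.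
- by move=> w /= h [n _ Bn]; apply: h; exists n.
Qed.

Lemma Rintegral_poisson (h : R -> R) : measurable_fun setT h -> (forall x, `|h x| <= 1) ->
  cvgn (pseries (fun n => h n%:R / n`!%:R) l) ->
  \int[P]_w h (fine (N w)) = expR (- l) * limn (pseries (fun n => h n%:R / n`!%:R) l).
Proof.
move=> mh h1 ch.
(* This equals [h] of the variable when its value is an integer below [M], and 0 otherwise: it is
   bounded by 1, and its integral is a partial sum of the series. *)
pose f_ M w := \sum_(n < M) h n%:R * \1_(B n) w.
have fE M w n : B n w -> f_ M w = if (n < M)%N then h (fine (N w)) else 0.
  move=> Bnw; rewrite /f_.
  have Bj (j : nat) : (\1_(B j) w = (j == n)%:R :> R).
    rewrite indicE; case: eqP => [->|jn]; first by rewrite mem_set.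
    rewrite memNset // => Bjw; apply: jn; apply/eqP; rewrite -(eqr_nat R).
    by move: Bjw Bnw; rewrite /B /= => -> [->].
  case: ifPn => nM.
    rewrite (bigD1 (Ordinal nM)) //= Bj eqxx mulr1 big1 ?addr0.
      by move: Bnw; rewrite /B /= => ->.
    by move=> j jn; rewrite Bj -[_ == n]/(j == Ordinal nM) (negbTE jn) mulr0.
  rewrite big1 // => j _; rewrite Bj; case: eqP => [jn|]; last by rewrite mulr0.
  by move: nM; rewrite -jn ltn_ord.
have mf M : measurable_fun setT (f_ M).
  by apply: measurable_sum => i; apply: measurable_funM => //; exact: measurable_indic.
have mhN : measurable_fun setT (fun w => h (fine (N w))).
  apply: (measurableT_comp mh); apply: (measurableT_comp _ mN); exact: fine_measurable.
have : \int[P]_w f_ M w @[M --> \oo] --> \int[P]_w h (fine (N w)).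
  apply: (@Rintegral_cvg_bounded _ _ _ _ _ _ 1) => //.
  - move=> M w.
    have [[n Bn]|nB] := pselect (exists n, B n w).
      by rewrite (fE _ _ _ Bn); case: ifP; rewrite ?normr0.
    rewrite /f_ big1 ?normr0 // => i _; rewrite indicE memNset ?mulr0 // => Bi.
    by apply: nB; exists i.
  - apply: filterS poisson_ae_nat => w [n Bn].
    apply: cvg_near_cst; exists n.+1 => // M /= nM.
    by rewrite (fE _ _ _ Bn) nM.
move=> cI; apply: (cvg_unique _ cI) => //.
have -> : (fun M => \int[P]_w f_ M w) =
    expR (- l) \*: pseries (fun n => h n%:R / n`!%:R) l.
  apply/funext => M; rewrite /f_ Rintegral_sum // => [|i]; last first.
    apply: (@bounded_integrable _ _ _ _ _ 1) => [|w].
      by apply: measurable_funM => //; exact: measurable_indic.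
    by rewrite normrM mulr_ile1 ?normr_indic_le1.
  rewrite /pseries /series /= big_mkord scaler_sumr; apply: eq_bigr => i _.
  rewrite RintegralZl //; last first.
    by apply: (@bounded_integrable _ _ _ _ _ 1) => [|w];
      [exact: measurable_indic|exact: normr_indic_le1].
  rewrite Rintegral_indic // PN poisson_prob1 /= /GRing.scale /=; ring.
by apply: cvgZr.
Qed.

Lemma mod2_poisson (a : R) :
  mod2 P (fun w => a * fine (N w)) = expR (- (2 * l * (1 - cos a))).
Proof.
have cE : (fun n : nat => cos (a * n%:R) / n`!%:R) = (fun n => cos (n%:R * a) / n`!%:R).
  by apply/funext => n; rewrite (mulrC a).
have sE : (fun n : nat => sin (a * n%:R) / n`!%:R) = (fun n => sin (n%:R * a) / n`!%:R).
  by apply/funext => n; rewrite (mulrC a).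
have ma : measurable_fun setT (fun x : R => a * x) by exact: measurable_funM.
have Ic := @Rintegral_poisson (fun x => cos (a * x)) (measurable_cos_comp ma)
  (fun x => normr_cos_le1 (a * x)).
have Is := @Rintegral_poisson (fun x => sin (a * x)) (measurable_sin_comp ma)
  (fun x => normr_sin_le1 (a * x)).
rewrite /mod2 Ic ?cE; last exact: is_cvg_pseries_cos.
rewrite Is ?sE; last exact: is_cvg_pseries_sin.
rewrite !exprMn -mulrDr.
rewrite pseries_cos_sin -expRM_natl -expRD; congr expR; ring.
Qed.

End poisson_variable.

Section gaussian.
Context (R : realType) (s : R).
Hypothesis s0 : 0 < s.
Let phi : R -> R := normal_pdf 0 s.
Let c : R := normal_peak s.
Let leb := @lebesgue_measure R.

Let phiE x : phi x = c * expR (- (x ^+ 2 / (2 * s ^+ 2))).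
Proof.
rewrite /phi normal_pdfE ?gt_eqF // /normal_fun subr0; congr (_ * expR _).
by rewrite mulNr -mulr_natl.
Qed.

Let phi0 x : 0 <= phi x. Proof. exact: normal_pdf_ge0. Qed.

Let sn0 : s != 0. Proof. by rewrite gt_eqF. Qed.

Let is_derive_phi x : is_derive x (1 : R) phi (- (x / s ^+ 2) * phi x).
Proof.
rewrite (_ : phi = fun x => c * expR (- (x ^+ 2 / (2 * s ^+ 2)))); last exact/funext.
apply: is_derive_eq.
rewrite /GRing.scale /=; field; exact: sn0.
Qed.

Let is_derive_cosl y th x : is_derive y (1 : R) (fun y => cos (x * y + th)) (- x * sin (x * y + th)).
Proof. by apply: is_derive_eq; rewrite /GRing.scale /=; ring. Qed.

Let is_derive_sinr y th x : is_derive x (1 : R) (fun x => sin (x * y + th)) (y * cos (x * y + th)).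
Proof. by apply: is_derive_eq; rewrite /GRing.scale /=; ring. Qed.


(** A Gaussian density of twice the width dominates the density together with its first two moments.
    With u = x^2/(8 s^2), the density decays as exp(-4u) and the wide one as exp(-u); the remaining
    exp(-3u) absorbs 1 + x^2 = 1 + 8 s^2 u, whence [K]. *)
Let psi : R -> R := normal_pdf 0 (2 * s).
Let K : R := c / normal_peak (2 * s) * (1 + 8 * s ^+ 2).

Let bound x : (1 + x ^+ 2) * phi x <= K * psi x.
Proof.
rewrite phiE /psi normal_pdfE ?mulf_neq0 // /normal_fun subr0 /K.
set c' := normal_peak _.
have c'0 : 0 < c' by apply: normal_peak_gt0; rewrite mulf_neq0.
have -> : c / c' * (1 + 8 * s ^+ 2) * (c' * expR (- x ^+ 2 / ((2 * s) ^+ 2 *+ 2))) =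
   c * ((1 + 8 * s ^+ 2) * expR (- x ^+ 2 / ((2 * s) ^+ 2 *+ 2))).
  by field; rewrite gt_eqF.
rewrite mulrCA ler_wpM2l ?normal_peak_ge0 //.
pose u := x ^+ 2 / (8 * s ^+ 2).
have s20 : 0 < s ^+ 2 by rewrite exprn_gt0.
have u0 : 0 <= u by rewrite divr_ge0 ?sqr_ge0 // mulr_ge0 // ltW.
have -> : - x ^+ 2 / ((2 * s) ^+ 2 *+ 2) = - u by rewrite /u; field; rewrite sn0.
have -> : x ^+ 2 / (2 * s ^+ 2) = u + (u + u + u) by rewrite /u; field; rewrite sn0.
rewrite opprD expRD mulrA -subr_ge0.
have -> : (1 + 8 * s ^+ 2) * expR (- u) - (1 + x ^+ 2) * expR (- u) * expR (- (u + u + u)) =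
  expR (- u) * ((1 + 8 * s ^+ 2) - (1 + x ^+ 2) * expR (- (u + u + u))) by ring.
apply: mulr_ge0; first exact: expR_ge0.
rewrite subr_ge0.
have xu : x ^+ 2 = 8 * s ^+ 2 * u by rewrite /u; field; rewrite sn0.
have e1 : expR (- (u + u + u)) <= 1 by rewrite -expR0 ler_expR; lra.
have e2 : u * expR (- (u + u + u)) <= 1.
  have h : u <= expR (u + u + u) by apply: le_trans (expR_ge1Dx _); lra.
  rewrite expRN ler_pdivrMr ?expR_gt0 // mul1r //.
rewrite mulrDl mul1r lerD // xu -mulrA ler_piMr // mulr_ge0 // ltW //.
Qed.

Let K0 : 0 <= K.
Proof.
rewrite /K mulr_ge0 ?divr_ge0 ?normal_peak_ge0 // addr_ge0 // mulr_ge0 // ?sqr_ge0 //.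
Qed.

Let psi0 x : 0 <= psi x. Proof. exact: normal_pdf_ge0. Qed.

Let int_psi : leb.-integrable setT (EFin \o (fun x => K * psi x)).
Proof. exact: (integrableZl measurableT K (integrable_normal_pdf _ _)). Qed.

Let mphi : measurable_fun setT phi. Proof. exact: measurable_normal_pdf. Qed.

Let le_psi (f : R -> R) : measurable_fun setT f -> (forall x, `|f x| <= K * psi x) ->
  leb.-integrable setT (EFin \o f).
Proof.
move=> mf fb; apply: le_integrable int_psi => //; first exact/measurable_EFinP.
by move=> x _; rewrite /= lee_fin (le_trans (fb x)) // ler_norm.
Qed.

Let phi_psi x : phi x <= K * psi x.
Proof. by apply: le_trans (bound x); rewrite ler_peMl // lerDl sqr_ge0. Qed.

Let xphi_psi x : `|x| * phi x <= K * psi x.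
Proof.
apply: le_trans (bound x); rewrite ler_wpM2r //.
have := sqr_ge0 (`|x| - 1); rewrite -(real_normK (num_real x)); have := normr_ge0 x; nra.
Qed.

Let mlin y th : measurable_fun setT (fun x : R => x * y + th).
Proof. by apply: measurable_funD => //; exact: measurable_funM. Qed.

Let int_cos y th : leb.-integrable setT (EFin \o (fun x => cos (x * y + th) * phi x)).
Proof.
apply: le_psi => [|x].
  by apply: measurable_funM => //; apply: measurable_cos_comp; exact: mlin.
rewrite normrM (ger0_norm (phi0 x)); apply: le_trans (phi_psi x).
by rewrite ler_piMl // normr_cos_le1.
Qed.

Let int_sin y th : leb.-integrable setT (EFin \o (fun x => x * sin (x * y + th) * phi x)).
Proof.
apply: le_psi => [|x].
  apply: measurable_funM => //; apply: measurable_funM => //.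
  by apply: measurable_sin_comp; exact: mlin.
rewrite normrM (ger0_norm (phi0 x)); apply: le_trans (xphi_psi x).
by rewrite ler_wpM2r // normrM ler_piMr // normr_sin_le1.
Qed.

Let I th y := \int[leb]_x (cos (x * y + th) * phi x).
Let J th y := \int[leb]_x (x * sin (x * y + th) * phi x).

Let partialE th y x :
  is_derive y (1 : R) (fun y => cos (x * y + th) * phi x) (- x * sin (x * y + th) * phi x).
Proof.
have := is_derive_cosl y th x => h.
by apply: is_derive_eq; rewrite /GRing.scale /=; ring.
Qed.

(** Differentiation under the integral sign; the partial derivative is dominated by the wide
    Gaussian uniformly in the parameter. *)
Let is_derive_I th y : is_derive y (1 : R) (I th) (- J th y).
Proof.
have yI : `]y - 1, y + 1[%classic y by rewrite /= in_itv /=; apply/andP; split; lra.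
have dI : forall z x : R, `]y - 1, y + 1[%classic z -> setT x ->
    derivable (fun y => cos (x * y + th) * phi x) z 1.
  by move=> z x _ _; have [] := partialE th z x.
have dE (z x : R) : partial1of2 (fun y x : R => cos (x * y + th) * phi x) z x = - (x * sin (x * z + th) * phi x).
  rewrite partial1of2E; have [_ ->] := partialE th z x; ring.
have Gb : forall z x : R, `]y - 1, y + 1[%classic z -> setT x ->
    `|partial1of2 (fun y x : R => cos (x * y + th) * phi x) z x| <= K * psi x.
  move=> z x _ _; rewrite dE normrN normrM (ger0_norm (phi0 x)); apply: le_trans (xphi_psi x).
  by rewrite ler_wpM2r // normrM ler_piMr // normr_sin_le1.
have G0 x : 0 <= K * psi x by rewrite mulr_ge0.
have h1 := derivable_under_integral measurableT yI (fun z _ => int_cos z th) dI G0 int_psi Gb.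
have h2 := differentiation_under_integral measurableT yI (fun z _ => int_cos z th) dI G0 int_psi Gb.
apply: DeriveDef => //; rewrite -derive1E h2.
under eq_Rintegral do rewrite dE.
rewrite /J -[RHS]mulN1r -RintegralZl //.
by apply: eq_Rintegral => x _; rewrite mulN1r.
Qed.

(** The primitive behind the integration by parts: since phi' = -(x/s^2) phi, its derivative
    combines the integrands of [I] and [J]. *)
Let g th y x := sin (x * y + th) * phi x.
Let g' th y x := y * (cos (x * y + th) * phi x) - (s ^+ 2)^-1 * (x * sin (x * y + th) * phi x).

Let is_derive_g th y x : is_derive x (1 : R) (g th y) (g' th y x).
Proof.
have h1 := is_derive_sinr y th x; have h2 := is_derive_phi x.
by apply: is_derive_eq; rewrite /g' /GRing.scale /=; ring.
Qed.

Let int_g' th y : leb.-integrable setT (EFin \o g' th y).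
Proof.
exact: (integrableB measurableT (integrableZl measurableT y (int_cos y th))
  (integrableZl measurableT (s ^+ 2)^-1 (int_sin y th))).
Qed.

Let cont_g' th y : continuous (g' th y).
Proof.
move=> x; apply: differentiable_continuous; apply/derivable1_diffP.
have h2 := is_derive_phi x; have h1 := is_derive_sinr y th x.
have h3 : is_derive x (1 : R) (fun x => cos (x * y + th)) (- (y * sin (x * y + th))).
  by apply: is_derive_eq; rewrite /GRing.scale /=; ring.
apply: ex_derive.
Qed.

Let FTC th y (n : nat) : \int[leb]_(x in `[- n.+1%:R, n.+1%:R]) g' th y x =
   g th y n.+1%:R - g th y (- n.+1%:R).
Proof.
rewrite /Rintegral (@continuous_FTC2 _ _ (g th y)) //.
- by rewrite -subr_gt0 opprK addr_gt0.
- exact/continuous_subspaceT/cont_g'.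
- have cg x : {for x, continuous (g th y)}.
    apply: differentiable_continuous; apply/derivable1_diffP.
    by have [] := is_derive_g th y x.
  split.
  + by move=> x _; have [] := is_derive_g th y x.
  + exact: (cvg_at_right_filter (cg _)).
  + exact: (cvg_at_left_filter (cg _)).
- by move=> x _; rewrite derive1E; have [_ ->] := is_derive_g th y x.
Qed.

Let g_le th y x : x != 0 -> `|g th y x| <= K * normal_peak (2 * s) / `|x|.
Proof.
move=> x0; rewrite /g normrM (ger0_norm (phi0 x)) ler_pdivlMr ?normr_gt0 //.
apply: (@le_trans _ _ (`|x| * phi x)).
  by rewrite mulrC ler_wpM2l // ler_piMl // normr_sin_le1.
apply: (le_trans (xphi_psi x)); rewrite ler_wpM2l //.
by apply: normal_pdf_ub; rewrite mulf_neq0.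
Qed.

(** The boundary terms on [-n-1, n+1] vanish in the limit, because [g] is bounded by a constant over
    |x|. *)
Let int_g'0 th y : \int[leb]_x g' th y x = 0.
Proof.
have h : \int[leb]_(x in `[- n.+1%:R, n.+1%:R]) g' th y x @[n --> \oo] --> \int[leb]_x g' th y x.
  have := @dominated_convergence _ _ R leb setT measurableT
    (fun n x => ((EFin \o g' th y) \_ `[- n.+1%:R, n.+1%:R]) x) (EFin \o g' th y)
    (abse \o (EFin \o g' th y)).
  case.
  - move=> n; apply/(measurable_restrictT _ _).1 => //.
    by apply: measurable_funTS; exact: (measurable_int _ (int_g' th y)).
  - exact: (measurable_int _ (int_g' th y)).
  - apply: aeW => x _; apply: cvg_near_cst.
    exists (Num.truncn `|x|).+1 => // n /= nx.
    rewrite patchE mem_set //= in_itv /= -ler_norml.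
    apply/ltW; apply: lt_le_trans (truncnS_gt `|x|) _; rewrite ler_nat.
    exact: ltnW.
  - exact: integrable_abse.
  - apply: aeW => x n _; rewrite patchE; case: ifP => // _.
    rewrite abse0; exact: abse_ge0.
  move=> _ _ H; apply: fine_cvg.
  rewrite fineK; last by apply: integrable_fin_num => //; exact: int_g'.
  apply: cvg_trans H; apply: near_eq_cvg; apply: nearW => n.
  by rewrite /= [RHS]integral_mkcond.
rewrite (funext (FTC th y)) in h.
have cn : K * normal_peak (2 * s) / n.+1%:R @[n --> \oo] --> (0 : R).
  rewrite -(mulr0 (K * normal_peak (2 * s))).
  by apply: cvgM; [exact: cvg_cst|exact: cvg_harmonic].
have gn : g th y n.+1%:R @[n --> \oo] --> (0 : R).
  apply: norm_cvg0; apply: (squeeze_cvgr _ (cvg_cst 0) cn).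
  apply: nearW => n; rewrite normr_ge0 /=.
  by apply: le_trans (g_le _ _ _) _ => //; rewrite normr_nat.
have gm : g th y (- n.+1%:R) @[n --> \oo] --> (0 : R).
  apply: norm_cvg0; apply: (squeeze_cvgr _ (cvg_cst 0) cn).
  apply: nearW => n; rewrite normr_ge0 /=.
  by apply: le_trans (g_le _ _ _) _ => //; rewrite normrN normr_nat.
have := cvgB gn gm; rewrite subr0 => h0.
apply: (cvg_unique _ h) => //. exact: h0.
Qed.

Let JE th y : J th y = s ^+ 2 * y * I th y.
Proof.
have := int_g'0 th y; rewrite /g'.
have i1 := integrableZl measurableT y (int_cos y th).
have i2 := integrableZl measurableT (s ^+ 2)^-1 (int_sin y th).
rewrite (RintegralB measurableT i1 i2) RintegralZl // RintegralZl // -/(I th y) -/(J th y).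
move/eqP; rewrite subr_eq0 => /eqP h.
have -> : J th y = s ^+ 2 * ((s ^+ 2)^-1 * J th y) by field; rewrite sn0.
by rewrite -h mulrA.
Qed.

(* The phase [th] absorbs the remaining coordinates in the induction on the
   dimension of [Rintegral_cos_gauss_cV]. *)
Lemma Rintegral_cos_normal_pdf (y th : R) :
  \int[leb]_x (cos (x * y + th) * phi x) = cos th * expR (- (s ^+ 2 * y ^+ 2 / 2)).
Proof.
rewrite -/(I th y).
(* By [JE] the function [I] solves I' = - s^2 y I, so this product is constant and equals its value
   at 0. *)
pose Q y := I th y * expR (s ^+ 2 * y ^+ 2 / 2).
have dQ z : is_derive z (1 : R) Q 0.
  have h := is_derive_I th z.
  apply: is_derive_eq; rewrite JE /GRing.scale /=; field => //.
have := @is_derive_0_is_cst _ Q y 0 dQ.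
rewrite /Q expr0n mulr0 mul0r expR0 mulr1.
have -> : I th 0 = cos th.
  rewrite /I; under eq_Rintegral do rewrite mulr0 add0r.
  rewrite RintegralZl //; last exact: integrable_normal_pdf.
  by rewrite /Rintegral integral_normal_pdf mulr1.
by move=> <-; rewrite -[RHS]mulrA -expRD subrr expR0 mulr1.
Qed.

End gaussian.

Lemma Rintegral_indicM (R : realType) d (T : measurableType d)
    (mu : {measure set T -> \bar R}) (A : set T) (f : T -> R) : measurable A ->
  \int[mu]_x (\1_A x * f x) = \int[mu]_(x in A) f x.
Proof.
move=> mA; rewrite [RHS]Rintegral_mkcond; apply: eq_Rintegral => x _.
rewrite patchE indicE; case: ifPn; rewrite ?mul1r ?mul0r //.
Qed.

(** The function may be unbounded, so at stage [r] the pieces cover only the part where |f| is at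
    most r. Dominated convergence handles this truncation, and the steps cost at most mu(V)/(r+1).
    It serves with [phi] the identity for jump sums and with 1 - cos for their exponents. *)
Lemma step_integral_cvg (R : realType) d (T : measurableType d)
    (mu : {measure set T -> \bar R}) (V : set T) (f : T -> R) (phi : R -> R)
    (N : nat -> nat) (A : forall r, 'I_(N r) -> set T) (a : forall r, 'I_(N r) -> R) :
  measurable V -> (mu V < +oo)%E -> measurable_fun setT f ->
  (forall x y, `|phi x - phi y| <= `|x - y|) ->
  mu.-integrable V (EFin \o (phi \o f)) ->
  (forall r i, measurable (A r i)) -> (forall r, trivIset setT (A r)) ->
  (forall r, \bigcup_i A r i = V `&` [set x | `|f x| <= r%:R]) ->
  (forall r i x, A r i x -> `|f x - a r i| <= r.+1%:R^-1) ->
  \sum_(i < N r) phi (a r i) * fine (mu (A r i)) @[r --> \oo] -->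
    \int[mu]_(x in V) phi (f x).
Proof.
move=> mV Voo mf Lphi Iphi mA tA AV Aa.
pose D r := V `&` [set x | `|f x| <= r%:R].
have mD r : measurable (D r).
  apply: measurableI => //.
  have -> : [set x | `|f x| <= r%:R] = ((fun y : R => `|y|) \o f) @^-1` `]-oo, r%:R].
    by apply/seteqP; split => x /=; rewrite in_itv.
  rewrite -[X in measurable X]setTI; apply: (measurableT_comp _ mf) => //.
have DV r : D r `<=` V by move=> x [].
have ID r : mu.-integrable (D r) (EFin \o (phi \o f)) by exact: (integrableS mV).
have Doo r : (mu (D r) < +oo)%E by apply: le_lt_trans Voo; apply: le_measure; rewrite ?inE.
have Vfin : mu V \is a fin_num by rewrite ge0_fin_numE.
have AD r i : A r i `<=` D r by rewrite /D -AV => x Ax; exists i.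
have IA r i : mu.-integrable (A r i) (EFin \o (phi \o f)) by exact: (integrableS (mD r)).
have Aoo r i : (mu (A r i) < +oo)%E.
  by apply: le_lt_trans (Doo r); apply: le_measure; rewrite ?inE.
have c1 : \int[mu]_(x in D r) phi (f x) @[r --> \oo] --> \int[mu]_(x in V) phi (f x).
  have := @dominated_convergence _ _ R mu V mV
    (fun r x => ((EFin \o (phi \o f)) \_ (D r)) x) (EFin \o (phi \o f))
    (abse \o (EFin \o (phi \o f))).
  case.
  - move=> r; apply: measurable_funTS; apply/(measurable_restrictT _ _).1 => //.
    exact: (measurable_int _ (ID r)).
  - exact: (measurable_int _ Iphi).
  - apply: aeW => x Vx; apply: cvg_near_cst.
    exists (Num.truncn `|f x|).+1 => // r /= nr.
    rewrite patchE mem_set //; split => //=.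
    apply/ltW; apply: lt_le_trans (truncnS_gt `|f x|) _; rewrite ler_nat //.
  - exact: integrable_abse.
  - apply: aeW => x n _; rewrite patchE; case: ifP => // _.
    rewrite abse0; exact: abse_ge0.
  move=> _ _ H; apply: fine_cvg.
  rewrite fineK; last by apply: integrable_fin_num => //; exact: Iphi.
  apply: cvg_trans H; apply: near_eq_cvg; apply: nearW => n.
  by rewrite /= -integral_mkcondr setIidr.
have c2 : \int[mu]_(x in D r) phi (f x) - \sum_(i < N r) phi (a r i) * fine (mu (A r i))
    @[r --> \oo] --> (0 : R).
  apply: norm_cvg0.
  have cn : fine (mu V) / r.+1%:R @[r --> \oo] --> (0 : R).
    rewrite -(mulr0 (fine (mu V))).
    by apply: cvgM; [exact: cvg_cst|exact: cvg_harmonic].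
  apply: (squeeze_cvgr _ (cvg_cst 0) cn); apply: nearW => r; rewrite normr_ge0 /=.
  have DE : D r = \big[setU/set0]_(i < N r) A r i.
    rewrite -bigcup_seq /D -AV; apply/seteqP; split=> x [i _ Ax]; exists i => //=.
    by rewrite mem_index_enum.
  have sD : \int[mu]_(x in D r) phi (f x) = \sum_(i < N r) \int[mu]_(x in A r i) phi (f x).
    rewrite DE /Rintegral integral_bigsetU_EFin //=.
    - by rewrite sum_fine // => i _; apply: integrable_fin_num => //; exact: IA.
    - exact: index_enum_uniq.
    - by apply: sub_trivIset (tA r).
    - rewrite -DE; exact: (measurable_int _ (ID r)).
  have sV : \sum_(i < N r) fine (mu (A r i)) <= fine (mu V).
    have hs : (\sum_(i < N r) mu (A r i) <= mu V)%E.
      rewrite -(measure_bigsetU_ord mu xpredT) //.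
      rewrite -DE; apply: le_measure; rewrite ?inE //.
    rewrite sum_fine; last by move=> i _; rewrite ge0_fin_numE.
    by rewrite fine_le // ge0_fin_numE ?sume_ge0 // (le_lt_trans hs).
  rewrite sD -sumrB; apply: le_trans (ler_norm_sum _ _ _) _.
  apply: le_trans (_ : \sum_(i < N r) fine (mu (A r i)) / r.+1%:R <= _); last first.
    by rewrite -mulr_suml ler_wpM2r ?invr_ge0.
  apply: ler_sum => i _.
  have Ic : mu.-integrable (A r i) (EFin \o cst (phi (a r i))).
    apply: measurable_bounded_integrable => //; exact: bounded_cst.
  have -> : phi (a r i) * fine (mu (A r i)) = \int[mu]_(x in A r i) cst (phi (a r i)) x.
    by rewrite -Rintegral_cst.
  rewrite -[X in `|X|](RintegralB (mA r i) (IA r i) Ic) /=.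
  have Ifc : mu.-integrable (A r i) (EFin \o (fun x => phi (f x) - phi (a r i))).
    exact: (integrableB (mA r i) (IA r i) Ic).
  apply: le_trans (le_normr_Rintegral _ _) _ => //.
  rewrite mulrC -Rintegral_cst //; apply: le_Rintegral => //.
  - exact: integrable_norm.
  - apply: measurable_bounded_integrable => //; exact: bounded_cst.
  - by move=> x Ax; apply: le_trans (Lphi _ _) _; exact: Aa.
rewrite -[X in _ --> X]subr0.
rewrite (_ : (fun r => \sum_(i < N r) _) = (fun r => \int[mu]_(x in D r) phi (f x) -
  (\int[mu]_(x in D r) phi (f x) - \sum_(i < N r) phi (a r i) * fine (mu (A r i))))).
  exact: cvgB.
by apply/funext => r; rewrite opprB addrC subrK.
Qed.

(** The law is given on sets only; step functions carry it over to bounded integrands, with an error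
    [e] on either side. *)
Lemma Rintegral_normal (R : realType) d (Omega : measurableType d) (P : probability Omega R)
    (Y : Omega -> R) (m s : R) (f : R -> R) (K : R) :
  measurable_fun setT Y ->
  (forall U, measurable U -> P (Y @^-1` U) = normal_prob m s U) ->
  measurable_fun setT f -> (forall x, `|f x| <= K) ->
  \int[P]_w f (Y w) = \int[lebesgue_measure]_x (f x * normal_pdf m s x).
Proof.
move=> mY PY mf fK.
apply/eqP; rewrite -subr_eq0; apply/eqP.
apply: (@ler0_eps _ _ 2) => e e0.
have [N [A [a [mA fs]]]] := step_approx mf fK e0.
pose s' x := \sum_(i < N) a i * \1_(A i) x.
pose pdf : R -> R := normal_pdf m s.
have pdf0 x : 0 <= pdf x by exact: normal_pdf_ge0.
have mpdf : measurable_fun setT pdf by exact: measurable_normal_pdf.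
have K0 : 0 <= K by apply: le_trans (fK 0).
have ms : measurable_fun setT s'.
  by apply: measurable_sum => i; apply: measurable_funM.
have sK x : `|s' x| <= K + e.
  have -> : s' x = f x - (f x - s' x) by rewrite opprB addrCA subrr addr0.
  apply: le_trans (ler_normB _ _) _; exact: lerD (fs x).
have sP : \int[P]_w s' (Y w) = \sum_(i < N) a i * fine (normal_prob m s (A i)).
  rewrite Rintegral_sum // => [|i].
    apply: eq_bigr => i _; rewrite RintegralZl //.
      rewrite -PY // -(Rintegral_indic P) //.
      by rewrite -[X in measurable X]setTI; exact: mY.
    apply: (@bounded_integrable _ _ _ _ _ 1) => [|w]; last exact: normr_indic_le1.
    exact: measurableT_comp.
  apply: (@bounded_integrable _ _ _ _ _ `|a i|) => [|w].
    by apply: measurable_funM => //; exact: measurableT_comp.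
  by rewrite normrM ler_piMr // normr_indic_le1.
have ile (g : R -> R) C : measurable_fun setT g -> (forall x, `|g x| <= C) ->
    (@lebesgue_measure R).-integrable setT (EFin \o (fun x => g x * pdf x)).
  move=> mg gC.
  have := integrableZl measurableT C (integrable_normal_pdf m s).
  apply: le_integrable => //; first by apply/measurable_EFinP; exact: measurable_funM.
  move=> x _; rewrite /= lee_fin !normrM ler_wpM2r //.
  by rewrite (le_trans (gC x)) // ler_norm.
have sL : \int[lebesgue_measure]_x (s' x * pdf x) = \sum_(i < N) a i * fine (normal_prob m s (A i)).
  rewrite /s'; under eq_Rintegral do rewrite mulr_suml.
  rewrite Rintegral_sum // => [|i].
    apply: eq_bigr => i _; under eq_Rintegral do rewrite -mulrA.
    rewrite RintegralZl //; first (congr (_ * _); exact (Rintegral_indicM lebesgue_measure pdf (mA i))).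
    by apply: (ile _ 1) => [|x]; [exact: measurable_indic|exact: normr_indic_le1].
  apply: (ile _ `|a i|) => [|x]; first by apply: measurable_funM.
  by rewrite normrM ler_piMr // normr_indic_le1.
have -> : \int[P]_w f (Y w) - \int[lebesgue_measure]_x (f x * normal_pdf m s x) =
  (\int[P]_w f (Y w) - \int[P]_w s' (Y w)) -
  (\int[lebesgue_measure]_x (f x * pdf x) - \int[lebesgue_measure]_x (s' x * pdf x)).
  by rewrite sP sL; ring.
apply: le_trans (ler_normB _ _) _; rewrite mulr_natl mulr2n lerD //.
  apply: (@Rint_dist _ _ _ _ _ _ _ (K + e)) => //.
  - exact: measurableT_comp.
  - exact: measurableT_comp.
  - by move=> w; rewrite (le_trans (fK _)) // lerDl ltW.
have If := ile f K mf fK; have Is := ile s' (K + e) ms sK.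
have Ifs : (@lebesgue_measure R).-integrable setT (EFin \o (fun x => f x * pdf x - s' x * pdf x)).
  exact: (integrableB measurableT If Is).
rewrite -[X in `|X|](RintegralB measurableT If Is).
apply: le_trans (le_normr_Rintegral _ Ifs) _ => //.
apply: le_trans (_ : \int[lebesgue_measure]_x (e * pdf x) <= _).
  apply: le_Rintegral => //.
  - exact: integrable_norm.
  - exact: (integrableZl measurableT e (integrable_normal_pdf m s)).
  - by move=> x _; rewrite -mulrBl normrM (ger0_norm (pdf0 x)) ler_wpM2r // fs.
rewrite RintegralZl //; last exact: integrable_normal_pdf.
by rewrite [X in e * X]/Rintegral integral_normal_pdf mulr1.
Qed.

Lemma mod2_normal (R : realType) d (Omega : measurableType d) (P : probability Omega R)
    (Y : Omega -> R) (s a : R) : 0 < s -> measurable_fun setT Y ->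
  (forall U, measurable U -> P (Y @^-1` U) = normal_prob 0 s U) ->
  mod2 P (fun w => a * Y w) = expR (- (s ^+ 2 * a ^+ 2)).
Proof.
move=> s0 mY PY; rewrite /mod2.
have ma : measurable_fun setT (fun x : R => a * x) by exact: measurable_funM.
rewrite (@Rintegral_normal _ _ _ P Y 0 s (fun x => cos (a * x)) 1 mY PY
  (measurable_cos_comp ma) (fun x => normr_cos_le1 (a * x))).
rewrite (@Rintegral_normal _ _ _ P Y 0 s (fun x => sin (a * x)) 1 mY PY
  (measurable_sin_comp ma) (fun x => normr_sin_le1 (a * x))).
under eq_Rintegral do rewrite mulrC -[a * _]addr0 (mulrC a) mulrC.
rewrite (Rintegral_cos_normal_pdf s0).
(* The sine is a cosine with phase -pi/2, so its integral carries the factor cos(-pi/2) = 0. *)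
have -> : (fun x => sin (a * x) * normal_pdf 0 s x) =
          (fun x => cos (x * a + - (pi / 2)) * normal_pdf 0 s x).
  by apply/funext => x; rewrite -cosN opprD opprK cosDpihalf sinN opprK (mulrC a).
rewrite (Rintegral_cos_normal_pdf s0) cosN cos_pihalf mul0r expr0n addr0 cos0 mul1r.
rewrite -expRM_natl; congr expR; by field.
Qed.

Section euclidean_measurability.
Context (R : realType) (n : nat).

Lemma measurable_dotp (q : 'cV[R]_n) : measurable_fun setT (dotp q).
Proof.
apply: measurable_sum => i; apply: measurable_funM => //; exact: measurable_coord.
Qed.

Lemma measurable_enorm : measurable_fun setT (@enorm R n).
Proof.
apply: (@measurableT_comp _ _ _ _ _ _ (@Num.sqrt R)).
  by apply: continuous_measurable_fun; exact: sqrt_continuous.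
by apply: measurable_sum => i; apply: measurable_funM; exact: measurable_coord.
Qed.

Lemma dotp_ge0 (u : 'cV[R]_n) : 0 <= dotp u u.
Proof. by apply: sumr_ge0 => i _; rewrite -expr2 sqr_ge0. Qed.

Lemma enorm_ge0 (u : 'cV[R]_n) : 0 <= enorm u. Proof. exact: sqrtr_ge0. Qed.

Lemma enorm_sqr (u : 'cV[R]_n) : enorm u ^+ 2 = dotp u u.
Proof. by rewrite sqr_sqrtr // dotp_ge0. Qed.

Lemma coord_le_enorm (u : 'cV[R]_n) i : `|u i ord0| <= enorm u.
Proof.
rewrite -(ler_pXn2r (n := 2)) ?nnegrE ?enorm_ge0 // enorm_sqr /dotp (bigD1 i) //=.
rewrite real_normK ?num_real // -expr2 lerDl.
by apply: sumr_ge0 => j _; rewrite -expr2 sqr_ge0.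
Qed.

Lemma dotp_le (q u : 'cV[R]_n) : `|dotp q u| <= (\sum_i `|q i ord0|) * enorm u.
Proof.
apply: le_trans (ler_norm_sum _ _ _) _; rewrite mulr_suml; apply: ler_sum => i _.
by rewrite normrM ler_wpM2l // coord_le_enorm.
Qed.

Lemma dotpDr (q u v : 'cV[R]_n) : dotp q (u + v) = dotp q u + dotp q v.
Proof. by rewrite /dotp -big_split; apply: eq_bigr => i _; rewrite mxE mulrDr. Qed.

Lemma dotpBr (q u v : 'cV[R]_n) : dotp q (u - v) = dotp q u - dotp q v.
Proof. by rewrite /dotp -sumrB; apply: eq_bigr => i _; rewrite !mxE mulrBr. Qed.

Lemma dotpZl (c : R) (q u : 'cV[R]_n) : dotp (c *: q) u = c * dotp q u.
Proof. by rewrite /dotp mulr_sumr; apply: eq_bigr => i _; rewrite !mxE mulrA. Qed.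

Lemma dotpZr (c : R) (q u : 'cV[R]_n) : dotp q (c *: u) = c * dotp q u.
Proof. by rewrite /dotp mulr_sumr; apply: eq_bigr => i _; rewrite !mxE mulrCA. Qed.

End euclidean_measurability.

Lemma measurable_fun_cVB (R : realType) n d (T : measurableType d) (f g : T -> 'cV[R]_n) :
  measurable_fun setT f -> measurable_fun setT g -> measurable_fun setT (fun x => f x - g x).
Proof.
move=> /measurable_mxP mf /measurable_mxP mg; apply/measurable_mxP => i j.
by under eq_fun do rewrite !mxE; apply: measurable_funB.
Qed.

Lemma measurable_fun_cVD (R : realType) n d (T : measurableType d) (f g : T -> 'cV[R]_n) :
  measurable_fun setT f -> measurable_fun setT g -> measurable_fun setT (fun x => f x + g x).
Proof.
move=> /measurable_mxP mf /measurable_mxP mg; apply/measurable_mxP => i j.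
by under eq_fun do rewrite !mxE; apply: measurable_funD.
Qed.

(** [mod2_sum] is used twice: over the time increments, then over the independent coordinates of one
    increment. *)
Lemma mod2_wiener (R : realType) d (Omega : measurableType d) (P : probability Omega R)
    k (W : R -> Omega -> 'cV[R]_k) n (t : nat -> R) (y : 'I_n -> 'cV[R]_k) :
  wiener_process P W -> 0 <= t 0%N -> (forall i, t i < t i.+1) ->
  mod2 P (fun w => \sum_(i < n) dotp (y i) (W (t i.+1) w - W (t i) w)) =
  expR (- \sum_(i < n) (t i.+1 - t i) * dotp (y i) (y i)).
Proof.
move=> [mW _ incW indW] t0 tS.
have tmono : {homo t : i j / (i <= j)%N >-> i <= j}.
  by apply/nondecreasing_seqP => i; exact: ltW.
have t_ge0 i : 0 <= t i by apply: le_trans t0 (tmono _ _ _).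
rewrite (@mod2_sum _ _ _ P n _ _ (fun (i : 'I_n) w => W (t i.+1) w - W (t i) w)
  (fun i => dotp (y i))); first last.
- by move=> i; exact: measurable_dotp.
- by move=> i; apply: measurable_fun_cVB; exact: mW.
- exact: indW.
rewrite -sumrN expR_sum; apply: eq_bigr => i _.
have [indc law] := incW (t i) (t i.+1) (t_ge0 i) (tS i).
have md : measurable_fun setT (fun w => W (t i.+1) w - W (t i) w).
  by apply: measurable_fun_cVB; exact: mW.
have mdj j : measurable_fun setT (fun w => (W (t i.+1) w - W (t i) w) j ord0 : R).
  exact: ((measurable_mxP _).1 md j ord0).
rewrite /dotp (@mod2_sum _ _ _ P k _ _ (fun j w => (W (t i.+1) w - W (t i) w) j ord0 : R)
  (fun j (x : R) => y i j ord0 * x)); first last.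
- by move=> j; exact: measurable_funM.
- exact: mdj.
- exact: indc.
rewrite -mulrN -sumrN mulr_sumr expR_sum; apply: eq_bigr => j _.
rewrite (@mod2_normal _ _ _ P _ (Num.sqrt (t i.+1 - t i))) //; last first.
  by move=> U mU; exact: law.
  by rewrite sqrtr_gt0 subr_gt0.
rewrite sqr_sqrtr ?subr_ge0 ?(ltW (tS i)) //; congr expR; ring.
Qed.

(** * Increments of the Levy process *)

Section levy_tail.
Context (R : realType) (d : nat) (Pi : {measure set 'cV[R]_d -> \bar R}).

Definition tail_set (e : R) : set 'cV[R]_d := [set u | e < enorm u].

Lemma measurable_tail_set e : measurable (tail_set e).
Proof.
have -> : tail_set e = (@enorm R d) @^-1` `]e, +oo[.
  by apply/seteqP; split => x /=; rewrite /tail_set /= in_itv /= andbT.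
by rewrite -[X in measurable X]setTI; apply: measurable_enorm.
Qed.

(** Markov's inequality: the integrand min(|u|^2, 1) is at least min(e^2, 1) on the tail. *)
Lemma levy_tail_finite e : levy_measure Pi -> 0 < e -> (Pi (tail_set e) < +oo)%E.
Proof.
move=> [_ h] e0; pose c := Num.min (e ^+ 2) 1.
have c0 : 0 < c by rewrite lt_min exprn_gt0 //= ltr01.
have mm : measurable_fun setT (fun u : 'cV[R]_d => (Num.min (enorm u ^+ 2) 1)%:E).
  apply/measurable_EFinP; apply: measurable_minr => //.
  by apply: measurable_funX; exact: measurable_enorm.
have mT := measurable_tail_set e.
have m0 (u : 'cV[R]_d) : (0 <= (Num.min (enorm u ^+ 2) 1)%:E)%E.
  by rewrite lee_fin le_min sqr_ge0 /= ler01.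
have : (c%:E * Pi (tail_set e) < +oo)%E.
  apply: le_lt_trans h; rewrite -integral_cst //.
  apply: (@le_trans _ _ (\int[Pi]_(u in tail_set e) (Num.min (enorm u ^+ 2) 1)%:E)%E).
    apply: ge0_le_integral => //.
    - by move=> u _; rewrite lee_fin ltW.
    - exact: measurable_funTS.
    - move=> u eu; rewrite lee_fin /c le_min; apply/andP; split.
        rewrite ge_min; apply/orP; left.
        by rewrite ler_pXn2r // ?nnegrE ?enorm_ge0 ?(ltW e0) // ltW.
      by rewrite ge_min lexx orbT.
  by apply: ge0_subset_integral.
have := measure_ge0 Pi (tail_set e); case: (Pi _) => [r _ _| _|].
- exact: ltry.
- by rewrite gt0_muley ?ltxx // lte_fin.
- by [].
Qed.

Lemma jump_intensity_rect (a b : R) (V : set 'cV[R]_d) : 0 <= a -> a <= b -> measurable V ->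
  jump_intensity Pi (`]a, b] `*` V) = ((b - a)%:E * Pi V)%E.
Proof.
move=> a0 ab mV; rewrite /jump_intensity setIidl; last first.
  by move=> [s u] /= [+ _]; rewrite in_itv /= => /andP[/ltW + _]; exact: le_trans.
rewrite /product_measure1.
transitivity (\int[lebesgue_measure]_x ((\1_(`]a, b]%classic : set R) x)%:E * Pi V))%E.
  apply: eq_integral => x _; rewrite /= indicE.
  have [xab|xab] := boolP (x \in (`]a, b]%classic : set R)).
    by rewrite in_xsectionX // mul1e.
  by rewrite notin_xsectionX // measure0 mul0e.
have mI : measurable_fun setT (EFin \o (\1_(`]a, b]%classic) : measurableTypeR R -> R)).
  by apply/measurable_EFinP; exact: measurable_indic.
rewrite (ge0_integralZr _ measurableT mI) //; last by move=> x _; rewrite lee_fin.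
rewrite integral_indic // setIT; congr (_ * _)%E.
apply: etrans (lebesgue_measure_itv _) _; rewrite /= lte_fin.
case: ltP ab => // ba ab; have -> : b = a by apply/eqP; rewrite eq_le ba ab.
by rewrite subrr.
Qed.

End levy_tail.

Arguments tail_set {R} d e.
Arguments measurable_tail_set {R} d e.

Section poisson_integrals.
Context (R : realType) disp (Omega : measurableType disp) (P : probability Omega R).
Context (d : nat) (Pi : {measure set 'cV[R]_d -> \bar R}).
Context (nu : R.-ker Omega ~> (R * 'cV[R]_d)%type).
Hypothesis levyPi : levy_measure Pi.
Hypothesis poisnu : poisson_random_measure P (jump_intensity Pi) nu.

Let mrect (a b : R) (V : set 'cV[R]_d) : measurable V -> measurable (`]a, b] `*` V).
Proof. by move=> mV; exact: measurableX. Qed.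

Let PN (a b : R) (V : set 'cV[R]_d) : 0 <= a -> a <= b -> measurable V -> (Pi V < +oo)%E ->
  forall n : nat, P [set w | nu w (`]a, b] `*` V) = n%:R%:E] =
    poisson_prob ((b - a) * fine (Pi V)) 0 [set n].
Proof.
move=> a0 ab mV Voo n; have [h _ _] := poisnu.
have mu := jump_intensity_rect Pi a0 ab mV.
have fV : Pi V \is a fin_num by rewrite ge0_fin_numE.
rewrite h //; last by rewrite mu -(fineK fV) -EFinM ltry.
  by rewrite mu fineM.
exact: mrect.
Qed.

Lemma mod2_poisson_rect (a b c : R) (V : set 'cV[R]_d) :
  0 <= a -> a <= b -> measurable V -> (Pi V < +oo)%E ->
  mod2 P (fun w => c * fine (nu w (`]a, b] `*` V))) =
  expR (- (2 * (b - a) * ((1 - cos c) * fine (Pi V)))).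
Proof.
move=> a0 ab mV Voo.
rewrite (@mod2_poisson _ _ _ P (fun w => nu w (`]a, b] `*` V)) ((b - a) * fine (Pi V))).
- by congr expR; ring.
- by apply: measurable_kernel; exact: mrect.
- by rewrite mulr_ge0 ?subr_ge0 // fine_ge0.
- exact: PN.
Qed.

Let tail_rect (T e : R) (n : nat) := `]0, T] `*` tail_set d (e + n%:R).

(** The jumps may have no mean, so integrability is obtained pathwise: almost surely there are
    finitely many jumps larger than [e] up to time [T], hence a largest one, and the integrand is
    bounded on the jumps that occur. *)
Lemma poisson_integrable (T e : R) : 0 <= T -> 0 < e ->
  {ae P, forall w, (nu w (`]0%R, T] `*` tail_set d e) < +oo)%E /\
    forall q : 'cV[R]_d, (nu w).-integrable (`]0, T] `*` tail_set d e)
       (EFin \o (fun p => dotp q p.2))}.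
Proof.
move=> T0 e0.
have en n : 0 < e + n%:R by rewrite ltr_pwDl.
have mt n : measurable (tail_rect T e n) by apply: mrect; exact: measurable_tail_set.
have : {ae P, forall w, forall n : nat, exists k : nat, nu w (tail_rect T e n) = k%:R%:E}.
  apply: ae_foralln => n.
  apply: (@poisson_ae_nat _ _ _ P _ ((T - 0) * fine (Pi (tail_set d (e + n%:R))))).
  - exact: measurable_kernel.
  - by apply: PN => //; [exact: measurable_tail_set|exact: levy_tail_finite].
apply: filterS => w hk.
have F0 : `]0, T] `*` tail_set d e = tail_rect T e 0 by rewrite /tail_rect addr0.
have oo0 : (nu w (tail_rect T e 0) < +oo)%E by have [k ->] := hk 0%N; exact: ltry.
have nd : nonincreasing_seq (tail_rect T e).
  move=> i j ij; apply/subsetPset => -[s u] /= [hs hu]; split => //.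
  by apply: le_lt_trans hu; rewrite lerD2l ler_nat.
have cap0 : \bigcap_n tail_rect T e n = set0.
  rewrite -subset0 => -[s u] h.
  have [_] := h (Num.truncn (enorm u)).+1 Logic.I.
  rewrite /tail_set /= => h1.
  have h2 := truncnS_gt (enorm u).
  by have := lt_trans h1 h2; rewrite gtrDr ltNge (ltW e0).
have := nonincreasing_cvg_mu oo0 mt _ nd.
rewrite cap0 measure0 => /(_ (@measurable0 _ _)) c0.
(* The counts decrease to 0 and are integers, so they vanish as soon as they are below 1. *)
have [N N0] : exists N, nu w (tail_rect T e N) = 0%E.
  have /fine_cvgP[_ /cvgrPdist_lt/(_ 1 ltr01)[N _ /(_ N (leqnn N)) /=]] := c0.
  have [k hN] := hk N; rewrite hN /= sub0r normrN normr_nat => k1.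
  exists N; rewrite hN; move: k1; rewrite (ltr_nat _ k 1) ltnS leqn0 => /eqP ->.
  by [].
split; first by rewrite F0.
move=> q; rewrite F0.
have mq : measurable_fun setT (fun p : R * 'cV[R]_d => dotp q p.2).
  exact: measurableT_comp (measurable_dotp q) measurable_snd.
apply/(negligible_integrable (mt N) (mt 0%N) _ N0).
  by apply/measurable_funTS/measurable_EFinP.
apply: measurable_bounded_integrable.
- exact: measurableD.
- by apply: le_lt_trans oo0; apply: le_measure; rewrite ?inE //; exact: measurableD.
- exact: measurable_funTS.
exists ((\sum_i `|q i ord0|) * (e + N%:R)); split; first exact: num_real.
move=> y hy [s u] [[hs hu]] hN /=.
apply/ltW; apply: le_lt_trans hy.
apply: le_trans (dotp_le _ _) _; rewrite ler_wpM2l ?sumr_ge0 //.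
by rewrite leNgt; apply/negP => h; apply: hN; split.
Qed.

Lemma measurable_Rintegral_kernel (D : set (R * 'cV[R]_d)) (f : R * 'cV[R]_d -> R) :
  measurable D -> measurable_fun setT f ->
  measurable_fun setT (fun w => \int[nu w]_(p in D) f p).
Proof.
move=> mD mf.
have mfD : measurable_fun setT ((EFin \o f) \_ D).
  apply/(measurable_restrictT _ _).1 => //; apply: measurable_funTS.
  exact/measurable_EFinP.
have mnu U : measurable U -> measurable_fun setT (fun w => nu w U).
  exact: measurable_kernel.
apply: (@measurableT_comp _ _ _ _ _ _ (@fine R)); first exact: fine_measurable.
under eq_fun do rewrite integral_mkcond integralE.
apply: emeasurable_funB; apply: measurable_fun_integral_kernel => //.
  exact: measurable_funepos.
exact: measurable_funeneg.
Qed.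

Definition truncated_jumps (e t : R) (w : Omega) : 'cV[R]_d :=
  large_jumps nu t w + compensated_jumps Pi nu e t w.

Lemma measurable_large_jumps t : measurable_fun setT (large_jumps nu t).
Proof.
apply/measurable_mxP => i j; under eq_fun do rewrite mxE.
apply: measurable_Rintegral_kernel; first by apply: mrect; exact: measurable_tail_set.
exact: measurableT_comp (@measurable_coord _ _ _ i ord0) measurable_snd.
Qed.

Let mid_set (e : R) : set 'cV[R]_d := [set u | e < enorm u <= 1].

Let measurable_mid e : measurable (mid_set e).
Proof.
have -> : mid_set e = (@enorm R d) @^-1` `]e, 1].
  by apply/seteqP; split => x /=; rewrite /mid_set /= in_itv.
by rewrite -[X in measurable X]setTI; apply: measurable_enorm.
Qed.

Lemma measurable_compensated_jumps e t : measurable_fun setT (compensated_jumps Pi nu e t).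
Proof.
apply: measurable_fun_cVB => //.
apply/measurable_mxP => i j; under eq_fun do rewrite mxE.
apply: measurable_Rintegral_kernel; first by apply: mrect; exact: measurable_mid.
exact: measurableT_comp (@measurable_coord _ _ _ i ord0) measurable_snd.
Qed.

Lemma measurable_truncated_jumps e t : measurable_fun setT (truncated_jumps e t).
Proof.
apply: measurable_fun_cVD; first exact: measurable_large_jumps.
exact: measurable_compensated_jumps.
Qed.

Let deltaE (u : 'cV[R]_d) i : u i ord0 = dotp (delta_mx i ord0) u.
Proof.
rewrite /dotp (bigD1 i) //= mxE !eqxx mul1r big1 ?addr0 // => j ji.
by rewrite mxE (negbTE ji) mul0r.
Qed.

(** Over a time interval the truncated process is a finite Poisson integral minus a deterministic
    drift. One null set serves all vectors and all intervals within [0, T]. *)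
Lemma dotp_truncated_jumps (T e : R) : 0 <= T -> 0 < e < 1 ->
  {ae P, forall w, forall (q : 'cV[R]_d) (a b : R), 0 <= a -> a <= b -> b <= T ->
    dotp q (truncated_jumps e b w - truncated_jumps e a w) =
    \int[nu w]_(p in `]a, b] `*` tail_set d e) dotp q p.2
    - (b - a) * dotp q (cV_integral Pi (mid_set e) id)}.
Proof.
move=> T0 /andP[e0 e1]; apply: filterS (poisson_integrable T0 e0) => w [_ Iq].
move=> q a b a0 ab bT.
pose I c c' (V : set 'cV[R]_d) i : R := \int[nu w]_(p in `]c, c'] `*` V) p.2 i ord0.
have mtail := measurable_tail_set d.
have IS (c c' : R) V (i : 'I_d) : measurable V -> V `<=` tail_set d e -> 0 <= c -> c' <= T ->
    (nu w).-integrable (`]c, c'] `*` V) (EFin \o (fun p : R * 'cV[R]_d => p.2 i ord0)).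
  move=> mV VS c0 cT.
  have := Iq (delta_mx i ord0); under [X in EFin \o X]eq_fun do rewrite -deltaE.
  apply: integrableS; [exact: mrect|exact: mrect|].
  move=> [s u] /= [hs /VS hu]; split=> //=; move: hs; rewrite !in_itv /= => /andP[h1 h2].
  by rewrite (le_lt_trans c0 h1) (le_trans h2 cT).
have Isplit V i : measurable V -> V `<=` tail_set d e -> I 0 b V i = I 0 a V i + I a b V i.
  move=> mV VS; rewrite /I.
  have E : `]0, b] `*` V = (`]0, a] `*` V) `|` (`]a, b] `*` V).
    apply/seteqP; split => -[s u] /=; rewrite !in_itv /=.
      move=> [/andP[h1 h2] h3]; case: (leP (s : R) a) => sa; [left|right];
      by split=> //; apply/andP; split.
    move=> [[/andP[h1 h2] h3]|[/andP[h1 h2] h3]]; split => //; apply/andP; split => //.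
      exact: le_trans h2 ab.
    exact: le_lt_trans a0 h1.
  rewrite E Rintegral_setU //; try exact: mrect.
    by rewrite -E; exact: IS.
  apply/disj_setPS => -[s u] /= [[]]; rewrite !in_itv /= => /andP[_ sa] _ [/andP[as_ _] _].
  by move: (lt_le_trans as_ sa); rewrite ltxx.
have tailE : tail_set d e = tail_set d 1 `|` mid_set e.
  apply/seteqP; split => u; rewrite /tail_set /mid_set /=.
    by move=> eu; have [h|h] := leP (enorm u) 1; [right; rewrite eu|left].
  by case=> [|/andP[]//]; exact: lt_trans.
have t1 : tail_set d 1 `<=` tail_set d e by rewrite tailE; left.
have t2 : mid_set e `<=` tail_set d e by rewrite tailE; right.
have Iab i : I a b (tail_set d e) i = I a b (tail_set d 1) i + I a b (mid_set e) i.
  rewrite /I.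
  have E : `]a, b] `*` tail_set d e = (`]a, b] `*` tail_set d 1) `|` (`]a, b] `*` mid_set e).
    by rewrite tailE; apply/seteqP; split => -[s u] /=; [move=> [h []]; [left|right]
      |move=> [[h1 h2]|[h1 h2]]; split=> //; [left|right]].
  rewrite E Rintegral_setU //; try exact: mrect.
    by rewrite -E; exact: IS.
  apply/disj_setPS => -[s u] /= [[_ h1] [_ /andP[_ h2]]].
  by move: (lt_le_trans h1 h2); rewrite ltxx.
have coordE i : (truncated_jumps e b w - truncated_jumps e a w) i ord0 =
    I a b (tail_set d e) i - (b - a) * (cV_integral Pi (mid_set e) id) i ord0.
  rewrite Iab /truncated_jumps /large_jumps /compensated_jumps !mxE /=.
  rewrite -/(tail_set d 1) -/(mid_set e).
  rewrite -!/(I _ _ _ _) (Isplit (tail_set d 1)) // (Isplit (mid_set e)) //; ring.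
rewrite /dotp; under eq_bigr do rewrite coordE mulrBr mulrCA.
rewrite sumrB -mulr_sumr; congr (_ - _).
rewrite Rintegral_sum.
- apply: eq_bigr => i _; rewrite RintegralZl //; first exact: mrect.
  exact: IS.
- exact: mrect.
- move=> i.
  apply: (@integrableZl _ _ _ _ _ (mrect _ _ _) (q i ord0) (EFin \o (fun p : R * 'cV[R]_d => p.2 i ord0))) => //.
  exact: IS.
Qed.

End poisson_integrals.

(** Reading [f] on the space that carries only the generated sigma-algebra turns membership in it
    into ordinary measurability, with all its closure lemmas. *)
Lemma measurable_generated (R : realType) disp (Omega : measurableType disp)
    d' (T : measurableType d') (G : set (set Omega)) (f : Omega -> T) :
  measurable_fun (setT : set (g_sigma_algebraType G)) (f : g_sigma_algebraType G -> T) ->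
  forall U, measurable U -> <<s G >> (f @^-1` U).
Proof. by move=> mf U mU; have := mf measurableT U mU; rewrite setTI. Qed.

Lemma cvgr_sum (R : realType) T (F : set_system T) (FF : Filter F) n
    (f : 'I_n -> T -> R) (l : 'I_n -> R) :
  (forall i, f i x @[x --> F] --> l i) ->
  \sum_(i < n) f i x @[x --> F] --> \sum_(i < n) l i.
Proof.
elim: n f l => [|n IH] f l h.
  rewrite big_ord0; under eq_fun do rewrite big_ord0; exact: cvg_cst.
rewrite big_ord_recr; under eq_fun do rewrite big_ord_recr.
by apply: cvgD; [exact: IH|exact: h].
Qed.

(* Minus the real part of the Levy exponent at [q] of the jumps larger than [e]. *)
Definition tail_exponent (R : realType) (d : nat) (Pi : {measure set 'cV[R]_d -> \bar R})
    (e : R) (q : 'cV[R]_d) : R := \int[Pi]_(u in tail_set d e) (1 - cos (dotp q u)).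

Lemma lipschitz_cos (R : realType) (x y : R) : `|cos x - cos y| <= `|x - y|.
Proof.
wlog xy : x y / x < y.
  move=> h; have [|yx|->] := ltgtP x y; first exact: h.
    by rewrite distrC (distrC x); exact: h.
  by rewrite !subrr.
rewrite distrC (distrC x).
have [c _ ->] := @MVT R cos (fun x => - sin x) x y xy (fun z _ => is_derive_cos z)
  (continuous_subspaceT (@continuous_cos R)).
by rewrite normrM normrN ler_piMl // normr_sin_le1.
Qed.

Section increments.
Context (R : realType) disp (Omega : measurableType disp) (P : probability Omega R).
Context (k d : nat) (Pi : {measure set 'cV[R]_d -> \bar R}).
Context (W : R -> Omega -> 'cV[R]_k) (nu : R.-ker Omega ~> (R * 'cV[R]_d)%type).
Hypothesis wienW : wiener_process P W.
Hypothesis levyPi : levy_measure Pi.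
Hypothesis poisnu : poisson_random_measure P (jump_intensity Pi) nu.
Hypothesis indWnu : independent_systems P (process_sigma W) (random_measure_sigma nu).
Context (n : nat) (t : nat -> R) (y : 'I_n -> 'cV[R]_k) (q : 'I_n -> 'cV[R]_d).
Hypothesis t0 : 0 <= t 0%N.
Hypothesis tS : forall i, t i < t i.+1.

Let t_ge0 i : 0 <= t i.
Proof. by elim: i => // i h; apply: le_trans h (ltW (tS i)). Qed.

Let t_le i j : (i <= j)%N -> t i <= t j.
Proof.
suff h : nondecreasing_seq t by exact: h.
by apply/nondecreasing_seqP => a; exact: ltW.
Qed.

Let Wpart w := \sum_(i < n) dotp (y i) (W (t i.+1) w - W (t i) w).

Let mW s : 0 <= s -> measurable_fun setT (W s).
Proof. by case: wienW => + _ _ _; exact. Qed.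

Let mWpart : measurable_fun setT Wpart.
Proof.
apply: measurable_sum => i; apply: (measurableT_comp (measurable_dotp _)).
by apply: measurable_fun_cVB; apply: mW.
Qed.

(** The independence of W and nu concerns their sigma-algebras, so measurability with respect to
    these has to be checked, here and in [S_sigma]. *)
Let Wpart_sigma U : measurable U -> process_sigma W (Wpart @^-1` U).
Proof.
apply: (measurable_generated R); apply: measurable_sum => i.
apply: (measurableT_comp (measurable_dotp _)).
have mWg s : 0 <= s -> measurable_fun setT (W s : g_sigma_algebraType
   [set E | exists t U, [/\ 0 <= t, measurable U & E = W t @^-1` U]] -> _).
  move=> s0 _ V mV; rewrite setTI; apply: sub_sigma_algebra.
  by exists s, V.
by apply: measurable_fun_cVB; apply: mWg.
Qed.

Section fixed_truncation.
Context (e : R) (e0 : 0 < e) (e1 : e < 1).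

Let V := tail_set d e.
Let mV : measurable V. Proof. exact: measurable_tail_set. Qed.
Let Voo : (Pi V < +oo)%E. Proof. exact: levy_tail_finite. Qed.

(** The number of bands of height 1/(r+1) in [-r, r]; it does not depend on the time index [j], so
    the pairs of indices form a plain product. *)
Let N r := (Num.truncn ((r%:R + r%:R) / (r.+1%:R^-1 : R))).+1.

Let D (j : 'I_n) (r : nat) := V `&` [set u | `|dotp (q j) u| <= r%:R].

Let mD j r : measurable (D j r).
Proof.
apply: measurableI => //.
have -> : [set u | `|dotp (q j) u| <= r%:R] = ((fun x : R => `|x|) \o dotp (q j)) @^-1` `]-oo, r%:R].
  by apply/seteqP; split => x /=; rewrite in_itv.
rewrite -[X in measurable X]setTI; apply: (measurableT_comp _ (measurable_dotp (q j))) => //.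
Qed.

Let part j r : exists (A : 'I_(N r) -> set 'cV[R]_d) (a : 'I_(N r) -> R),
  [/\ forall i, measurable (A i), trivIset setT A, \bigcup_i A i = D j r
      & forall i x, A i x -> `|dotp (q j) x - a i| <= r.+1%:R^-1].
Proof.
apply: step_partition => //; first exact: measurable_dotp.
  by move=> x [].
Qed.

Let A j r := sval (cid (part j r)).
Let a j r := sval (cid (svalP (cid (part j r)))).
#[local] Arguments A : clear implicits.
#[local] Arguments a : clear implicits.
Let partP j r : [/\ forall i, measurable (A j r i), trivIset setT (A j r), \bigcup_i A j r i = D j r
      & forall i x, A j r i x -> `|dotp (q j) x - a j r i| <= r.+1%:R^-1].
Proof. exact: (svalP (cid (svalP (cid (part j r))))). Qed.

Let mA j r i : measurable (A j r i). Proof. by case: (partP j r). Qed.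
Let AV j r i : A j r i `<=` V.
Proof.
case: (partP j r) => _ _ AD _ x Ax; have : D j r x by rewrite -AD; exists i.
by case.
Qed.
Let Aoo j r i : (Pi (A j r i) < +oo)%E.
Proof. by apply: le_lt_trans Voo; apply: le_measure; rewrite ?inE //; exact: AV. Qed.

Let rect j r i := `]t (nat_of_ord j), t j.+1] `*` A j r i.
#[local] Arguments rect : clear implicits.
Let mrect j r i : measurable (rect j r i). Proof. exact: measurableX. Qed.

(** A compound Poisson approximation: the scalar product of the jump with [q j] is rounded to
    [a j r i], and the jumps in each disjoint rectangle are counted. *)
Let S r w := \sum_(j < n) \sum_(i < N r) a j r i * fine (nu w (rect j r i)).

Let mN B : measurable B -> measurable_fun setT (fun w => fine (nu w B)).
Proof.
move=> mB; apply: (@measurableT_comp _ _ _ _ _ _ (@fine R)); first exact: fine_measurable.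
exact: measurable_kernel.
Qed.

Let mS r : measurable_fun setT (S r).
Proof.
apply: measurable_sum => j; apply: measurable_sum => i; apply: measurable_funM => //.
exact: mN.
Qed.

Let S_sigma r U : measurable U -> random_measure_sigma nu (S r @^-1` U).
Proof.
apply: (measurable_generated R); apply: measurable_sum => j; apply: measurable_sum => i.
apply: measurable_funM => //.
apply: (@measurableT_comp _ _ _ _ _ _ (@fine R)); first exact: fine_measurable.
move=> _ B mB; rewrite setTI; apply: sub_sigma_algebra.
by exists (rect j r i), B.
Qed.

Let mod2S r : mod2 P (S r) = expR (- \sum_(j < n) 2 * (t j.+1 - t j) *
  \sum_(i < N r) (1 - cos (a j r i)) * fine (Pi (A j r i))).
Proof.
pose B (x : 'I_#|{: 'I_n * 'I_(N r)}|) := rect (enum_val x).1 r (enum_val x).2.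
pose c (x : 'I_#|{: 'I_n * 'I_(N r)}|) := a (enum_val x).1 r (enum_val x).2.
have SE : S r = (fun w => \sum_(x < #|{: 'I_n * 'I_(N r)}|) c x * fine (nu w (B x))).
  apply/funext => w; rewrite /S pair_bigA /=.
  transitivity (\sum_(p in {: 'I_n * 'I_(N r)}) a p.1 r p.2 * fine (nu w (rect p.1 r p.2))).
    by apply: eq_bigl.
  by rewrite big_enum_val.
have tB : trivIset setT B.
  apply/trivIsetP => x x' _ _ xx'; rewrite -subset0 /B => -[s u] /=.
  have : enum_val x != enum_val x' by apply: contra xx' => /eqP/enum_val_inj ->.
  case: (enum_val x) (enum_val x') => [j i] [j' i'] /= ne.
  rewrite /rect /= !in_itv /= => -[[/andP[h1 h2] hA] [/andP[h3 h4] hA']].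
  (* Rectangles of different time intervals are disjoint, so a common point forces the same
     interval; within it the space partition separates the rectangles. *)
  have jj : j = j'.
    apply: val_inj; apply/eqP; rewrite eqn_leq; apply/andP; split; rewrite leqNgt; apply/negP => lt.
      by have := lt_le_trans h1 (le_trans h4 (t_le lt)); rewrite ltxx.
    by have := lt_le_trans h3 (le_trans h2 (t_le lt)); rewrite ltxx.
  subst j'; have ii : i != i' by apply: contra ne => /eqP ->.
  case: (partP j r) => _ /trivIsetP/(_ i i' Logic.I Logic.I ii) h _ _.
  by rewrite -[False]/(set0 u) -h.
rewrite SE (@mod2_sum _ _ _ P _ _ _ (fun x w => nu w (B x)) (fun x z => c x * fine z)).
- transitivity (\prod_(x < #|{: 'I_n * 'I_(N r)}|) expR (- (2 * (t (enum_val x).1.+1 - t (enum_val x).1) *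
       ((1 - cos (c x)) * fine (Pi (A (enum_val x).1 r (enum_val x).2)))))).
    apply: eq_bigr => x _; rewrite (mod2_poisson_rect poisnu) //; exact: ltW.
  rewrite -expR_sum; congr expR; rewrite sumrN; congr (- _).
  under [RHS]eq_bigr do rewrite mulr_sumr.
  rewrite pair_bigA /=.
  transitivity (\sum_(p in {: 'I_n * 'I_(N r)}) 2 * (t p.1.+1 - t p.1) *
     ((1 - cos (a p.1 r p.2)) * fine (Pi (A p.1 r p.2)))).
    by rewrite [RHS]big_enum_val.
  by apply: eq_bigl.
- case: poisnu => _ _ ind; apply: ind => // x; exact: mrect.
- by move=> x; apply: measurable_kernel; exact: mrect.
- move=> x; apply: measurable_funM => //; exact: fine_measurable.
Qed.

Let mod2WS r : mod2 P (fun w => Wpart w + S r w) =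
  expR (- \sum_(i < n) (t i.+1 - t i) * dotp (y i) (y i)) * mod2 P (S r).
Proof.
rewrite mod2_indep //.
  by rewrite (mod2_wiener y wienW t0 tS).
by move=> U U' mU mU'; apply: indWnu; [exact: Wpart_sigma|exact: S_sigma].
Qed.

Let Sinf w := \sum_(j < n) \int[nu w]_(p in `]t j, t j.+1] `*` V) dotp (q j) p.2.

Let S_cvg : {ae P, forall w, S r w @[r --> \oo] --> Sinf w}.
Proof.
apply: filterS (poisson_integrable levyPi poisnu (t_ge0 n) e0) => w [ooF Iq].
rewrite /S /Sinf; apply: cvgr_sum => j.
have sub : `]t j, t j.+1] `*` V `<=` `]0, t n] `*` tail_set d e.
  move=> [s u] /= []; rewrite !in_itv /= => /andP[h1 h2] hu; split=> //.
  apply/andP; split; first exact: le_lt_trans (t_ge0 j) h1.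
  exact: le_trans h2 (t_le (ltn_ord j)).
have mF : measurable (`]t j, t j.+1] `*` V) by exact: measurableX.
have mF' : measurable (`]0, t n] `*` tail_set d e).
  by apply: measurableX => //; exact: measurable_tail_set.
apply: (@step_integral_cvg _ _ _ (nu w) (`]t j, t j.+1] `*` V) (fun p => dotp (q j) p.2) id
  N (fun r i => rect j r i) (a j)) => //.
- by apply: le_lt_trans ooF; apply: le_measure; rewrite ?inE.
- exact: measurableT_comp (measurable_dotp _) measurable_snd.
- exact: (integrableS mF' mF sub (Iq (q j))).
- move=> r; apply/trivIsetP => i i' _ _ ii; rewrite -subset0 => -[s u] /= [[_ h1] [_ h2]].
  case: (partP j r) => _ /trivIsetP/(_ i i' Logic.I Logic.I ii) h _ _.
  by rewrite -[False]/(set0 u) -h.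
- move=> r; case: (partP j r) => _ _ AD _; apply/seteqP; split => -[s u] /=.
    move=> [i _ /= [hs hu]]; have : D j r u by rewrite -AD; exists i.
    by move=> [].
  move=> [[hs hV] hr]; have : D j r u by [].
  by rewrite -AD => -[i _ Ai]; exists i.
- by move=> r i [s u] [_ hu]; case: (partP j r) => _ _ _; exact.
Qed.

Let Psi_cvg : expR (- \sum_(j < n) 2 * (t j.+1 - t j) *
    \sum_(i < N r) (1 - cos (a j r i)) * fine (Pi (A j r i))) @[r --> \oo] -->
  expR (- \sum_(j < n) 2 * (t j.+1 - t j) * tail_exponent Pi e (q j)).
Proof.
apply: (cvg_comp _ expR); last exact: continuous_expR.
apply: cvgN; apply: cvgr_sum => j; apply: cvgM; first exact: cvg_cst.
have mc : measurable_fun setT (fun u : 'cV[R]_d => 1 - cos (dotp (q j) u)).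
  by apply: measurable_funB => //; apply: measurable_cos_comp; exact: measurable_dotp.
apply: (@step_integral_cvg _ _ _ Pi V (dotp (q j)) (fun x => 1 - cos x) N (A j) (a j)) => //.
- exact: measurable_dotp.
- move=> x z; have -> : 1 - cos x - (1 - cos z) = - (cos x - cos z) by ring.
  by rewrite normrN lipschitz_cos.
- apply: measurable_bounded_integrable => //; first exact: measurable_funTS.
  exists 2; split; first exact: num_real.
  move=> M M2 u _ /=; apply: le_trans (ltW M2); apply: le_trans (ler_normB _ _) _.
  by rewrite normr1 -natr1 addrC lerD2r normr_cos_le1.
- by move=> r; case: (partP j r).
- by move=> r; case: (partP j r).
- by move=> r i x Ax; case: (partP j r) => _ _ _; exact.
Qed.

Let mSinf : measurable_fun setT Sinf.
Proof.
apply: measurable_sum => j; apply: measurable_Rintegral_kernel; first exact: measurableX.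
exact: measurableT_comp (measurable_dotp _) measurable_snd.
Qed.

(** The same partitions make the compound Poisson sums converge pathwise and their exponents
    converge to [tail_exponent]; the two limits of the squared moduli must agree. *)
Lemma mod2_truncated :
  mod2 P (fun w => \sum_(i < n) dotp (y i) (W (t i.+1) w - W (t i) w) +
    \sum_(i < n) dotp (q i) (truncated_jumps Pi nu e (t i.+1) w - truncated_jumps Pi nu e (t i) w)) =
  expR (- \sum_(i < n) (t i.+1 - t i) *
    (dotp (y i) (y i) + 2 * tail_exponent Pi e (q i))).
Proof.
(* The total compensating drift, deterministic and therefore removed by [mod2D_cst]. *)
pose C := \sum_(i < n) (t i.+1 - t i) *
  dotp (q i) (cV_integral Pi [set u | e < enorm u <= 1] id).
have mJ i : measurable_fun setT (fun w => dotp (q i)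
    (truncated_jumps Pi nu e (t i.+1) w - truncated_jumps Pi nu e (t i) w)).
  apply: (measurableT_comp (measurable_dotp _)).
  by apply: measurable_fun_cVB; exact: measurable_truncated_jumps.
transitivity (mod2 P (fun w => (Wpart w + Sinf w) + (- C))).
  apply: mod2_ae_eq.
  - by apply: measurable_funD => //; apply: measurable_sum.
  - by apply: measurable_funD => //; exact: measurable_funD.
  have e01 : 0 < e < 1 by rewrite e0.
  apply: filterS (dotp_truncated_jumps levyPi poisnu (t_ge0 n) e01) => w h.
  rewrite -addrA; congr (_ + _); rewrite /Sinf /C -sumrB; apply: eq_bigr => i _.
  by rewrite h //; [exact: ltW|exact: t_le].
rewrite mod2D_cst; last exact: measurable_funD.
have c1 : mod2 P (fun w => Wpart w + S r w) @[r --> \oo] --> mod2 P (fun w => Wpart w + Sinf w).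
  apply: mod2_cvg.
  - by move=> r; exact: measurable_funD.
  - exact: measurable_funD.
  - by apply: filterS S_cvg => w h; apply: cvgD => //; exact: cvg_cst.
have c2 : mod2 P (fun w => Wpart w + S r w) @[r --> \oo] -->
    expR (- \sum_(i < n) (t i.+1 - t i) * dotp (y i) (y i)) *
    expR (- \sum_(j < n) 2 * (t j.+1 - t j) * tail_exponent Pi e (q j)).
  rewrite (_ : (fun r => mod2 P (fun w => Wpart w + S r w)) =
    (fun r => expR (- \sum_(i < n) (t i.+1 - t i) * dotp (y i) (y i)) *
      expR (- \sum_(j < n) 2 * (t j.+1 - t j) *
        \sum_(i < N r) (1 - cos (a j r i)) * fine (Pi (A j r i))))).
    by apply: cvgM => //; exact: cvg_cst.
  by apply/funext => r; rewrite mod2WS mod2S.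
have -> := cvg_unique _ c1 c2 => //.
rewrite -expRD -opprD -big_split; congr (expR (- _)); apply: eq_bigr => i _ /=; ring.
Qed.

End fixed_truncation.

End increments.

Lemma cvge_sum0 (R : realType) T (F : set_system T) (FF : Filter F) n
    (f : 'I_n -> T -> \bar R) :
  (forall i, f i x @[x --> F] --> 0%E) -> (\sum_(i < n) f i x)%E @[x --> F] --> 0%E.
Proof.
elim: n f => [|n IH] f h.
  under eq_fun do rewrite big_ord0; exact: cvg_cst.
under eq_fun do rewrite big_ord_recr /=.
suff H : ((\sum_(i < n) f (widen_ord (leqnSn n) i) x) + f ord_max x)%E @[x --> F] --> (0 + 0)%E.
  by rewrite adde0 in H.
by apply: cvgeD => //; apply: IH => i; exact: h.
Qed.

(** * From L^2 convergence of the small jumps to convergence of squared moduli *)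

Section L1_convergence.
Context (R : realType) d (Omega : measurableType d) (P : probability Omega R).

Lemma dist_expect_cos (h : R -> R) (X Y : Omega -> R) (e : R) :
  measurable_fun setT h -> (forall x, `|h x| <= 1) ->
  (forall x y, `|h x - h y| <= `|x - y|) ->
  measurable_fun setT X -> measurable_fun setT Y ->
  (\int[P]_w (`|X w - Y w|)%:E <= e%:E)%E ->
  `|\int[P]_w h (X w) - \int[P]_w h (Y w)| <= e.
Proof.
move=> mh h1 hL mX mY He.
have mhX := measurableT_comp mh mX; have mhY := measurableT_comp mh mY.
have IX : P.-integrable setT (EFin \o (fun w => h (X w))).
  by apply: (@bounded_integrable _ _ _ _ _ 1).
have IY : P.-integrable setT (EFin \o (fun w => h (Y w))).
  by apply: (@bounded_integrable _ _ _ _ _ 1).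
have IXY : P.-integrable setT (EFin \o (fun w => h (X w) - h (Y w))).
  exact: (integrableB measurableT IX IY).
rewrite -[X in `|X|](RintegralB measurableT IX IY) -lee_fin.
rewrite EFin_normr_Rintegral //.
apply: le_trans (le_abse_integral _ _ _) _ => //; first exact: (measurable_int _ IXY).
apply: le_trans He; apply: ge0_le_integral => //.
- by apply/measurable_EFinP; apply: measurableT_comp => //; exact: measurable_funB.
- by apply/measurable_EFinP; apply: measurableT_comp => //; exact: measurable_funB.
- by move=> w _; rewrite /= lee_fin.
Qed.

Lemma lipschitz_sin (x y : R) : `|sin x - sin y| <= `|x - y|.
Proof.
have sE (z : R) : sin z = - cos (z + pi / 2) by rewrite cosDpihalf opprK.
rewrite !sE -opprD normrN; apply: le_trans (lipschitz_cos _ _) _.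
by rewrite opprD addrACA subrr addr0.
Qed.

Lemma mod2_cvg_L1 T (F : set_system T) (FF : ProperFilter F) (X_ : T -> Omega -> R) (X : Omega -> R) :
  (forall e, measurable_fun setT (X_ e)) -> measurable_fun setT X ->
  (\int[P]_w (`|X w - X_ e w|)%:E)%E @[e --> F] --> 0%E ->
  mod2 P (X_ e) @[e --> F] --> mod2 P X.
Proof.
move=> mX_ mX XX.
have near_le e : 0 < e -> \forall x \near F, (\int[P]_w (`|X w - X_ x w|)%:E <= e%:E)%E.
  move=> e0; have := XX; move/fine_cvgP => [fin /cvgrPdist_le/(_ e e0) H].
  near=> x.
  have fx : (\int[P]_w (`|X w - X_ x w|)%:E)%E \is a fin_num by near: x.
  rewrite -(fineK fx) lee_fin; apply: le_trans (ler_norm _) _.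
  by rewrite -normrN -sub0r; near: x.
have mc : measurable_fun setT (@cos R) by exact: (@measurable_cos_comp _ _ _ id).
have ms : measurable_fun setT (@sin R) by exact: (@measurable_sin_comp _ _ _ id).
rewrite /mod2; apply: cvgD;
  apply: (@cvg_comp _ _ _ _ (fun x : R => x ^+ 2) _ _ _ _ (@exprn_continuous _ 2 _));
  apply/cvgrPdist_le => e e0; apply: filterS (near_le e e0) => x Hx.
- exact: (dist_expect_cos mc (@normr_cos_le1 R) (@lipschitz_cos R)).
- exact: (dist_expect_cos ms (@normr_sin_le1 R) lipschitz_sin).
Unshelve. all: by end_near. Qed.

Lemma cvg_L2_L1 (f_ : R -> Omega -> R) (F : set_system R) (FF : ProperFilter F) :
  (forall e, measurable_fun setT (f_ e)) -> (forall e w, 0 <= f_ e w) ->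
  (\int[P]_w (f_ e w ^+ 2)%:E)%E @[e --> F] --> 0%E ->
  (\int[P]_w (f_ e w)%:E)%E @[e --> F] --> 0%E.
Proof.
move=> mf f0 /fine_cvgP[fin H].
have key dl : 0 < dl -> \forall x \near F, (\int[P]_w (f_ x w)%:E <= (dl + dl)%:E)%E.
  move=> dl0; move/cvgrPdist_le : H => /(_ (dl ^+ 2) (exprn_gt0 2 dl0)) H.
  near=> x.
  have fx : (\int[P]_w (f_ x w ^+ 2)%:E)%E \is a fin_num by near: x.
  have hx : fine (\int[P]_w (f_ x w ^+ 2)%:E)%E <= dl ^+ 2.
    apply: le_trans (ler_norm _) _; rewrite -normrN -sub0r; near: x; exact: H.
  have m2 : measurable_fun setT (fun w => (f_ x w ^+ 2)%:E).
    by apply/measurable_EFinP; exact: measurable_funX.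
  (* Pointwise x <= dl + x^2/dl; the total mass is 1 and the second moment is at most dl^2. *)
  apply: (@le_trans _ _ (\int[P]_w (dl%:E + dl^-1%:E * (f_ x w ^+ 2)%:E))%E).
    apply: ge0_le_integral => //.
    - by move=> w _; rewrite lee_fin.
    - exact/measurable_EFinP.
    - by apply: emeasurable_funD => //; exact: measurable_funeM.
    - move=> w _; rewrite -EFinM -EFinD lee_fin -(ler_pM2l dl0) mulrDr mulrA divff ?gt_eqF //.
      have := f0 x w; nra.
  rewrite ge0_integralD //; first last.
  - exact: measurable_funeM.
  - by move=> w _; rewrite -EFinM lee_fin mulr_ge0 ?sqr_ge0 // invr_ge0 ltW.
  - by move=> w _; rewrite lee_fin ltW.
  rewrite integral_cst // [X in (_ * X + _)%E](_ : _ = 1%E); last exact: probability_setT.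
  rewrite mule1 ge0_integralZl //; first last.
  - by rewrite lee_fin invr_ge0 ltW.
  - by move=> w _; rewrite lee_fin sqr_ge0.
  rewrite -(fineK fx) -EFinM -EFinD lee_fin lerD2l.
  by rewrite -(ler_pM2l dl0) mulrA divff ?gt_eqF // mul1r -expr2.
have f0' x : (0 <= \int[P]_w (f_ x w)%:E)%E by apply: integral_ge0 => w _; rewrite lee_fin.
apply/fine_cvgP; split.
  near=> x; rewrite ge0_fin_numE //; apply: le_lt_trans (_ : _ <= (1 + 1)%:E)%E _; last exact: ltry.
  by near: x; exact: key.
apply/cvgrPdist_le => e e0.
have e20 : 0 < e / 2 by rewrite divr_gt0.
near=> x; rewrite sub0r normrN ger0_norm ?fine_ge0 //.
have h : (\int[P]_w (f_ x w)%:E <= (e / 2 + e / 2)%:E)%E by near: x; exact: key.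
rewrite -lee_fin fineK; first by rewrite -splitr in h.
by rewrite ge0_fin_numE // (le_lt_trans h) // ltry.
Unshelve. all: by end_near. Qed.

End L1_convergence.

Section levy_increments.
Context (R : realType) disp (Omega : measurableType disp) (P : probability Omega R).
Context (k d : nat) (Pi : {measure set 'cV[R]_d -> \bar R}).
Context (W : R -> Omega -> 'cV[R]_k) (nu : R.-ker Omega ~> (R * 'cV[R]_d)%type).
Context (Z : R -> Omega -> 'cV[R]_d).
Hypothesis wienW : wiener_process P W.
Hypothesis levyPi : levy_measure Pi.
Hypothesis poisnu : poisson_random_measure P (jump_intensity Pi) nu.
Hypothesis indWnu : independent_systems P (process_sigma W) (random_measure_sigma nu).
Hypothesis levyZ : jump_levy_process P Pi nu Z.

(** The exponents of the truncated jumps are bounded below for all small cutoffs at once, so the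
    bound passes to the limit without identifying the limiting exponent. *)
Lemma mod2_increments (n : nat) (t : nat -> R) (y : 'I_n -> 'cV[R]_k) (q : 'I_n -> 'cV[R]_d)
    (b : 'I_n -> R) :
  0 <= t 0%N -> (forall i, t i < t i.+1) ->
  (forall i, \forall e \near (0 : R)^'+, b i <= tail_exponent Pi e (q i)) ->
  mod2 P (fun w => \sum_(i < n) dotp (y i) (W (t i.+1) w - W (t i) w) +
                   \sum_(i < n) dotp (q i) (Z (t i.+1) w - Z (t i) w)) <=
  expR (- \sum_(i < n) (t i.+1 - t i) * (dotp (y i) (y i) + 2 * b i)).
Proof.
move=> t0 tS Hb.
have t_ge0 i : 0 <= t i by elim: i => // i h; apply: le_trans h (ltW (tS i)).
have [mZ _ HZ] := levyZ; have [mW _ _ _] := wienW.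
have /choice[Y HY] : forall i : nat, exists Y, small_jumps P Pi nu (t i) Y /\
    {ae P, forall w, Z (t i) w = large_jumps nu (t i) w + Y w}.
  by move=> i; have [Y h1 h2] := HZ (t i) (t_ge0 i); exists Y.
pose Wp w := \sum_(i < n) dotp (y i) (W (t i.+1) w - W (t i) w).
pose X w := Wp w + \sum_(i < n) dotp (q i) (Z (t i.+1) w - Z (t i) w).
pose X_ e w := Wp w + \sum_(i < n) dotp (q i)
  (truncated_jumps Pi nu e (t i.+1) w - truncated_jumps Pi nu e (t i) w).
have mWp : measurable_fun setT Wp.
  apply: measurable_sum => i; apply: (measurableT_comp (measurable_dotp _)).
  by apply: measurable_fun_cVB; exact: mW.
have mX : measurable_fun setT X.
  apply: measurable_funD => //; apply: measurable_sum => i.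
  apply: (measurableT_comp (measurable_dotp _)).
  by apply: measurable_fun_cVB; exact: mZ.
have mX_ e : measurable_fun setT (X_ e).
  apply: measurable_funD => //; apply: measurable_sum => i.
  apply: (measurableT_comp (measurable_dotp _)).
  by apply: measurable_fun_cVB; exact: measurable_truncated_jumps.
pose f i e w := enorm (Y i w - compensated_jumps Pi nu e (t i) w).
have mf i e : measurable_fun setT (f i e).
  apply: (measurableT_comp (@measurable_enorm R d)); apply: measurable_fun_cVB.
    by have [[]] := HY i.
  exact: measurable_compensated_jumps.
have f0 i e w : 0 <= f i e w by exact: enorm_ge0.
have fL1 i : (\int[P]_w (f i e w)%:E)%E @[e --> (0 : R)^'+] --> 0%E.
  by apply: cvg_L2_L1 => //; have [[]] := HY i.
pose K (i : 'I_n) := \sum_j `|q i j ord0|.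
have K0 i : 0 <= K i by exact: sumr_ge0.
have aeY : {ae P, forall w, forall i, Z (t i) w = large_jumps nu (t i) w + Y i w}.
  by apply: ae_foralln => i; have [] := HY i.
have dX e : (\int[P]_w (`|X w - X_ e w|)%:E <= \sum_(i < n) ((K i)%:E *
     (\int[P]_w (f i.+1 e w)%:E + \int[P]_w (f i e w)%:E)))%E.
  have mff i : measurable_fun setT (fun w => (f i.+1 e w)%:E + (f i e w)%:E)%E.
    by apply: emeasurable_funD; exact/measurable_EFinP.
  have ff0 i w : (0 <= (f i.+1 e w)%:E + (f i e w)%:E)%E by rewrite adde_ge0 // lee_fin.
  apply: (@le_trans _ _ (\int[P]_w (\sum_(i < n) (K i)%:E * ((f i.+1 e w)%:E + (f i e w)%:E)))%E).
    apply: ae_ge0_le_integral => //.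
    - apply/measurable_EFinP; apply: measurableT_comp => //; exact: measurable_funB.
    - by move=> w _; apply: sume_ge0 => i _; rewrite mule_ge0 // lee_fin.
    - by apply: emeasurable_sum => i; exact: measurable_funeM.
    apply: filterS aeY => w hw _.
    under eq_bigr do rewrite -EFinD -EFinM.
    rewrite sumEFin lee_fin /X /X_ opprD addrACA subrr add0r -sumrB.
    apply: le_trans (ler_norm_sum _ _ _) _; apply: ler_sum => i _.
    rewrite -dotpBr !hw /truncated_jumps.
    set L := large_jumps nu _ w; set L' := large_jumps nu _ w.
    (* The large jumps cancel, and only the L^2 errors of the small jumps at the two end times
       remain. *)
    have -> : L + Y i.+1 w - (L' + Y i w) -
       (L + compensated_jumps Pi nu e (t i.+1) w - (L' + compensated_jumps Pi nu e (t i) w)) =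
       (Y i.+1 w - compensated_jumps Pi nu e (t i.+1) w) -
       (Y i w - compensated_jumps Pi nu e (t i) w).
      by apply/matrixP => a c; rewrite !mxE; ring.
    rewrite dotpBr mulrDr; apply: le_trans (ler_normB _ _) _.
    by apply: lerD; exact: dotp_le.
  rewrite ge0_integral_sum //; last 2 first.
  - by move=> i; exact: measurable_funeM.
  - by move=> i w _; rewrite mule_ge0 // lee_fin.
  apply: lee_sum => i _.
  rewrite ge0_integralZl //; last by rewrite lee_fin.
  rewrite ge0_integralD // ; try exact/measurable_EFinP;
  by move=> w _; rewrite lee_fin.
have cX : mod2 P (X_ e) @[e --> (0 : R)^'+] --> mod2 P X.
  apply: mod2_cvg_L1 => //.
  apply: (@squeeze_cvge _ _ _ _ (cst 0%E) _ (fun e => \sum_(i < n) ((K i)%:E *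
     (\int[P]_w (f i.+1 e w)%:E + \int[P]_w (f i e w)%:E)))%E).
  - by apply: nearW => e; rewrite dX andbT integral_ge0 // => w _; rewrite lee_fin.
  - exact: cvg_cst.
  - apply: cvge_sum0 => i; rewrite -(mule0 (K i)%:E); apply: cvgeZl => //.
    suff H : (\int[P]_w (f i.+1 e w)%:E + \int[P]_w (f i e w)%:E)%E @[e --> (0 : R)^'+] -->
        (0 + 0)%E by rewrite adde0 in H.
    by apply: cvgeD => //; exact: fL1.
have allb : \forall e \near (0 : R)^'+, forall i, b i <= tail_exponent Pi e (q i).
  exact: filter_forall.
rewrite -[leLHS]/(mod2 P X).
apply: (cvgr_to_le cX); near=> e.
have e0 : 0 < e by near: e; exact: nbhs_right_gt.
have e1 : e < 1 by near: e; exact: nbhs_right_lt.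
have be : forall i, b i <= tail_exponent Pi e (q i) by near: e.
rewrite /X_ /Wp mod2_truncated // ler_expR lerN2; apply: ler_sum => i _.
by rewrite ler_wpM2l ?subr_ge0 ?(ltW (tS i)) // lerD2l ler_wpM2l.
Unshelve. all: by end_near. Qed.

End levy_increments.

(** * Logarithmic growth of the jump exponent *)

Lemma cos_half (R : realType) (x : R) : 1 - cos x = 2 * sin (x / 2) ^+ 2.
Proof.
have := cos2Dsin2 (x / 2).
have -> : cos x = cos (x / 2) ^+ 2 - sin (x / 2) ^+ 2.
  by rewrite {1}[x]splitr cosD !expr2.
lra.
Qed.

Lemma sin_le_norm (R : realType) (x : R) : `|sin x| <= `|x|.
Proof.
have sE (z : R) : sin z = - cos (z + pi / 2) by rewrite cosDpihalf opprK.
have := lipschitz_cos (x + pi / 2) (0 + pi / 2).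
by rewrite !cosDpihalf sin0 oppr0 subr0 normrN add0r addrK.
Qed.

(** On [0, 1] the cosine is at least 1/2, hence sin z >= z/2 by the mean value theorem, and 1 - cos
    x = 2 sin(x/2)^2 >= 2 (x/4)^2. *)
Lemma onem_cos_ge (R : realType) (x : R) : `|x| <= 1 -> x ^+ 2 / 8 <= 1 - cos x.
Proof.
have cosge (z : R) : `|z| <= 1 -> 2^-1 <= cos z.
  move=> z1; have h := cos_half z.
  have hs : sin (z / 2) ^+ 2 <= (z / 2) ^+ 2.
    rewrite -[leLHS]real_normK ?num_real // -[leRHS]real_normK ?num_real //.
    by rewrite ler_pXn2r ?nnegrE // sin_le_norm.
  have hz : z ^+ 2 <= 1.
    by rewrite -[leLHS]real_normK ?num_real // expr_le1.
  have hh : (z / 2) ^+ 2 = z ^+ 2 / 4 by field.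
  move: hs; rewrite hh; lra.
have pos (z : R) : 0 <= z -> z <= 1 -> z / 2 <= sin z.
  rewrite le_eqVlt => /orP[/eqP <- _|z0 z1]; first by rewrite mul0r sin0.
  have [c cz] := @MVT R sin cos 0 z z0 (fun y _ => is_derive_sin y)
    (continuous_subspaceT (@continuous_sin R)).
  rewrite sin0 !subr0 => ->; rewrite mulrC ler_wpM2r ?(ltW z0) //.
  move: cz; rewrite in_itv /= => /andP[c0 cz]; apply: cosge.
  by rewrite ger0_norm ?(ltW c0) // (le_trans (ltW cz)).
move=> x1; wlog x0 : x x1 / 0 <= x.
  move=> h; have [|x0] := leP 0 x; first exact: h.
  by rewrite -cosN -sqrrN; apply: h; rewrite ?normrN // oppr_ge0 ltW.
move: x1; rewrite ger0_norm // => x1.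
rewrite cos_half.
have h2 : x / 2 / 2 <= sin (x / 2) by apply: pos; lra.
have h3 : 0 <= x / 2 / 2 by lra.
have : (x / 2 / 2) ^+ 2 <= sin (x / 2) ^+ 2.
  by rewrite ler_pXn2r // ?nnegrE // (le_trans h3).
have -> : (x / 2 / 2) ^+ 2 = x ^+ 2 / 16 by field.
lra.
Qed.

Lemma enormZ (R : realType) n (c : R) (u : 'cV[R]_n) : enorm (c *: u) = `|c| * enorm u.
Proof.
rewrite /enorm dotpZl dotpZr mulrA -expr2 sqrtrM ?sqr_ge0 // sqrtr_sqr //.
Qed.

(** Taking e = 1/|q| and l = q/|q| in the moment condition turns the set |(u,l)| <= e into |(q,u)|
    <= 1, where 1 - cos is at least a multiple of the square; the factor e^2 cancels and ln(1/e)
    becomes ln|q|. *)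
Lemma tail_exponent_ge (R : realType) (d : nat) (Pi : {measure set 'cV[R]_d -> \bar R}) (K : R) :
  levy_measure Pi -> directional_moment_condition Pi -> 0 < K ->
  exists2 r0 : R, 1 < r0 & forall q : 'cV[R]_d, r0 < enorm q ->
    \forall e \near (0 : R)^'+, K * ln (enorm q) <= tail_exponent Pi e q.
Proof.
move=> levyPi dirPi K0.
(* In 16 K, a factor 8 pays for 1 - cos x >= x^2/8 and a factor 2 for removing the jumps near the
   origin. *)
have := dirPi; rewrite /directional_moment_condition => /cvgeyPge/(_ (16 * K)) hn.
have {}hn : \forall e \near (0 : R)^'+, 0 < e /\ e < 1 /\ forall l, sphere l ->
    ((16 * K * (e ^+ 2 * ln e^-1))%:E <= directional_moment Pi e l)%E.
  near=> e.
  have e0 : 0 < e by near: e; exact: nbhs_right_gt.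
  have e1 : e < 1 by near: e; exact: nbhs_right_lt.
  split => //; split => // l sl.
  have h : ((16 * K)%:E <= ((e ^+ 2 * ln e^-1)^-1)%:E *
     ereal_inf [set directional_moment Pi e l | l in @sphere R d])%E by near: e.
  have c0 : 0 < e ^+ 2 * ln e^-1.
    by rewrite mulr_gt0 ?exprn_gt0 // ln_gt0 // invf_gt1.
  apply: le_trans (_ : _ <= ereal_inf [set directional_moment Pi e l | l in @sphere R d])%E _; last first.
    by apply: ereal_inf_lbound; exists l.
  by move: h; rewrite lee_pdivlMl // -EFinM mulrC.
have [e0 /= [e00 [e01 _]] {}hn] : exists2 e0 : R, 0 < e0 /\ e0 < 1 /\ True & forall e, 0 < e -> e < e0 ->
    e < 1 /\ forall l : 'cV[R]_d, sphere l ->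
    ((16 * K * (e ^+ 2 * ln e^-1))%:E <= directional_moment Pi e l)%E.
  move: hn; rewrite near_withinE => /nbhs_ballP[e0 /= e00 H].
  (* Keeping the radius below 1 makes its inverse, the threshold on |q|, larger than 1. *)
  exists (Num.min e0 2^-1).
    by rewrite lt_min e00 invr_gt0 ltr0n /= gt_min invf_lt1 // ltr1n orbT.
  move=> e ep; rewrite lt_min => /andP[ee _].
  have [|//|_ [? ?]] := H e; last by split.
  by rewrite /ball /= sub0r normrN gtr0_norm.
exists (e0^-1); first by rewrite invf_gt1.
move=> q hq.
set r := enorm q.
have r1 : 1 < r by apply: lt_trans hq; rewrite invf_gt1.
have r0 : 0 < r by rewrite (lt_trans ltr01).
have lr : 0 < ln r by rewrite ln_gt0.
have [rv1 hl] : r^-1 < 1 /\ forall l : 'cV[R]_d, sphere l ->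
    ((16 * K * (r^-1 ^+ 2 * ln r^-1^-1))%:E <= directional_moment Pi r^-1 l)%E.
  by apply: hn; rewrite ?invr_gt0 // invf_plt ?posrE.
pose l := r^-1 *: q.
have sl : sphere l.
  by rewrite /sphere /= enormZ gtr0_norm ?invr_gt0 // mulVf // gt_eqF.
pose S := [set u : 'cV[R]_d | `|dotp q u| <= 1].
have dotC (u v : 'cV[R]_d) : dotp u v = dotp v u.
  by apply: eq_bigr => i _; rewrite mulrC.
have dl u : dotp u l = r^-1 * dotp q u by rewrite /l dotpZr dotC.
have mS : measurable S.
  have -> : S = ((fun x : R => `|x|) \o dotp q) @^-1` `]-oo, 1].
    by apply/seteqP; split => x /=; rewrite in_itv.
  rewrite -[X in measurable X]setTI; apply: (measurableT_comp _ (measurable_dotp q)) => //.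
have m2 D : measurable_fun D (fun u : 'cV[R]_d => (dotp q u ^+ 2)%:E).
  apply: measurable_funTS; apply/measurable_EFinP; apply: measurable_funX.
  exact: measurable_dotp.
have p2 (u : 'cV[R]_d) : (0 <= (dotp q u ^+ 2)%:E)%E by rewrite lee_fin sqr_ge0.
have hS : ((16 * K * ln r)%:E <= \int[Pi]_(u in S) (dotp q u ^+ 2)%:E)%E.
  have := hl l sl; rewrite invrK /directional_moment.
  have -> : [set u : 'cV[R]_d | `|dotp u l| <= r^-1] = S.
    have E u : (r^-1 * `|dotp q u| <= r^-1) = (`|dotp q u| <= 1).
      by rewrite -{2}[r^-1]mulr1 ler_pM2l // invr_gt0.
    by apply/seteqP; split => u; rewrite /S /= dl normrM gtr0_norm ?invr_gt0 // E.
  under eq_integral do rewrite dl exprMn EFinM.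
  rewrite ge0_integralZl //; last by rewrite lee_fin sqr_ge0.
  rewrite [16 * K * _]mulrCA EFinM lee_pmul2l //.
  by rewrite lte_fin exprn_gt0 // invr_gt0.
(* Jumps above a positive cutoff; they exhaust [S] up to the origin, where the integrand
   vanishes. *)
pose V (i : nat) := S `&` tail_set d (i.+1%:R^-1 : R).
have mV i : measurable (V i) by apply: measurableI => //; exact: measurable_tail_set.
have ndV : nondecreasing_seq V.
  move=> i j ij; apply/subsetPset => u [Su] /= hu; split => //.
  by apply: le_lt_trans hu; rewrite lef_pV2 ?posrE // ler_nat.
have VU : \bigcup_i V i = S `&` [set u | 0 < enorm u].
  apply/seteqP; split => u.
    move=> [i _ [Su hu]]; split => //=; apply: le_lt_trans hu.
    by rewrite invr_ge0.
  move=> [Su /= u0].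
  have [i _ /(_ i (leqnn i)) /= hi] := near_infty_natSinv_lt (PosNum u0).
  by exists i => //; split.
have SV : (\int[Pi]_(u in S) (dotp q u ^+ 2)%:E = \int[Pi]_(u in \bigcup_i V i) (dotp q u ^+ 2)%:E)%E.
  rewrite VU integral_mkcondr; apply: eq_integral => u _; rewrite patchE.
  case: ifPn => // /negP hu; have : enorm u = 0.
    apply/eqP; rewrite eq_le enorm_ge0 andbT leNgt; apply/negP => h.
    by apply: hu; rewrite inE.
  move=> u0; have := dotp_le q u; rewrite u0 mulr0 normr_le0 => /eqP ->.
  by rewrite expr0n.
have cV : (\int[Pi]_(u in V i) (dotp q u ^+ 2)%:E)%E @[i --> \oo] -->
    (\int[Pi]_(u in \bigcup_i V i) (dotp q u ^+ 2)%:E)%E.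
  apply: ge0_nondecreasing_set_cvg_integral => //.
(* The limit over [i], possibly infinite, is at least 16 K ln r, hence half of this bound is reached
   at some [i]; every smaller cutoff inherits it. *)
have [i hi] : exists i, ((8 * K * ln r)%:E <= \int[Pi]_(u in V i) (dotp q u ^+ 2)%:E)%E.
  apply: contrapT => /forallNP hi.
  have : (\int[Pi]_(u in \bigcup_i V i) (dotp q u ^+ 2)%:E <= (8 * K * ln r)%:E)%E.
    apply: (cvge_to_le cV); apply: nearW => i.
    by apply: ltW; rewrite ltNge; apply/negP; exact: hi.
  rewrite -SV => h; have := le_trans hS h; rewrite lee_fin.
  have : 0 < K * ln r by rewrite mulr_gt0.
  lra.
near=> e.
have e_gt0 : 0 < e by near: e; exact: nbhs_right_gt.
have ei : e < i.+1%:R^-1 by near: e; apply: nbhs_right_lt; rewrite invr_gt0.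
have Vfin := levy_tail_finite levyPi e_gt0.
have mT := measurable_tail_set d e.
have mc : measurable_fun setT (fun u : 'cV[R]_d => 1 - cos (dotp q u)).
  by apply: measurable_funB => //; apply: measurable_cos_comp; exact: measurable_dotp.
have c0 (u : 'cV[R]_d) : 0 <= 1 - cos (dotp q u) by rewrite subr_ge0 cos_le1.
have Ic : Pi.-integrable (tail_set d e) (EFin \o (fun u => 1 - cos (dotp q u))).
  apply: measurable_bounded_integrable => //; first exact: measurable_funTS.
  exists 2; split; first exact: num_real.
  move=> M M2 u _ /=; apply: le_trans (ltW M2); apply: le_trans (ler_normB _ _) _.
  by rewrite normr1 -natr1 addrC lerD2r normr_cos_le1.
rewrite /tail_exponent -lee_fin /Rintegral fineK; last first.
  by apply: integrable_fin_num => //; exact: Ic.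
apply: (@le_trans _ _ (\int[Pi]_(u in V i) (8^-1%:E * (dotp q u ^+ 2)%:E))%E).
  rewrite ge0_integralZl // -lee_pdivrMl ?invr_gt0 //.
  by rewrite invrK -EFinM mulrA.
apply: (@le_trans _ _ (\int[Pi]_(u in V i) (1 - cos (dotp q u))%:E)%E).
  apply: ge0_le_integral => //.
  - by move=> u _; rewrite mule_ge0.
  - exact: measurable_funeM.
  - by apply: measurable_funTS; exact/measurable_EFinP.
  - by move=> u [Su _]; rewrite -EFinM lee_fin mulrC onem_cos_ge.
apply: ge0_subset_integral => //.
- by apply: measurable_funTS; exact/measurable_EFinP.
- by move=> u [_ hu]; apply: lt_trans hu.
Unshelve. all: by end_near. Qed.

(** * Euler scheme *)

Section norm1.
Context (R : realType).

Definition norm1 m (x : 'cV[R]_m) : R := \sum_i `|x i ord0|.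

Definition mnorm m n (A : 'M[R]_(m, n)) : R := \sum_i \sum_j `|A i j|.

Lemma norm1_ge0 m (x : 'cV[R]_m) : 0 <= norm1 x.
Proof. exact: sumr_ge0. Qed.

Lemma mnorm_ge0 m n (A : 'M[R]_(m, n)) : 0 <= mnorm A.
Proof. by apply: sumr_ge0 => i _; exact: sumr_ge0. Qed.

Lemma norm1_0 m : norm1 (0 : 'cV[R]_m) = 0.
Proof. by rewrite /norm1 big1 // => i _; rewrite mxE normr0. Qed.

Lemma norm1D m (x y : 'cV[R]_m) : norm1 (x + y) <= norm1 x + norm1 y.
Proof.
by rewrite /norm1 -big_split; apply: ler_sum => i _; rewrite mxE ler_normD.
Qed.

Lemma norm1N m (x : 'cV[R]_m) : norm1 (- x) = norm1 x.
Proof. by apply: eq_bigr => i _; rewrite mxE normrN. Qed.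

Lemma norm1B m (x y : 'cV[R]_m) : norm1 (x - y) <= norm1 x + norm1 y.
Proof. by apply: le_trans (norm1D _ _) _; rewrite norm1N. Qed.

Lemma norm1Z m c (x : 'cV[R]_m) : norm1 (c *: x) = `|c| * norm1 x.
Proof. by rewrite /norm1 mulr_sumr; apply: eq_bigr => i _; rewrite mxE normrM. Qed.

Lemma coord_le_norm1 m (x : 'cV[R]_m) i : `|x i ord0| <= norm1 x.
Proof. by rewrite /norm1 (bigD1 i) //= lerDl sumr_ge0. Qed.

Lemma norm1_mulmx m n (A : 'M[R]_(m, n)) x : norm1 (A *m x) <= mnorm A * norm1 x.
Proof.
rewrite /mnorm mulr_suml; apply: ler_sum => i _; rewrite mxE mulr_suml.
apply: le_trans (ler_norm_sum _ _ _) _; apply: ler_sum => j _.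
by rewrite normrM ler_wpM2l // coord_le_norm1.
Qed.

Lemma dotp_le_norm1 m (z x : 'cV[R]_m) : `|dotp z x| <= norm1 z * norm1 x.
Proof.
apply: le_trans (ler_norm_sum _ _ _) _; rewrite /norm1 mulr_suml; apply: ler_sum => i _.
by rewrite normrM ler_wpM2l // coord_le_norm1.
Qed.

Lemma measurable_norm1 m d (T : measurableType d) (D : set T) (f : T -> 'cV[R]_m) :
  (forall i, measurable_fun D (fun x => f x i ord0)) ->
  measurable_fun D (fun x => norm1 (f x)).
Proof.
by move=> mf; apply: measurable_sum => i; apply: measurableT_comp => //; exact: mf.
Qed.

Lemma norm1_cV_integral m d (T : measurableType d) (mu : {measure set T -> \bar R})
    (D : set T) (f : T -> 'cV[R]_m) : measurable D ->
  (forall i, mu.-integrable D (EFin \o (fun x => f x i ord0))) ->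
  norm1 (cV_integral mu D f) <= \int[mu]_(x in D) norm1 (f x).
Proof.
move=> mD If; rewrite /norm1 Rintegral_sum //; last first.
  by move=> i; exact: integrable_norm.
by apply: ler_sum => i _; rewrite mxE le_normr_Rintegral.
Qed.

End norm1.

Lemma fine_lebesgue_ocitv (R : realType) (a b : R) : a <= b ->
  fine (@lebesgue_measure R `]a, b]) = b - a.
Proof.
move=> ab; rewrite (_ : lebesgue_measure _ = (b - a)%:E) //.
apply: etrans (lebesgue_measure_itv _) _; rewrite /= lte_fin.
case: ltP ab => // h1 h2; have -> : b = a by apply/eqP; rewrite eq_le h1 h2.
by rewrite subrr.
Qed.

Lemma discrete_gronwall (R : realType) (c : R) (f g : nat -> R) : 0 <= c -> f 0%N <= 0 ->
  (forall k, 0 <= g k) -> forall n, (forall k, (k < n)%N -> f k.+1 <= (1 + c) * f k + g k) ->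
  f n <= (1 + c) ^+ n * \sum_(j < n) g j.
Proof.
move=> c0 f0 g0; elim=> [|n IH] H; first by rewrite big_ord0 mulr0.
have c1 : 1 <= 1 + c by rewrite lerDl.
apply: le_trans (H n (ltnSn n)) _; rewrite big_ord_recr /= mulrDr; apply: lerD.
  rewrite exprS -mulrA ler_wpM2l ?(le_trans ler01) //.
  by apply: IH => k kn; apply: H; exact: ltnW.
by rewrite ler_peMl // exprn_ege1.
Qed.

Section euler.
Context (R : realType) (m : nat) (A : 'M[R]_m) (V X : R -> 'cV[R]_m) (t : R).
Local Notation leb := (@lebesgue_measure R).
Hypothesis t0 : 0 < t.
Hypothesis Xeq : forall s, 0 <= s -> s <= t ->
  X s = cV_integral leb `[0, s] (fun u => A *m X u) + V s.
Hypothesis bX : [bounded X s | s in `[0, t]].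
Hypothesis mX : measurable_fun (`[0, t] : set R) X.
Hypothesis rV : forall s, 0 <= s -> s < t -> V x @[x --> s^'+] --> V s.
Hypothesis V0 : V 0 = 0.

Let a := mnorm A.
Let a0 : 0 <= a. Proof. exact: mnorm_ge0. Qed.

Let bX1 : exists M, forall s, 0 <= s -> s <= t -> norm1 (X s) <= M.
Proof.
have [M0 [_ /(_ (M0 + 1)) h]] := bX.
exists (\sum_(i < m) (M0 + 1)) => s s0 st; apply: ler_sum => i _.
have hs : `|X s| <= M0 + 1 by apply: h; rewrite ?ltrDl //= in_itv /= s0.
apply: le_trans hs; rewrite [leRHS]mx_normrE.
by apply: (le_bigmax _ (fun ij => `|X s ij.1 ij.2|) (i, ord0)).
Qed.

Let M := sval (cid bX1).
Let XM s : 0 <= s -> s <= t -> norm1 (X s) <= M. Proof. exact: (svalP (cid bX1)). Qed.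
Let M0 : 0 <= M. Proof. by apply: le_trans (XM (lexx 0) (ltW t0)); exact: norm1_ge0. Qed.

Let mXi i : measurable_fun (`[0, t] : set R) (fun s => X s i ord0).
Proof. exact: (measurableT_comp (@measurable_coord R m 1 i ord0) mX). Qed.

Let mAX i : measurable_fun (`[0, t] : set R) (fun s => (A *m X s) i ord0).
Proof.
have -> : (fun s => (A *m X s) i ord0) = (fun s => \sum_j A i j * X s j ord0).
  by apply/funext => s; rewrite mxE.
apply: measurable_sum => j; by apply: measurable_funM => //; exact: mXi.
Qed.

Let bdd_int (D : set R) (f : R -> R) C : measurable D -> D `<=` `[0, t] ->
  measurable_fun (`[0, t] : set R) f -> (forall s, 0 <= s -> s <= t -> `|f s| <= C) ->
  leb.-integrable D (EFin \o f).
Proof.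
move=> mD DS mf fC; apply: measurable_bounded_integrable => //.
- apply: (@le_lt_trans _ _ (leb `[0, t])); first by apply: le_measure; rewrite ?inE.
  by rewrite /= lebesgue_measure_itv /= lte_fin t0 -EFinB ltry.
- exact: measurable_funS mf.
- exists C; split; first exact: num_real.
  move=> C' CC' s /DS /=; rewrite in_itv /= => /andP[s0 st].
  by apply: le_trans (ltW CC'); exact: fC.
Qed.

Let sub_itv c d (b1 b2 : bool) : 0 <= c -> d <= t ->
  [set` Interval (BSide b1 c) (BSide b2 d)] `<=` `[0, t].
Proof.
move=> c0 dt s /=; rewrite !in_itv /=; case: b1; case: b2 => /andP[h1 h2]; apply/andP; split;
  by rewrite ?(le_trans c0) ?(le_trans _ dt) ?(ltW h1) ?(ltW h2).
Qed.

Let AXC i s : 0 <= s -> s <= t -> `|(A *m X s) i ord0| <= a * M.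
Proof.
move=> s0 st; apply: le_trans (coord_le_norm1 _ _) _.
by apply: le_trans (norm1_mulmx _ _) _; rewrite ler_wpM2l // XM.
Qed.

Let incr s s' : 0 <= s -> s <= s' -> s' <= t ->
  X s' - X s = cV_integral leb `]s, s'] (fun u => A *m X u) + (V s' - V s).
Proof.
move=> s0 ss st; have s'0 := le_trans s0 ss; have st' := le_trans ss st.
rewrite (Xeq s'0 st) (Xeq s0 st').
rewrite opprD addrACA; congr (_ + _); apply/matrixP => i j; rewrite !mxE.
apply: Rintegral_itvB; rewrite ?bnd_simp //.
by apply: (bdd_int (C := a * M)) => //; [exact: sub_itv|exact: AXC].
Qed.

Let norm1_int s s' : 0 <= s -> s <= s' -> s' <= t ->
  norm1 (cV_integral leb `]s, s'] (fun u => A *m X u)) <= a * M * (s' - s).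
Proof.
move=> s0 ss st.
have sub := @sub_itv s s' false false s0 st.
have If i : leb.-integrable `]s, s'] (EFin \o (fun x => (A *m X x) i ord0)).
  by apply: (bdd_int (C := a * M)) => //; exact: AXC.
apply: le_trans (norm1_cV_integral _ If) _ => //.
have -> : a * M * (s' - s) = \int[leb]_(u in `]s, s']) (cst (a * M) u).
  by rewrite Rintegral_cst //; congr (_ * _); rewrite -(fine_lebesgue_ocitv ss).
apply: le_Rintegral => //.
- apply: (bdd_int (C := a * M)) => //.
    by apply: measurable_norm1 => i; exact: mAX.
  move=> u u0 ut; rewrite ger0_norm ?norm1_ge0 //.
  by apply: le_trans (norm1_mulmx _ _) _; rewrite ler_wpM2l // XM.
- apply: (bdd_int (C := a * M)) => // u _ _; rewrite ger0_norm //.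
  by rewrite mulr_ge0.
- move=> u /sub /=; rewrite in_itv /= => /andP[u0 ut].
  by apply: le_trans (norm1_mulmx _ _) _; rewrite ler_wpM2l // XM.
Qed.

(** [X] inherits right continuity from [V], since the integral term is Lipschitz in time. *)
Let rX u e : 0 <= u -> u < t -> 0 < e ->
  exists2 dl, 0 < dl & forall v, u <= v -> v < u + dl -> v <= t -> norm1 (X v - X u) <= e.
Proof.
move=> u0 ut e0.
have cV : norm1 (V x - V u) @[x --> u^'+] --> (0 : R).
  have -> : (0 : R) = \sum_(i < m) `|V u i ord0 - V u i ord0|.
    by rewrite big1 // => i _; rewrite subrr normr0.
  have -> : (fun x => norm1 (V x - V u)) = (fun x => \sum_(i < m) `|V x i ord0 - V u i ord0|).
    by apply/funext => x; apply: eq_bigr => i _; rewrite !mxE.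
  apply: cvgr_sum => i; apply: cvg_norm; apply: cvgB; last exact: cvg_cst.
  exact: (cvg_comp _ _ (rV u0 ut) (@coord_continuous R m 1 i ord0 (V u))).
have e20 : 0 < e / 2 by rewrite divr_gt0.
move/cvgrPdist_le : cV => /(_ _ e20).
rewrite near_withinE => /nbhs_ballP[d1 /= d10 H].
pose d2 := e / 2 / (a * M + 1).
have c0 : 0 < a * M + 1 by rewrite ltr_wpDl // mulr_ge0.
have d20 : 0 < d2 by rewrite divr_gt0.
exists (Num.min d1 d2); first by rewrite lt_min d10.
move=> v; rewrite le_eqVlt => /orP[/eqP <- _ _|uv vd vt].
  by rewrite subrr norm1_0 ltW.
rewrite incr ?(ltW uv) //; apply: le_trans (norm1D _ _) _.
rewrite [e]splitr; apply: lerD.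
  apply: le_trans (norm1_int _ _ _) _; rewrite ?(ltW uv) //.
  apply: (@le_trans _ _ ((a * M + 1) * d2)); last by rewrite mulrC divfK // gt_eqF.
  apply: ler_pM; rewrite ?mulr_ge0 ?subr_ge0 ?(ltW uv) // ?lerDl //.
  by rewrite lerBlDl ltW // (lt_le_trans vd) // lerD2l ge_min lexx orbT.
have := H v; rewrite sub0r normrN ger0_norm ?norm1_ge0 //; apply => //=.
rewrite /ball /= distrC gtr0_norm ?subr_gt0 // ltrBlDl (lt_le_trans vd) //.
by rewrite lerD2l ge_min lexx.
Qed.


Let h (n : nat) : R := t / n.+1%:R.
Let tt n j : R := j%:R * h n.

Let h0 n : 0 < h n. Proof. by rewrite divr_gt0. Qed.
Let hE n : n.+1%:R * h n = t. Proof. by rewrite /h mulrC divfK // pnatr_eq0. Qed.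
Let tt0 n j : 0 <= tt n j. Proof. by rewrite mulr_ge0 // ltW. Qed.
Let ttS n j : tt n j.+1 = tt n j + h n.
Proof. by rewrite /tt -natr1 mulrDl mul1r. Qed.
Let tt_le n j : (j <= n.+1)%N -> tt n j <= t.
Proof. by move=> jn; rewrite -(hE n) ler_wpM2r ?ler_nat // ltW. Qed.
Let tt_mono n i j : (i <= j)%N -> tt n i <= tt n j.
Proof. by move=> ij; rewrite ler_wpM2r ?ler_nat // ltW. Qed.

Definition euler_step (B : 'M[R]_m) (s : R) : 'M[R]_m := 1%:M + s *: B.

(** The solved form of the explicit scheme S(k+1) = S(k) + h A S(k) + increment of V, started at 0;
    with h = t/(n+1) time t is reached at k = n+1. *)
Definition euler_sum n (k : nat) : 'cV[R]_m :=
  \sum_(j < k) (euler_step A (h n) ^+ (k - j.+1)) *m (V (tt n j.+1) - V (tt n j)).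

Let euler_sumS n k : euler_sum n k.+1 =
  euler_sum n k + h n *: (A *m euler_sum n k) + (V (tt n k.+1) - V (tt n k)).
Proof.
rewrite /euler_sum big_ord_recr /= subnn expr0 mul1mx; congr (_ + _).
transitivity (euler_step A (h n) *m euler_sum n k); last first.
  by rewrite /euler_step mulmxDl mul1mx scalemxAl.
rewrite /euler_sum mulmx_sumr; apply: eq_bigr => i _.
by rewrite subSn // exprS mulmxA.
Qed.

Let I n j : set R := `]tt n j, tt n j.+1].
Let e n j u : R := norm1 (X u - X (tt n j.+1)).

Let me n j : measurable_fun (`[0, t] : set R) (e n j).
Proof.
apply: measurable_norm1 => i.
have -> : (fun u => (X u - X (tt n j.+1)) i ord0) = (fun u => X u i ord0 - X (tt n j.+1) i ord0).
  by apply/funext => u; rewrite !mxE.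
by apply: measurable_funB => //; exact: mXi.
Qed.

Let e_le n j : (j < n.+1)%N -> forall u, 0 <= u -> u <= t -> `|e n j u| <= M + M.
Proof.
move=> jn u u0 ut; rewrite ger0_norm ?norm1_ge0 //; apply: le_trans (norm1B _ _) _.
by apply: lerD; apply: XM => //; exact: tt_le.
Qed.

Let I_sub n j : (j < n.+1)%N -> I n j `<=` `[0, t].
Proof. by move=> jn; apply: (@sub_itv _ _ false false) => //; exact: tt_le. Qed.

(** The integral is compared with the value at the right end of the interval: [V] jumps, and X(v)
    tends to X(u) only as v tends to u from the right. *)
Let res n j := cV_integral leb (I n j) (fun u => A *m X u) - h n *: (A *m X (tt n j.+1)).

Let res_le n j : (j < n.+1)%N -> norm1 (res n j) <= a * \int[leb]_(u in I n j) e n j u.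
Proof.
move=> jn; have IS := I_sub jn.
have tj : tt n j.+1 <= t by exact: tt_le.
have mI : measurable (I n j : set (measurableTypeR R)) by exact: measurable_itv.
have If i : leb.-integrable (I n j) (EFin \o (fun x => (A *m X x) i ord0)).
  by apply: (bdd_int (C := a * M)) => //; exact: AXC.
have Ic i : leb.-integrable (I n j) (EFin \o (fun x => cst ((A *m X (tt n j.+1)) i ord0) x)).
  apply: (bdd_int (C := a * M)) => // *; exact: AXC.
have rE : res n j = cV_integral leb (I n j) (fun u => A *m (X u - X (tt n j.+1))).
  apply/matrixP => i c; rewrite (ord1 c) !mxE.
  transitivity (\int[leb]_(u in I n j) ((A *m X u) i ord0 - cst ((A *m X (tt n j.+1)) i ord0) u)).
    rewrite (RintegralB mI (If i) (Ic i)) Rintegral_cst //.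
    rewrite fine_lebesgue_ocitv; last by exact: tt_mono.
    have -> : tt n j.+1 - tt n j = h n by rewrite ttS addrAC subrr add0r.
    by rewrite [in RHS]mxE [in RHS]mulrC.
  by apply: eq_Rintegral => u _; rewrite mulmxBr !mxE.
have Ie : leb.-integrable (I n j) (EFin \o e n j).
  apply: (bdd_int (C := M + M)) => //; exact: e_le.
have mAe i : measurable_fun (`[0, t] : set R) (fun u => (A *m (X u - X (tt n j.+1))) i ord0).
  have -> : (fun u => (A *m (X u - X (tt n j.+1))) i ord0) =
     (fun u => (A *m X u) i ord0 - (A *m X (tt n j.+1)) i ord0).
    by apply/funext => u; rewrite mulmxBr !mxE.
  by apply: measurable_funB => //; exact: mAX.
have Ale u : norm1 (A *m (X u - X (tt n j.+1))) <= a * e n j u by exact: norm1_mulmx.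
have IAe i : leb.-integrable (I n j) (EFin \o (fun u => (A *m (X u - X (tt n j.+1))) i ord0)).
  apply: (bdd_int (C := a * (M + M))) => // u u0 ut.
  apply: le_trans (coord_le_norm1 _ _) _; apply: le_trans (Ale u) _.
  by rewrite ler_wpM2l // (le_trans (ler_norm _)) // e_le.
rewrite rE; apply: le_trans (norm1_cV_integral _ IAe) _ => //.
rewrite -RintegralZl //; apply: le_Rintegral => //.
- apply: (bdd_int (C := a * (M + M))) => //; first exact: measurable_norm1.
  move=> u u0 ut; rewrite ger0_norm ?norm1_ge0 //; apply: le_trans (Ale u) _.
  by rewrite ler_wpM2l // (le_trans (ler_norm _)) // e_le.
- exact: (integrableZl mI a Ie).
Qed.

(** The scheme uses left end values and the residual right end ones; subtracting the term h A X from
    the error reconciles them, leaving only a source of order h^2 besides the residual. *)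
Let F n k := (X (tt n k) - euler_sum n k) - h n *: (A *m X (tt n k)).

Let FS n k : (k < n.+1)%N ->
  F n k.+1 = F n k + h n *: (A *m F n k) + (h n ^+ 2 *: (A *m (A *m X (tt n k))) + res n k).
Proof.
move=> kn.
have inc := incr (tt0 n k) (tt_mono n (leqnSn k)) (tt_le kn).
have XS : X (tt n k.+1) = X (tt n k) + (cV_integral leb (I n k) (fun u => A *m X u)
    + (V (tt n k.+1) - V (tt n k))) by rewrite -inc addrC subrK.
rewrite /F /res euler_sumS {1}XS.
rewrite !mulmxBr -!scalemxAr.
move: (A *m X (tt n k)) (A *m euler_sum n k) (A *m (A *m X (tt n k))) => a1 a2 a3.
move: (cV_integral _ _ _) (A *m X (tt n k.+1)) (X (tt n k)) (euler_sum n k) => c1 c2 c3 c4.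
move: (V _) (V _) => v1 v2.
by apply/matrixP => i j; rewrite !mxE; ring.
Qed.

(** The distances to the right end values glued into one function on ]0, t], so that the sum of all
    residuals is treated by a single dominated convergence. *)
Let G n u := \sum_(j < n.+1) ((e n j) \_ (I n j)) u.

Let Gj n (j : 'I_n.+1) u : I n j u -> G n u = e n j u.
Proof.
move=> Iu; rewrite /G (bigD1 j) //= patchE mem_set // big1 ?addr0 // => j' jj.
  rewrite patchE memNset // => Iu'.
  move: Iu Iu'; rewrite /I /= !in_itv /= => /andP[h1 h2] /andP[h3 h4].
  move/eqP: jj; apply; apply: val_inj; apply/eqP; rewrite eqn_leq; apply/andP; split;
    rewrite leqNgt; apply/negP => lt.
    by have := lt_le_trans h3 (le_trans h2 (tt_mono n lt)); rewrite ltxx.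
  by have := lt_le_trans h1 (le_trans h4 (tt_mono n lt)); rewrite ltxx.
Qed.

Let G_cvg u : 0 < u -> u <= t -> G n u @[n --> \oo] --> (0 : R).
Proof.
move=> u0 ut.
have exj n : exists j : 'I_n.+1, I n j u.
  have ex : exists j, u <= tt n j.+1 by exists n; rewrite /tt hE.
  have [j uj jmin] := ex_minnP ex.
  have jn : (j < n.+1)%N by rewrite ltnS; apply: jmin; rewrite /tt hE.
  exists (Ordinal jn); rewrite /I /= in_itv /= uj andbT.
  case: (j) jmin => [_|j' jmin]; first by rewrite /tt mul0r.
  by rewrite ltNge; apply/negP => /jmin; rewrite ltnn.
apply/cvgrPdist_le => ep ep0.
have [ut'|tu] := ltP u t; last first.
  apply: nearW => n; have [j Ij] := exj n; rewrite (Gj Ij) sub0r normrN ger0_norm ?norm1_ge0 //.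
  move: Ij; rewrite /I /= in_itv /= => /andP[_ uj].
  have -> : u = tt n j.+1.
    apply/eqP; rewrite eq_le uj; apply: le_trans tu; exact: tt_le.
  by rewrite /e subrr norm1_0 ltW.
have [dl dl0 H] := rX (ltW u0) ut' ep0.
have hn : h n @[n --> \oo] --> (0 : R).
  by rewrite -(mulr0 t); apply: cvgM; [exact: cvg_cst|exact: cvg_harmonic].
move/cvgrPdist_lt : hn => /(_ _ dl0); apply: filterS => n; rewrite sub0r normrN gtr0_norm // => hdl.
have [j Ij] := exj n; rewrite (Gj Ij) sub0r normrN ger0_norm ?norm1_ge0 //.
move: Ij; rewrite /I /= in_itv /= ttS => /andP[ju uj].
rewrite /e -norm1N opprB ttS; apply: H => //.
  by apply: lt_trans (_ : u + h n < _); rewrite ?ltrD2l // ltrD2r.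
by rewrite -ttS; exact: tt_le.
Qed.

Let IG n : \int[leb]_(u in `]0, t]) G n u = \sum_(j < n.+1) \int[leb]_(u in I n j) e n j u.
Proof.
have IS (j : 'I_n.+1) : I n j `<=` `]0, t].
  move=> u; rewrite /I /= !in_itv /= => /andP[h1 h2]; apply/andP; split.
    exact: le_lt_trans (tt0 n j) h1.
  by apply: le_trans h2 _; exact: tt_le.
rewrite /G Rintegral_sum //=.
  apply: eq_bigr => j _; rewrite -Rintegral_mkcondr; congr (Rintegral _ _ _).
  by rewrite setIidr.
move=> j; rewrite -restrict_EFin; apply/integrable_restrict => //.
  exact: measurable_itv.
rewrite setIidr //.
by apply: (bdd_int (C := M + M)); [exact: measurable_itv|exact: I_sub|exact: me|exact: e_le].
Qed.


Let G_le n u : 0 <= u -> u <= t -> 0 <= G n u <= M + M.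
Proof.
move=> u0 ut.
have [[j Ij]|nj] := pselect (exists j : 'I_n.+1, I n j u).
  by rewrite (Gj Ij) norm1_ge0 /= (le_trans (ler_norm _)) // e_le.
rewrite /G big1 ?lexx ?addr_ge0 // => j _; rewrite patchE memNset // => Ij.
by apply: nj; exists j.
Qed.

Let IG_cvg : \int[leb]_(u in `]0, t]) G n u @[n --> \oo] --> (0 : R).
Proof.
have mD : measurable (`]0, t]%classic : set (measurableTypeR R)) by exact: measurable_itv.
have mG n : measurable_fun (`]0, t]%classic : set (measurableTypeR R)) (G n).
  apply: measurable_sum => j.
  have mI : measurable (I n j : set (measurableTypeR R)) by exact: measurable_itv.
  apply/measurable_restrict => //.
  apply: (@measurable_funS _ _ _ _ (`[0, t]%classic : set (measurableTypeR R))) => //.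
    by move=> u [_]; apply: I_sub.
  exact: me.
have DS : (`]0, t] : set R) `<=` `[0, t] by exact: (@sub_itv 0 t false false).
have := @dominated_convergence _ _ R leb `]0, t] mD (fun n x => (G n x)%:E) (EFin \o cst 0)
  (EFin \o cst (M + M)).
case.
- by move=> n; exact/measurable_EFinP.
- exact/measurable_EFinP.
- apply: aeW => u /=; rewrite in_itv /= => /andP[u0 ut].
  by apply: cvg_EFin; [exact: nearW|exact: G_cvg].
- by apply: (bdd_int (C := `|M + M|)).
- apply: aeW => u n /DS /=; rewrite in_itv /= => /andP[u0 ut].
  by have /andP[g0 gM] := G_le n u0 ut; rewrite lee_fin ger0_norm.
move=> _ _ H; apply: fine_cvg.
have E0 : (\int[leb]_(x in `]0%R, t]) (EFin \o cst 0%R) x = 0)%E by rewrite integral0_eq.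
by rewrite E0 in H.
Qed.

Lemma euler_cvg : norm1 (X t - euler_sum n n.+1) @[n --> \oo] --> (0 : R).
Proof.
have F0 n : F n 0%N = 0.
  have X0 : X (tt n 0) = 0.
    rewrite /tt mul0r Xeq ?(ltW t0) // V0 addr0.
    apply/matrixP => i c; rewrite !mxE set_itv1; exact: Rintegral_set1.
  by rewrite /F X0 /euler_sum big_ord0 mulmx0 scaler0 !subr0.
(* Gronwall over n+1 steps of growth 1 + h a gives the exponential; the sources add up to the terms
   in the bracket, and the last term restores the correction subtracted in [F]. *)
have bnd n : norm1 (X t - euler_sum n n.+1) <=
   expR (t * a) * (t * (h n * a ^+ 2 * M) + a * \int[leb]_(u in `]0, t]) G n u) + h n * (a * M).
  have ttn : tt n n.+1 = t by rewrite /tt hE.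
  have -> : X t - euler_sum n n.+1 = F n n.+1 + h n *: (A *m X t) by rewrite /F ttn subrK.
  apply: le_trans (norm1D _ _) _; apply: lerD; last first.
    rewrite norm1Z gtr0_norm // ler_wpM2l ?(ltW (h0 n)) //.
    by apply: le_trans (norm1_mulmx _ _) _; rewrite ler_wpM2l // XM // ltW.
  have Ge0 (j : 'I_n.+1) : 0 <= \int[leb]_(u in I n j) e n j u.
    by apply: Rintegral_ge0 => u _; exact: norm1_ge0.
  pose g j := h n ^+ 2 * (a * (a * M)) + (if (j < n.+1)%N then a * \int[leb]_(u in I n j) e n j u else 0).
  have g0 k : 0 <= g k.
    rewrite /g addr_ge0 //; first by rewrite !mulr_ge0 // ltW.
    case: ifPn => // kn.
    by rewrite mulr_ge0 // (Ge0 (Ordinal kn)).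
  have ha : 0 <= h n * a by rewrite mulr_ge0 // ltW.
  apply: le_trans (@discrete_gronwall _ (h n * a) (fun k => norm1 (F n k)) g ha _ g0 n.+1 _) _.
  - by rewrite F0 norm1_0.
  - move=> k kn; rewrite FS //; apply: le_trans (norm1D _ _) _; apply: lerD.
      apply: le_trans (norm1D _ _) _; rewrite mulrDl mul1r lerD2l norm1Z gtr0_norm //.
      by rewrite -mulrA ler_wpM2l ?(ltW (h0 n)) // norm1_mulmx.
    apply: le_trans (norm1D _ _) _; rewrite /g kn; apply: lerD; last exact: res_le.
    rewrite norm1Z ger0_norm ?sqr_ge0 // ler_wpM2l ?sqr_ge0 //.
    apply: le_trans (norm1_mulmx _ _) _; rewrite ler_wpM2l //.
    apply: le_trans (norm1_mulmx _ _) _; rewrite ler_wpM2l // XM //.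
    by apply: tt_le; exact: ltnW.
  have sg : \sum_(j < n.+1) g j = t * (h n * a ^+ 2 * M) + a * \int[leb]_(u in `]0, t]) G n u.
    rewrite /g big_split /= sumr_const card_ord; congr (_ + _).
      by rewrite -mulr_natl -{1}(hE n); ring.
    by rewrite IG mulr_sumr; apply: eq_bigr => j _; rewrite ltn_ord.
  rewrite sg ler_wpM2r //.
    by rewrite -sg sumr_ge0.
  apply: (@le_trans _ _ (expR (h n * a) ^+ n.+1)).
    by rewrite lerXn2r // ?nnegrE ?expR_ge0 ?addr_ge0 // expR_ge1Dx.
  by rewrite -expRM_natl mulrA hE.
have hn : h n @[n --> \oo] --> (0 : R).
  by rewrite -(mulr0 t); apply: cvgM; [exact: cvg_cst|exact: cvg_harmonic].
apply: (@squeeze_cvgr _ _ _ _ (cst 0) (fun n => expR (t * a) * (t * (h n * a ^+ 2 * M) +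
    a * \int[leb]_(u in `]0, t]) G n u) + h n * (a * M))).
- by apply: nearW => n; rewrite norm1_ge0 bnd.
- exact: cvg_cst.
suff H : expR (t * a) * (t * (h n * a ^+ 2 * M) + a * \int[leb]_(u in `]0, t]) G n u) + h n * (a * M)
    @[n --> \oo] --> expR (t * a) * (t * (0 * a ^+ 2 * M) + a * 0) + 0 * (a * M).
  by rewrite !mul0r !mulr0 !addr0 mulr0 in H.
apply: cvgD.
  apply: cvgM; first exact: cvg_cst.
  apply: cvgD; (apply: cvgM; first exact: cvg_cst) => //.
  apply: cvgM; last exact: cvg_cst.
  by apply: cvgM => //; exact: cvg_cst.
by apply: cvgM => //; exact: cvg_cst.
Qed.

End euler.

(** * Observability of the Euler scheme *)

(** The scalar source of the constants in [step_growth], [step_lipschitz] and [step_quadratic],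
    which compare E^s with its Taylor expansion uniformly in the step size. *)
Lemma expr1D_le2 (R : realFieldType) (x : R) (r : nat) : 0 <= x -> r%:R * x <= 1 ->
  (1 + x) ^+ r <= 1 + r%:R * x + (r%:R * x) ^+ 2.
Proof.
move=> x0; elim: r => [|r IH] rx; first by rewrite expr0 mul0r expr0n addr0 addr0.
have rx1 : r%:R * x <= 1.
  by apply: le_trans rx; rewrite ler_wpM2r // ler_nat.
rewrite exprSr; apply: le_trans (ler_wpM2r _ (IH rx1)) _; first by rewrite addr_ge0.
rewrite -natr1; have r0 : 0 <= r%:R :> R by [].
have : 0 <= x ^+ 2 * (r%:R * (1 - r%:R * x) + 1).
  by rewrite mulr_ge0 ?sqr_ge0 // addr_ge0 // mulr_ge0 // subr_ge0.
nra.
Qed.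

Section observability.
Context (R : realType) (m : nat) (A : 'M[R]_m).
Let a := mnorm A.
Let a0 : 0 <= a. Proof. exact: mnorm_ge0. Qed.

Section steps.
Context (h : R) (h0 : 0 <= h).
Let E s (x : 'cV[R]_m) := (euler_step A h ^+ s) *m x.

Let ES s x : E s.+1 x = E s x + h *: (A *m E s x).
Proof. by rewrite /E exprS -mulmxA /euler_step mulmxDl mul1mx scalemxAl. Qed.

Let E0 x : E 0 x = x. Proof. by rewrite /E expr0 mul1mx. Qed.

Let ha : 0 <= h * a. Proof. exact: mulr_ge0. Qed.

Let E_le s x : norm1 (E s x) <= (1 + h * a) ^+ s * norm1 x.
Proof.
elim: s => [|s IH]; first by rewrite E0 expr0 mul1r.
rewrite ES exprS -mulrA; apply: le_trans (norm1D _ _) _.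
rewrite norm1Z ger0_norm //.
apply: (@le_trans _ _ ((1 + h * a) * norm1 (E s x))); last by rewrite ler_wpM2l // addr_ge0.
by rewrite mulrDl mul1r lerD2l -mulrA ler_wpM2l // norm1_mulmx.
Qed.

Let E1_le s x : norm1 (E s x - x) <= ((1 + h * a) ^+ s - 1) * norm1 x.
Proof.
elim: s => [|s IH]; first by rewrite E0 subrr norm1_0 expr0 subrr mul0r.
have -> : E s.+1 x - x = (E s x - x) + h *: (A *m (E s x)).
  by rewrite ES addrAC.
apply: le_trans (norm1D _ _) _.
have h1 : norm1 (h *: (A *m E s x)) <= h * a * ((1 + h * a) ^+ s * norm1 x).
  rewrite norm1Z ger0_norm // -mulrA ler_wpM2l //.
  by apply: le_trans (norm1_mulmx _ _) _; rewrite ler_wpM2l // E_le.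
apply: le_trans (lerD IH h1) _; rewrite exprS le_eqVlt; apply/orP; left; apply/eqP; ring.
Qed.

Let E2_le s x : norm1 (E s x - x - (s%:R * h) *: (A *m x)) <=
  ((1 + h * a) ^+ s - 1 - s%:R * (h * a)) * norm1 x.
Proof.
elim: s => [|s IH].
  by rewrite E0 subrr mul0r scale0r subrr norm1_0 expr0 subrr mul0r subr0 mul0r.
have -> : E s.+1 x - x - (s.+1%:R * h) *: (A *m x) =
  (E s x - x - (s%:R * h) *: (A *m x)) + h *: (A *m (E s x - x)).
  rewrite ES mulmxBr; move: (E s x) (A *m E s x) (A *m x) => b1 b2 b3.
  by apply/matrixP => i j; rewrite !mxE -natr1; ring.
apply: le_trans (norm1D _ _) _.
have h1 : norm1 (h *: (A *m (E s x - x))) <= h * a * (((1 + h * a) ^+ s - 1) * norm1 x).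
  rewrite norm1Z ger0_norm // -mulrA ler_wpM2l //.
  by apply: le_trans (norm1_mulmx _ _) _; rewrite ler_wpM2l // E1_le.
apply: le_trans (lerD IH h1) _; rewrite exprS -natr1 le_eqVlt; apply/orP; left; apply/eqP; ring.
Qed.

Lemma step_growth s x : s%:R * (h * a) <= 1 -> norm1 (euler_step A h ^+ s *m x) <= 3 * norm1 x.
Proof.
move=> s1; apply: le_trans (E_le s x) _; rewrite ler_wpM2r ?norm1_ge0 //.
apply: le_trans (expr1D_le2 ha s1) _.
have : (s%:R * (h * a)) ^+ 2 <= 1 by rewrite expr_le1 // mulr_ge0.
lra.
Qed.

Lemma step_lipschitz s x : s%:R * (h * a) <= 1 ->
  norm1 (euler_step A h ^+ s *m x - x) <= 2 * (s%:R * h * a) * norm1 x.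
Proof.
move=> s1; apply: le_trans (E1_le s x) _; rewrite ler_wpM2r ?norm1_ge0 //.
rewrite lerBlDl; apply: le_trans (expr1D_le2 ha s1) _.
have s0 : 0 <= s%:R * (h * a) by rewrite mulr_ge0.
have : (s%:R * (h * a)) ^+ 2 <= s%:R * (h * a) by rewrite expr2 ler_piMl.
rewrite -mulrA; lra.
Qed.

Lemma step_quadratic s x : s%:R * (h * a) <= 1 ->
  norm1 (euler_step A h ^+ s *m x - x - (s%:R * h) *: (A *m x)) <=
  (s%:R * h * a) ^+ 2 * norm1 x.
Proof.
move=> s1; apply: le_trans (E2_le s x) _; rewrite ler_wpM2r ?norm1_ge0 //.
by rewrite -addrA -opprD lerBlDl; apply: le_trans (expr1D_le2 ha s1) _; rewrite !mulrA.
Qed.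

End steps.

(** Error constants of the p-th difference: one more difference multiplies the previous error by at
    most 2 tau a and adds the quadratic remainder (tau a)^2 at A^p x; powers of tau are factored
    out. *)
Fixpoint diff_coef (p : nat) : R :=
  if p is q.+1 then 2 * a * diff_coef q + a ^+ 2 * a ^+ q else 0.

Lemma diff_coef_ge0 p : 0 <= diff_coef p.
Proof.
by elim: p => //= p IH; rewrite addr_ge0 // !mulr_ge0 ?exprn_ge0 // ?sqr_ge0.
Qed.

Lemma mulmx_exprS p (x : 'cV[R]_m) : A ^+ p.+1 *m x = A *m (A ^+ p *m x).
Proof. by rewrite exprS -mulmxA. Qed.

Lemma mulmx_exp_le p x : norm1 (A ^+ p *m x) <= a ^+ p * norm1 x.
Proof.
elim: p => [|p IH]; first by rewrite !expr0 mul1mx mul1r.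
rewrite mulmx_exprS exprS -mulrA; apply: le_trans (norm1_mulmx _ _) _.
by rewrite ler_wpM2l.
Qed.

Section differences.
Context (h : R) (r : nat).
Hypotheses (h0 : 0 <= h) (r1 : r%:R * (h * a) <= 1).
Let T (x : 'cV[R]_m) := euler_step A h ^+ r *m x.
Let tau := r%:R * h.

Definition step_diff (x : 'cV[R]_m) := euler_step A h ^+ r *m x - x.

Let diffB x y : step_diff (x - y) = step_diff x - step_diff y.
Proof.
rewrite /step_diff mulmxBr; move: (_ *m x) (_ *m y) => u v.
by apply/matrixP => i j; rewrite !mxE; ring.
Qed.

(* The finite differences of step [r * h = tau] of s |-> E^s x approximate tau^p A^p x;
   so if [g] is small along the scheme, it is small at each A^p x. *)
Lemma iter_step_diff p x :
  norm1 (iter p step_diff x - tau ^+ p *: (A ^+ p *m x)) <= tau ^+ p.+1 * diff_coef p * norm1 x.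
Proof.
have tau0 : 0 <= tau by rewrite mulr_ge0.
elim: p => [|p IH].
  by rewrite /= !expr0 mul1mx scale1r subrr norm1_0 mulr0 mul0r.
have -> : iter p.+1 step_diff x - tau ^+ p.+1 *: (A ^+ p.+1 *m x) =
   step_diff (iter p step_diff x - tau ^+ p *: (A ^+ p *m x)) +
   tau ^+ p *: (step_diff (A ^+ p *m x) - tau *: (A *m (A ^+ p *m x))).
  rewrite diffB iterS.
  have -> : step_diff (tau ^+ p *: (A ^+ p *m x)) = tau ^+ p *: step_diff (A ^+ p *m x).
    by rewrite /step_diff -scalemxAr scalerBr.
  rewrite mulmx_exprS.
  move: (step_diff (iter p step_diff x)) (step_diff (A ^+ p *m x)) (A *m _) => u v w.
  by apply/matrixP => i j; rewrite !mxE exprS; ring.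
apply: le_trans (norm1D _ _) _.
have k1 : norm1 (step_diff (iter p step_diff x - tau ^+ p *: (A ^+ p *m x))) <=
    2 * (tau * a) * (tau ^+ p.+1 * diff_coef p * norm1 x).
  apply: le_trans (step_lipschitz h0 _ r1) _; rewrite ler_wpM2l //.
  by rewrite !mulr_ge0.
have k2 : norm1 (tau ^+ p *: (step_diff (A ^+ p *m x) - tau *: (A *m (A ^+ p *m x)))) <=
    tau ^+ p * ((tau * a) ^+ 2 * (a ^+ p * norm1 x)).
  rewrite norm1Z ger0_norm ?exprn_ge0 // ler_wpM2l ?exprn_ge0 //.
  apply: le_trans (step_quadratic h0 _ r1) _; rewrite ler_wpM2l ?sqr_ge0 //.
  exact: mulmx_exp_le.
apply: le_trans (lerD k1 k2) _.
rewrite /= !exprS le_eqVlt; apply/orP; left; apply/eqP; rewrite expr0; ring.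
Qed.

(** Each difference splits into two differences of lower order along the orbit of [T], hence the
    factor 2^p. *)
Lemma iter_step_diff_le (g : 'cV[R]_m -> R) (x : 'cV[R]_m) (b : R) (p : nat) :
  (forall u v, g (u - v) <= g u + g v) ->
  (forall i, (i <= p)%N -> g (iter i T x) <= b) ->
  g (iter p step_diff x) <= 2 ^+ p * b.
Proof.
move=> gB H.
have iterB q u v : iter q step_diff (u - v) = iter q step_diff u - iter q step_diff v.
  by elim: q => //= q ->; rewrite diffB.
have key q : (q <= p)%N -> forall i, (i + q <= p)%N -> g (iter q step_diff (iter i T x)) <= 2 ^+ q * b.
  elim: q => [_ i ip|q IH qp i ip].
    by rewrite mul1r; apply: H; rewrite addn0 in ip.
  have -> : iter q.+1 step_diff (iter i T x) =
     iter q step_diff (iter i.+1 T x) - iter q step_diff (iter i T x).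
    by rewrite iterSr -iterB.
  apply: le_trans (gB _ _) _; rewrite exprS -mulrA mulr_natl mulr2n.
  apply: lerD; apply: IH; rewrite ?(ltnW qp) //; first by rewrite addSnnS.
  by apply: leq_trans ip; rewrite leq_add2l.
have := key p (leqnn p) 0%N; rewrite add0n; exact.
Qed.

End differences.

End observability.

Section kalman.
Context (R : realType).

Lemma trmx_exp m (A : 'M[R]_m) p : (A ^+ p)^T = A^T ^+ p.
Proof.
elim: p => [|p IH]; first by rewrite !expr0 trmx1.
by rewrite exprSr exprS -IH; exact: trmx_mul.
Qed.

Lemma norm1_sum m n (f : 'I_n -> 'cV[R]_m) : norm1 (\sum_i f i) <= \sum_i norm1 (f i).
Proof.
elim/big_ind2 : _ => [|x a y b h1 h2|//]; first by rewrite norm1_0.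
by apply: le_trans (norm1D _ _) _; exact: lerD.
Qed.

(** Kalman duality: the full rank matrix has a right inverse, whose transpose reconstructs z
    linearly from the observations of (A^T)^p z. *)
Lemma controllability_observable m k d (A : 'M[R]_m) (B : 'M[R]_(m, k)) (D : 'M[R]_(m, d)) :
  \rank (controllability_mx A B D) = m ->
  exists2 c : R, 0 <= c & forall z : 'cV[R]_m, norm1 z <=
    c * \sum_(p < m) (norm1 (B^T *m (A^T ^+ p *m z)) + norm1 (D^T *m (A^T ^+ p *m z))).
Proof.
move=> rk.
have /row_freeP[K HK] : row_free (controllability_mx A B D) by rewrite /row_free rk.
pose L := K^T.
pose L1 p := submxrow (lsubmx L) p; pose L2 p := submxrow (rsubmx L) p.
exists (\sum_(p < m) (mnorm (L1 p) + mnorm (L2 p))).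
  by apply: sumr_ge0 => p _; rewrite addr_ge0 ?mnorm_ge0.
move=> z.
have zE : z = \sum_(p < m) L1 p *m (B^T *m (A^T ^+ p *m z)) +
              \sum_(p < m) L2 p *m (D^T *m (A^T ^+ p *m z)).
  have : L *m (controllability_mx A B D)^T = 1%:M by rewrite -trmx_mul HK trmx1.
  move/(congr1 (mulmx^~ z)); rewrite mul1mx => {1}<-.
  rewrite /controllability_mx tr_row_mx -{1}(hsubmxK L) mul_row_col !tr_mxrow.
  rewrite -{1}(submxrowK (lsubmx L)) -{1}(submxrowK (rsubmx L)) !mul_mxrow_mxcol.
  rewrite mulmxDl !mulmx_suml; congr (_ + _); apply: eq_bigr => p _;
  by rewrite trmx_mul trmx_exp -!mulmxA.
rewrite {1}zE; apply: le_trans (norm1D _ _) _.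
apply: le_trans (lerD (norm1_sum _) (norm1_sum _)) _.
rewrite -big_split /= mulr_suml; apply: ler_sum => p _.
pose b := norm1 (B^T *m (A^T ^+ p *m z)); pose e := norm1 (D^T *m (A^T ^+ p *m z)).
have be : b + e <= \sum_(p < m) (norm1 (B^T *m (A^T ^+ p *m z)) + norm1 (D^T *m (A^T ^+ p *m z))).
  by rewrite (bigD1 p) //= lerDl sumr_ge0 // => i _; rewrite addr_ge0 ?norm1_ge0.
have b0 : 0 <= b by exact: norm1_ge0.
have e0 : 0 <= e by exact: norm1_ge0.
apply: le_trans (lerD (norm1_mulmx _ _) (norm1_mulmx _ _)) _.
rewrite -/b -/e mulrDl; apply: lerD; rewrite ler_wpM2l ?mnorm_ge0 //;
  by apply: le_trans be; rewrite ?lerDl ?lerDr.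
Qed.

(* Some E^(i * r) z with i < m is observed, and then so are all the steps of a
   block after it, of length proportional to [n] since E^s moves a vector little. *)
Lemma euler_observable m (A : 'M[R]_m) (g : 'cV[R]_m -> R) (G c t : R) :
  (0 < m)%N -> 0 < t -> 0 <= G -> 0 <= c ->
  (forall u v, g (u - v) <= g u + g v) -> (forall e u, g (e *: u) = `|e| * g u) ->
  (forall u, 0 <= g u) -> (forall u, g u <= G * norm1 u) ->
  (forall z, norm1 z <= c * \sum_(p < m) g (A ^+ p *m z)) ->
  exists dl kap : R, [/\ 0 < dl, 0 < kap &
    exists n0 : nat, forall n : nat, (n0 <= n)%N -> forall z : 'cV[R]_m,
    exists e0 L : nat, [/\ (e0 + L <= n.+1)%N, kap * n.+1%:R <= L%:R &
      forall j, (e0 <= j < e0 + L)%N ->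
        dl * norm1 z <= g (euler_step A (t / n.+1%:R) ^+ j *m z)]].
Proof.
move=> m0 t0 G0 c0 gB gZ g0 gG obs.
pose a := mnorm A; have a0 : 0 <= a by exact: mnorm_ge0.
have a10 : 0 < a + 1 by rewrite ltr_wpDl.
pose S := \sum_(p < m) diff_coef A p.
have S0 : 0 <= S by apply: sumr_ge0 => p _; exact: diff_coef_ge0.
(* The macroscopic time step of the differences: the three bounds allow the Taylor estimates, let m
   such steps fit into t/4, and keep the difference error below 1/2. *)
pose ts := Num.min ((a + 1)^-1) (Num.min (t / (4 * m%:R)) ((2 * (c * G * S + 1))^-1)).
have m0R : 0 < m%:R :> R by rewrite ltr0n.
have cGS : 0 <= c * G * S by rewrite !mulr_ge0.
have ts0 : 0 < ts.
  rewrite !lt_min invr_gt0 a10 divr_gt0 ?mulr_gt0 //= invr_gt0 mulr_gt0 //.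
  by rewrite ltr_wpDl.
have ts1 : ts <= (a + 1)^-1 by rewrite ge_min lexx.
have ts2 : ts <= t / (4 * m%:R) by rewrite !ge_min lexx orbT.
have ts3 : ts <= (2 * (c * G * S + 1))^-1 by rewrite !ge_min lexx !orbT.
pose Q := \sum_(p < m) (4 / ts) ^+ p.
have Q0 : 0 <= Q by apply: sumr_ge0 => p _; rewrite exprn_ge0 // divr_ge0 // ltW.
have cQ : 0 <= c * Q by rewrite mulr_ge0.
(* If all m observations were below this threshold, their contribution would be at most 1/4; with
   the error 1/2 this gives |z| <= (3/4)|z|. *)
pose d0 := (4 * (c * Q + 1))^-1.
have d00 : 0 < d0 by rewrite invr_gt0 mulr_gt0 // ltr_wpDl.
(* The duration of the block: short enough to fit into t/4 and to change the observation by at most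
   half of the threshold. *)
pose sg := Num.min ((a + 1)^-1) (Num.min (t / 4) (d0 / (4 * (G * a * 3 ^+ m + 1)))).
have Ga : 0 <= G * a * 3 ^+ m by rewrite !mulr_ge0.
have sg0 : 0 < sg.
  rewrite !lt_min invr_gt0 a10 divr_gt0 //= divr_gt0 // mulr_gt0 // ltr_wpDl //.
have sg1 : sg <= (a + 1)^-1 by rewrite ge_min lexx.
have sg2 : sg <= t / 4 by rewrite !ge_min lexx orbT.
have sg3 : sg <= d0 / (4 * (G * a * 3 ^+ m + 1)) by rewrite !ge_min lexx !orbT.
exists (d0 / 2), (sg / t); split; [by rewrite divr_gt0|by rewrite divr_gt0|].
exists (Num.truncn (t / ts)).+1 => n nn0 z.
pose h := t / n.+1%:R.
have h0 : 0 < h by rewrite divr_gt0.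
have hE : n.+1%:R * h = t by rewrite /h mulrC divfK // pnatr_eq0.
have h_ts : h <= ts.
  rewrite /h ler_pdivrMr // mulrC -ler_pdivrMr //.
  apply/ltW; apply: lt_le_trans (truncnS_gt _) _; rewrite ler_nat.
  by apply: leq_trans nn0 _.
(* The number of scheme steps in a macroscopic step; r h lies between ts/2 and ts, hence the
   quotient 4/ts in [Q]. *)
pose r := Num.truncn (ts / h).
have /andP[r1 r2] : r%:R <= ts / h < r.+1%:R by apply: truncn_itv; rewrite divr_ge0 ?ltW.
have rh : r%:R * h <= ts by rewrite -ler_pdivlMr.
have r_gt0 : (0 < r)%N by rewrite truncn_gt0 ler_pdivlMr // mul1r.
have rh2 : ts / 2 <= r%:R * h.
  rewrite ler_pdivrMr //; move: r2; rewrite ltr_pdivrMr // => r2; apply/ltW.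
  apply: lt_le_trans r2 _; rewrite mulrAC ler_wpM2r ?(ltW h0) //.
  have r1' : 1 <= r%:R :> R by rewrite (ler_nat _ 1 r).
  rewrite -[r.+1%:R]natr1; lra.
have inva1 x : x <= (a + 1)^-1 -> 0 <= x -> x * a <= 1.
  move=> xa x0; apply: le_trans (ler_wpM2r a0 xa) _.
  by rewrite mulrC ler_pdivrMr // mul1r lerDl.
have rha : r%:R * (h * a) <= 1.
  by rewrite mulrA inva1 ?(le_trans rh) // mulr_ge0 // ltW.
pose tau := r%:R * h.
have tau0 : 0 < tau by rewrite mulr_gt0 // ltr0n.
pose T (x : 'cV[R]_m) := euler_step A h ^+ r *m x.
have TE i (x : 'cV[R]_m) : iter i T x = euler_step A h ^+ (i * r) *m x.
  elim: i => [|i IH]; first by rewrite mul0n expr0 mul1mx.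
  by rewrite iterS IH /T mulSn exprD mulmxA.
pose L := (Num.truncn (sg / h)).+1.
have /andP[l1 l2] : (Num.truncn (sg / h))%:R <= sg / h < L%:R.
  by apply: truncn_itv; rewrite divr_ge0 ?ltW.
have LE : sg / t * n.+1%:R <= L%:R.
  apply: le_trans (ltW l2); rewrite /h invfM invrK mulrAC mulrA.
  by rewrite le_eqVlt; apply/orP; left; apply/eqP; ring.
have fits i : (i < m)%N -> (i * r + L <= n.+1)%N.
  move=> im; rewrite /L addnS ltnS -(ler_nat R) natrD natrM.
  have n1 : 1 <= n%:R :> R by rewrite (ler_nat _ 1); apply: leq_trans nn0.
  have e1 : i%:R * r%:R <= m%:R * (ts / h).
    by apply: ler_pM => //; rewrite ler_nat ltnW.
  have e2 : m%:R * (ts / h) + sg / h <= n.+1%:R / 2.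
    have : m%:R * ts + sg <= t / 2.
      have h3 : m%:R * ts <= t / 4.
        apply: le_trans (ler_wpM2l _ ts2) _; first exact: ltW.
        by rewrite le_eqVlt; apply/orP; left; apply/eqP; field; rewrite gt_eqF.
      by have := sg2; lra.
    rewrite mulrA -mulrDl ler_pdivrMr // => h4; apply: le_trans h4 _.
    by rewrite mulrAC hE.
  have n2 : n.+1%:R = n%:R + 1 :> R by rewrite natr1.
  rewrite n2 in e2.
  apply: le_trans (lerD e1 l1) _; apply: le_trans e2 _; lra.
have [z0|zneq] := eqVneq (norm1 z) 0.
  by exists 0%N, L; split => //; [exact: (fits 0%N)|move=> j _; rewrite z0 mulr0].
have zgt : 0 < norm1 z by rewrite lt_neqAle eq_sym zneq norm1_ge0.
(* By contradiction: small observations at the m macroscopic times make all differences small, hence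
   every A^p z nearly unobserved, against the hypothesis [obs]. *)
have [i im Hi] : exists2 i, (i < m)%N & d0 * norm1 z < g (iter i T z).
  apply: contrapT => H.
  have {}H i : (i < m)%N -> g (iter i T z) <= d0 * norm1 z.
    by move=> im; rewrite leNgt; apply/negP => hi; apply: H; exists i.
  have gp (p : 'I_m) : g (A ^+ p *m z) <= (4 / ts) ^+ p * (d0 * norm1 z) +
      G * ts * diff_coef A p * norm1 z.
    have tp : 0 < tau ^+ p by rewrite exprn_gt0.
    have s1 : g (iter p (step_diff A h r) z) <= 2 ^+ p * (d0 * norm1 z).
      apply: iter_step_diff_le => // i ip; apply: H.
      exact: leq_ltn_trans ip (ltn_ord p).
    have s2 := iter_step_diff (ltW h0) rha p z.
    have s3 : tau ^+ p * g (A ^+ p *m z) <= 2 ^+ p * (d0 * norm1 z) +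
        G * (tau ^+ p.+1 * diff_coef A p * norm1 z).
      rewrite -[tau ^+ p]gtr0_norm // -gZ.
      have -> : tau ^+ p *: (A ^+ p *m z) = iter p (step_diff A h r) z -
        (iter p (step_diff A h r) z - tau ^+ p *: (A ^+ p *m z)) by rewrite opprB addrC subrK.
      apply: le_trans (gB _ _) _; apply: lerD => //.
      by apply: le_trans (gG _) _; rewrite ler_wpM2l.
    rewrite -(ler_pM2l tp); apply: le_trans s3 _; rewrite mulrDr; apply: lerD.
      rewrite [leRHS]mulrA ler_wpM2r ?mulr_ge0 ?(ltW d00) ?norm1_ge0 // -exprMn.
      have q1 : 2 <= tau * (4 / ts).
        by rewrite mulrA ler_pdivlMr //; have := rh2; rewrite -/tau; lra.
      by rewrite lerXn2r // ?nnegrE //; apply: le_trans q1.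
    rewrite exprSr.
    have : tau <= ts by [].
    move=> tts.
    have -> : G * (tau ^+ p * tau * diff_coef A p * norm1 z) =
      tau ^+ p * (G * tau * diff_coef A p * norm1 z) by ring.
    rewrite ler_wpM2l ?(ltW tp) // !ler_wpM2r ?norm1_ge0 ?diff_coef_ge0 //.
    by rewrite ler_wpM2l.
  have := obs z.
  have : c * \sum_(p < m) g (A ^+ p *m z) <= c * (Q * (d0 * norm1 z) + G * ts * S * norm1 z).
    rewrite ler_wpM2l //; apply: le_trans (ler_sum _ (fun p _ => gp p)) _.
    by rewrite big_split /= /Q /S mulr_suml -mulrA mulr_suml mulr_sumr lerD2l;
      rewrite le_eqVlt; apply/orP; left; apply/eqP; apply: eq_bigr => p _; rewrite !mulrA.
  move=> h1 h2; have := le_trans h2 h1.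
  have k1 : c * Q * d0 <= 4^-1.
    rewrite /d0 ler_pdivrMr ?mulr_gt0 ?ltr_wpDl // mulrA mulVf // mul1r lerDl //.
  have k2 : c * G * S * ts <= 2^-1.
    apply: le_trans (ler_wpM2l cGS ts3) _.
    rewrite ler_pdivrMr ?mulr_gt0 ?ltr_wpDl // mulrA mulVf // mul1r lerDl //.
  have -> : c * (Q * (d0 * norm1 z) + G * ts * S * norm1 z) =
    (c * Q * d0 + c * G * S * ts) * norm1 z by ring.
  rewrite -{1}[norm1 z]mul1r ler_pM2r // => h3.
  have := le_trans h3 (lerD k1 k2); lra.
exists (i * r)%N, L; split => //; first exact: fits.
move=> j /andP[j1 j2].
pose s := (j - i * r)%N.
have js : j = (s + i * r)%N by rewrite subnK.
have sL : s%:R * h <= sg.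
  rewrite -ler_pdivlMr //; apply: le_trans l1; rewrite ler_nat -ltnS.
  by rewrite ltn_subLR.
have sha : s%:R * (h * a) <= 1.
  by rewrite mulrA inva1 ?(le_trans sL) // mulr_ge0 // ltW.
rewrite js exprD -mulmxA -TE; set y := iter i T z in Hi *.
have yz : norm1 y <= 3 ^+ m * norm1 z.
  apply: (@le_trans _ _ (3 ^+ i * norm1 z)); last first.
    by rewrite ler_wpM2r ?norm1_ge0 // ler_weXn2l ?(ltnW im) // ler1n.
  rewrite /y; elim: (i) => [|i' IH]; first by rewrite mul1r.
  rewrite iterS exprS -mulrA; apply: le_trans (step_growth (ltW h0) _ rha) _.
  by rewrite ler_wpM2l.
have gy : g y <= g (euler_step A h ^+ s *m y) + g (euler_step A h ^+ s *m y - y).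
  have {1}-> : y = euler_step A h ^+ s *m y - (euler_step A h ^+ s *m y - y).
    by rewrite opprB addrC subrK.
  exact: gB.
have gd : g (euler_step A h ^+ s *m y - y) <= d0 / 2 * norm1 z.
  apply: le_trans (gG _) _.
  apply: (@le_trans _ _ (G * (2 * (sg * a) * (3 ^+ m * norm1 z)))).
    rewrite ler_wpM2l //; apply: le_trans (step_lipschitz (ltW h0) _ sha) _.
    have w1 : 0 <= 2 * (s%:R * h * a) by rewrite !mulr_ge0 // ltW.
    have w2 : 2 * (s%:R * h * a) <= 2 * (sg * a) by rewrite ler_wpM2l // ler_wpM2r.
    exact: ler_pM w1 (norm1_ge0 _) w2 yz.
  have -> : G * (2 * (sg * a) * (3 ^+ m * norm1 z)) = (2 * (G * a * 3 ^+ m) * sg) * norm1 z by ring.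
  rewrite ler_wpM2r ?norm1_ge0 //.
  have := ler_wpM2l (ltW (ltr_wpDl Ga (@ltr01 R))) sg3.
  have -> : (G * a * 3 ^+ m + 1) * (d0 / (4 * (G * a * 3 ^+ m + 1))) = d0 / 4.
    by field; rewrite gt_eqF // ltr_wpDl.
  rewrite mulrDl mul1r; have := sg0; lra.
have := le_trans (ltW Hi) gy; rewrite -/h; lra.
Qed.

End kalman.

(** * Fourier inversion *)

Section lebesgue_cV_integral.
Context (R : realType).
Local Notation leb := (@lebesgue_measure R).

Lemma cV_cons_ord0 n (p : R * 'cV[R]_n) : cV_cons p ord0 ord0 = p.1.
Proof. by have := congr1 fst (cV_consK p). Qed.

Lemma cV_cons_lift n (p : R * 'cV[R]_n) i : cV_cons p (lift ord0 i) ord0 = p.2 i ord0.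
Proof.
have := congr1 (fun q : R * 'cV[R]_n => q.2 i ord0) (cV_consK p).
by rewrite /= mxE => <-; congr (cV_cons p _ _); exact/val_inj.
Qed.

Local Open Scope ereal_scope.

Let ge0_pushforward n (f : 'cV[R]_n.+1 -> \bar R) :
  measurable_fun setT f -> (forall x, 0 <= f x) ->
  \int[lebesgue_cV R n.+1]_x f x =
  \int[leb \x lebesgue_cV R n]_p (f \o @cV_cons R n) p.
Proof.
move=> mf f0; have mc := @measurable_cV_cons R n.
have <- : \int[pushforward (leb \x lebesgue_cV R n) (@cV_cons R n)]_x f x =
    \int[leb \x lebesgue_cV R n]_p (f \o @cV_cons R n) p.
  by rewrite ge0_integral_pushforward.
reflexivity.
Qed.

Lemma ge0_integral_cV_cons n (f : 'cV[R]_n.+1 -> \bar R) :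
  measurable_fun setT f -> (forall x, 0 <= f x) ->
  \int[lebesgue_cV R n.+1]_x f x =
  \int[leb]_x \int[lebesgue_cV R n]_v f (cV_cons (x, v)).
Proof.
move=> mf f0; rewrite ge0_pushforward //.
have mfc := measurableT_comp mf (@measurable_cV_cons R n).
rewrite fubini_tonelli1; first by [].
- exact: mfc.
- by move=> x; exact: f0.
Qed.

Lemma integral_cV_cons n (f : 'cV[R]_n.+1 -> R) :
  (lebesgue_cV R n.+1).-integrable setT (EFin \o f) ->
  (forall x, (lebesgue_cV R n).-integrable setT (fun v => (f (cV_cons (x, v)))%:E)) ->
  (\int[lebesgue_cV R n.+1]_x f x =
  \int[leb]_x \int[lebesgue_cV R n]_v f (cV_cons (x, v)))%R.
Proof.
move=> If Ifx.
have mc := @measurable_cV_cons R n.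
have mf := measurable_int _ If.
have If' : (leb \x lebesgue_cV R n).-integrable setT ((EFin \o f) \o @cV_cons R n).
  apply/integrableP; split; first exact: measurableT_comp.
  have /integrableP[_] := If.
  rewrite (ge0_pushforward (f := fun x => `|(EFin \o f) x|)) //.
  exact: measurableT_comp.
rewrite /Rintegral; congr fine.
have e : \int[pushforward (leb \x lebesgue_cV R n) (@cV_cons R n)]_x (f x)%:E =
    \int[leb \x lebesgue_cV R n]_p ((EFin \o f) \o @cV_cons R n) p.
  have mc' : measurable_fun [set: measurableTypeR R * 'cV[R]_n] (@cV_cons R n) := mc.
  by rewrite (integral_pushforward mc' mf If').
transitivity (\int[leb \x lebesgue_cV R n]_p ((EFin \o f) \o @cV_cons R n) p).
  by rewrite -e.
rewrite -integral12_prod_meas1; last exact: If'.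
apply: eq_integral => x _; rewrite fineK //; apply: integrable_fin_num => //; exact: Ifx.
Qed.

(** Tonelli, one coordinate at a time; it computes the mass of the Gaussian densities and of the
    integrable majorant of rapidly decreasing functions. *)
Lemma ge0_integral_lebesgue_cV_prod n (g : 'I_n -> R -> R) (a : 'I_n -> R) :
  (forall i, measurable_fun setT (g i)) -> (forall i x, (0 <= g i x)%R) ->
  (forall i, \int[leb]_x (g i x)%:E = (a i)%:E) ->
  \int[lebesgue_cV R n]_v (\prod_(i < n) g i (v i ord0))%:E = (\prod_(i < n) a i)%:E.
Proof.
elim: n g a => [|n IH] g a mg g0 ga.
  under eq_integral do rewrite big_ord0.
  by rewrite big_ord0 integral_cst //= diracT mul1e.
have mp k (h : 'I_k -> R -> R) : (forall i, measurable_fun setT (h i)) ->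
    measurable_fun setT (fun v : 'cV[R]_k => (\prod_(i < k) h i (v i ord0))%:E).
  move=> mh; apply/measurable_EFinP; apply: measurable_prod => i _.
  by apply: measurableT_comp (mh i) _; exact: measurable_coord.
rewrite ge0_integral_cV_cons; last 2 first.
- exact: mp.
- by move=> x; rewrite lee_fin prodr_ge0.
rewrite big_ord_recl mulrC EFinM -ga -ge0_integralZl //; last 3 first.
- by apply/measurable_EFinP; exact: (mg ord0).
- by move=> x _; rewrite lee_fin.
- by rewrite lee_fin prodr_ge0 // => i _; rewrite -lee_fin -ga integral_ge0 // => x _; rewrite lee_fin.
apply: eq_integral => x _.
under eq_integral => v _.
  rewrite big_ord_recl cV_cons_ord0 /= EFinM.
  under eq_bigr do rewrite cV_cons_lift.
  over.
rewrite ge0_integralZl //; last 3 first.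
- exact: (mp _ (fun i => g (lift ord0 i))).
- by move=> v _; rewrite lee_fin prodr_ge0.
- by rewrite lee_fin.
by rewrite (IH (fun i => g (lift ord0 i)) (fun i => a (lift ord0 i))) // muleC.
Qed.

End lebesgue_cV_integral.

Section gauss_cV.
Context (R : realType).
Local Notation leb := (@lebesgue_measure R).

Definition gauss_cV n (s : R) (z : 'cV[R]_n) : R := \prod_i normal_pdf 0 s (z i ord0).

Lemma measurable_prod_coord n (h : R -> R) : measurable_fun setT h ->
  measurable_fun setT (fun v : 'cV[R]_n => \prod_(i < n) h (v i ord0)).
Proof.
move=> mh; apply: measurable_prod => i _.
by apply: measurableT_comp mh _; exact: measurable_coord.
Qed.

Lemma gauss_cV_ge0 n s (z : 'cV[R]_n) : 0 <= gauss_cV s z.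
Proof. by apply: prodr_ge0 => i _; exact: normal_pdf_ge0. Qed.

Lemma integral_gauss_cV n s :
  (\int[lebesgue_cV R n]_z (gauss_cV s z)%:E = 1)%E.
Proof.
rewrite (ge0_integral_lebesgue_cV_prod (g := fun=> normal_pdf 0 s) (a := fun=> 1)).
- by rewrite big1.
- by move=> i; exact: measurable_normal_pdf.
- by move=> i x; exact: normal_pdf_ge0.
- by move=> i; exact: integral_normal_pdf.
Qed.

Lemma measurable_gauss_cV n s : measurable_fun setT (@gauss_cV n s).
Proof. by apply: measurable_prod_coord; exact: measurable_normal_pdf. Qed.

Lemma ge0_integrable d (T : measurableType d) (mu : {measure set T -> \bar R}) (f : T -> R) a :
  measurable_fun setT f -> (forall x, 0 <= f x) -> (\int[mu]_x (f x)%:E = a%:E)%E ->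
  mu.-integrable setT (EFin \o f).
Proof.
move=> mf f0 fa; apply/integrableP; split; first exact/measurable_EFinP.
under eq_integral do rewrite /= ger0_norm //.
by rewrite fa ltry.
Qed.

Lemma integrable_gauss_cV n s : (lebesgue_cV R n).-integrable setT (EFin \o @gauss_cV n s).
Proof.
apply: ge0_integrable (integral_gauss_cV n s).
- exact: measurable_gauss_cV.
- exact: gauss_cV_ge0.
Qed.

Lemma bounded_integrableM d (T : measurableType d) (mu : {measure set T -> \bar R})
    (f g : T -> R) C :
  measurable_fun setT f -> (forall x, `|f x| <= C) -> mu.-integrable setT (EFin \o g) ->
  mu.-integrable setT (EFin \o (fun x => f x * g x)).
Proof.
move=> mf fC Ig; apply: (@le_integrable _ _ _ _ _ measurableT _ (fun x => C%:E * (g x)%:E)%E).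
- apply/measurable_EFinP; apply: measurable_funM => //; apply/measurable_EFinP.
  exact: measurable_int Ig.
- move=> x _; change (`|f x * g x|%:E <= `|C * g x|%:E)%E.
  rewrite lee_fin !normrM ler_wpM2r //.
  exact: le_trans (fC x) (ler_norm _).
- exact: integrableZl.
Qed.

Lemma measurable_dotpl n (y : 'cV[R]_n) : measurable_fun setT (fun z => dotp z y).
Proof.
by apply: measurable_sum => i; apply: measurable_funM => //; exact: measurable_coord.
Qed.

Lemma Rintegral_cos_gauss_cV n s (y : 'cV[R]_n) th : 0 < s ->
  \int[lebesgue_cV R n]_z (cos (dotp z y + th) * gauss_cV s z) =
  cos th * expR (- (s ^+ 2 * dotp y y / 2)).
Proof.
move=> s0.
have I k (u : 'cV[R]_k) t : (lebesgue_cV R k).-integrable setT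
    (EFin \o (fun z => cos (dotp z u + t) * gauss_cV s z)).
  apply: (bounded_integrableM _ (C := 1)) => //.
  - apply: measurable_cos_comp; apply: measurable_funD => //; exact: measurable_dotpl.
  - by move=> x; exact: normr_cos_le1.
  - exact: integrable_gauss_cV.
elim: n y th => [|n IH] y th.
  under eq_Rintegral do rewrite /gauss_cV /dotp !big_ord0 mulr1 add0r.
  rewrite /dotp big_ord0 mulr0 mul0r oppr0 expR0 mulr1.
  by rewrite /Rintegral integral_cst //= indicT mulr1.
(* The contribution of the first coordinate is moved into the phase of the remaining ones; after the
   induction hypothesis a one-dimensional integral with a phase is left. *)
have E (x : R) (v : 'cV[R]_n) :
    cos (dotp (cV_cons (x, v)) y + th) * gauss_cV s (cV_cons (x, v)) =
    normal_pdf 0 s x * (cos (dotp v (\col_i y (lift ord0 i) ord0) + (x * y ord0 ord0 + th)) * gauss_cV s v).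
  rewrite /gauss_cV big_ord_recl cV_cons_ord0 /= mulrCA; congr (_ * (_ * _)).
    rewrite /dotp big_ord_recl cV_cons_ord0 /= addrCA addrA; congr (cos (_ + _ + _)).
    by apply: eq_bigr => i _; rewrite cV_cons_lift mxE.
  by apply: eq_bigr => i _; rewrite cV_cons_lift.
rewrite integral_cV_cons; last 2 first.
- exact: I.
- move=> x; under eq_fun do rewrite E EFinM.
  by apply: integrableZl => //; exact: I.
under eq_Rintegral => x _.
  under eq_Rintegral do rewrite E.
  rewrite RintegralZl //.
  rewrite IH mulrA (mulrC (normal_pdf _ _ _)).
  over.
rewrite RintegralZr //; last first.
  apply: (bounded_integrableM _ (C := 1)) => //.
  - by apply: measurable_cos_comp; apply: measurable_funD => //; apply: measurable_funM.
  - by move=> x; exact: normr_cos_le1.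
  - exact: integrable_normal_pdf.
rewrite Rintegral_cos_normal_pdf // -[LHS]mulrA -expRD; congr (_ * expR _).
rewrite [dotp y y]/dotp big_ord_recl /dotp; under eq_bigr do rewrite !mxE.
by ring.
Qed.

End gauss_cV.

Lemma norm1_le_norm (R : realType) m (h : 'cV[R]_m) : norm1 h <= m%:R * `|h|.
Proof.
rewrite /norm1 mulr_natl -[X in _ *+ X]card_ord -sumr_const; apply: ler_sum => i _.
rewrite [leRHS]mx_normrE; exact: (le_bigmax _ (fun ij => `|h ij.1 ij.2|) (i, ord0)).
Qed.

(** * Smoothness of Fourier integrals with rapidly decreasing coefficients *)

Lemma differentiable_quadratic (R : realType) (V W : normedModType R) (f : V -> W)
    (df : {linear V -> W}) (x : V) (K : R) :
  0 <= K -> continuous df -> (forall h, `|f (x + h) - f x - df h| <= K * `|h| ^+ 2) ->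
  differentiable f x /\ 'd f x = df :> (V -> W).
Proof.
move=> K0 cdf H.
have Ho : f \o shift x = cst (f x) + df +o_ 0 id.
  apply/eqaddoP => e e0; near=> h.
  rewrite !fctE /= opprD addrA (addrC h x); apply: le_trans (H h) _.
  have : `|h| <= e / (K + 1).
    by near: h; apply: nbhs0_le; rewrite divr_gt0 // ltr_wpDl.
  rewrite ler_pdivlMr; last by rewrite ltr_wpDl.
  rewrite mulrDr mulr1 expr2 mulrA => he; rewrite ler_wpM2r //.
  by apply: le_trans he; rewrite mulrC lerDl.
split; last exact: diff_unique.
by apply/diff_locallyP; rewrite (diff_unique cdf Ho).
Unshelve. all: end_near. Qed.

Lemma differentiable_quadratic_cV (R : realType) m (f : 'cV[R]_m -> R) (g x : 'cV[R]_m) K :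
  0 <= K -> (forall h, `|f (x + h) - f x - dotp g h| <= K * norm1 h ^+ 2) ->
  differentiable f x /\ forall i, 'D_(delta_mx i ord0) f x = g i ord0.
Proof.
move=> K0 H.
have lin : linear (dotp g : 'cV[R]_m -> R).
  by move=> a u v; rewrite dotpDr dotpZr.
pose glM := GRing.isLinear.Build _ _ _ _ _ lin.
pose df : {linear 'cV[R]_m -> R} := HB.pack (dotp g : 'cV[R]_m -> R) glM.
have cdf : continuous df.
  move=> u; apply: (@cvgr_sum R 'cV[R]_m (nbhs u) (nbhs_filter u) m
    (fun i (v : 'cV[R]_m) => g i ord0 * v i ord0) (fun i => g i ord0 * u i ord0)) => i.
  by apply: cvgMr; exact: coord_continuous.
have H2 h : `|f (x + h) - f x - df h| <= K * m%:R ^+ 2 * `|h| ^+ 2.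
  apply: le_trans (H h) _; rewrite -mulrA -exprMn ler_wpM2l // lerXn2r //.
  - by rewrite nnegrE norm1_ge0.
  - by rewrite nnegrE mulr_ge0.
  - exact: norm1_le_norm.
have [|D De] := differentiable_quadratic _ cdf H2; first by rewrite mulr_ge0 // exprn_ge0.
split=> // i; rewrite deriveE // De /= /dotp (bigD1 i) //= big1 ?addr0.
  by rewrite mxE !eqxx mulr1.
by move=> j /negPf ji; rewrite mxE ji mulr0.
Qed.

Section taylor.
Context (R : realType).

(** Mean value theorem for the cosine, then the Lipschitz bound for the sine. An explicit remainder
    valid for all [e] integrates directly, giving differentiability of the Fourier integral in all
    directions at once. *)
Lemma cos_taylor1 (x e : R) : `|cos (x + e) - cos x + e * sin x| <= e ^+ 2.
Proof.
have [c cx ->] : exists2 c, `|c - x| <= `|e| & cos (x + e) - cos x = - sin c * e.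
  have [e0|e0|->] := ltgtP e 0; last by exists x; rewrite ?subrr ?addr0 ?mulr0 ?normr0 // subrr.
  - have xe : x + e < x by rewrite gtrDl.
    have [c] := @MVT R cos (fun x => - sin x) _ _ xe (fun z _ => is_derive_cos z)
      (continuous_subspaceT (@continuous_cos R)).
    rewrite in_itv /= => /andP[c1 c2] ce; exists c.
      by rewrite !ler0_norm ?(ltW e0) ?subr_le0 ?(ltW c2) //; lra.
    by rewrite -opprB ce; ring.
  - have xe : x < x + e by rewrite ltrDl.
    have [c] := @MVT R cos (fun x => - sin x) _ _ xe (fun z _ => is_derive_cos z)
      (continuous_subspaceT (@continuous_cos R)).
    rewrite in_itv /= => /andP[c1 c2] ce; exists c.
      by rewrite !ger0_norm ?(ltW e0) ?subr_ge0 ?(ltW c1) //; lra.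
    by rewrite ce; ring.
rewrite -[e ^+ 2]real_normK ?num_real // expr2.
have -> : - sin c * e + e * sin x = e * (sin x - sin c) by ring.
rewrite normrM ler_wpM2l //; apply: le_trans (lipschitz_sin _ _) _.
by rewrite distrC.
Qed.

Lemma sin_taylor1 (x e : R) : `|sin (x + e) - sin x - e * cos x| <= e ^+ 2.
Proof.
have := cos_taylor1 (x - pi / 2) e.
have -> : x - pi / 2 + e = (x + e) - pi / 2 by ring.
have cE (z : R) : cos (z - pi / 2) = sin z by rewrite cosB cos_pihalf sin_pihalf; ring.
have sE (z : R) : sin (z - pi / 2) = - cos z by rewrite sinB cos_pihalf sin_pihalf; ring.
by rewrite !cE sE mulrN.
Qed.
End taylor.

Section rapid.
Context (R : realType) (m : nat).
Local Notation leb := (@lebesgue_measure R).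
Local Notation mu := (lebesgue_cV R m).
Implicit Types (a b : 'cV[R]_m -> R).

Definition rapidly_decreasing a : Prop :=
  measurable_fun setT a /\ forall N, exists C, forall z, `|a z| * (1 + norm1 z) ^+ N <= C.

Lemma oneDnorm1_ge1 (z : 'cV[R]_m) : 1 <= 1 + norm1 z.
Proof. by rewrite lerDl norm1_ge0. Qed.

Lemma rapidly_decreasingN a : rapidly_decreasing a -> rapidly_decreasing (fun z => - a z).
Proof.
move=> [ma da]; split; first exact: measurable_funN.
by move=> N; have [C h] := da N; exists C => z; rewrite normrN.
Qed.

Lemma rapidly_decreasingZ k a : rapidly_decreasing a -> rapidly_decreasing (fun z => k * a z).
Proof.
move=> [ma da]; split; first exact: measurable_funM.
move=> N; have [C h] := da N; exists (`|k| * C) => z.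
by rewrite normrM -mulrA ler_wpM2l.
Qed.

Lemma rapidly_decreasing_coord a i : rapidly_decreasing a ->
  rapidly_decreasing (fun z => z i ord0 * a z).
Proof.
move=> [ma da]; split.
  by apply: measurable_funM => //; exact: measurable_coord.
move=> N; have [C h] := da N.+1; exists C => z; apply: le_trans (h z).
rewrite exprS mulrA ler_wpM2r ?exprn_ge0 ?(le_trans ler01) ?oneDnorm1_ge1 //.
rewrite normrM mulrC ler_wpM2l //; apply: le_trans (coord_le_norm1 z i) _.
by rewrite lerDr.
Qed.

Lemma integral_oneDsqrV : (\int[leb]_x ((oneDsqr x)^-1)%:E = pi%:E)%E.
Proof.
rewrite ge0_symfun_integralT.
- rewrite -set_itvcy integral0y_oneDsqr -EFinM; congr (_%:E); by field.
- by move=> x; rewrite invr_ge0 (le_trans ler01) // oneDsqr_ge1.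
- exact: continuous_oneDsqrV.
- by move=> x; rewrite /oneDsqr /= sqrrN.
Qed.

Lemma integrable_dominator :
  mu.-integrable setT (EFin \o (fun z => \prod_(i < m) (oneDsqr (z i ord0))^-1)).
Proof.
have mV : measurable_fun setT (fun x : R => (oneDsqr x)^-1).
  by apply: continuous_measurable_fun; exact: continuous_oneDsqrV.
have V0 (x : R) : 0 <= (oneDsqr x)^-1 by rewrite invr_ge0 (le_trans ler01) // oneDsqr_ge1.
apply: (@ge0_integrable _ _ _ _ _ (\prod_(i < m) pi)).
- exact: (measurable_prod_coord mV).
- by move=> x; apply: prodr_ge0.
- apply: (ge0_integral_lebesgue_cV_prod (g := fun=> fun x => (oneDsqr x)^-1)) => // i.
  exact: integral_oneDsqrV.
Qed.

(** Each factor 1 + z_i^2 is at most (1 + |z|)^2, so 2m powers of decay are enough for integrability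
    over R^m. *)
Lemma dominator_ge (z : 'cV[R]_m) :
  1 <= (\prod_(i < m) (oneDsqr (z i ord0))^-1) * (1 + norm1 z) ^+ (2 * m).
Proof.
have V0 (x : R) : 0 < oneDsqr x by rewrite (lt_le_trans ltr01) // oneDsqr_ge1.
rewrite prodfV ler_pdivlMl ?prodr_gt0 // mulr1 exprM -[X in _ ^+ X]card_ord -prodr_const.
apply: ler_prod => i _; rewrite (ltW (V0 _)) /= /oneDsqr.
have zi := coord_le_norm1 z i; have := normr_ge0 (z i ord0).
rewrite -[z i ord0 ^+ 2]real_normK ?num_real //.
move: zi; set u := `|_|; set v := norm1 z => zi u0.
have : u ^+ 2 <= v ^+ 2 by rewrite lerXn2r // nnegrE (le_trans u0).
by lra.
Qed.

Lemma rapidly_decreasing_integrable a : rapidly_decreasing a ->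
  mu.-integrable setT (EFin \o a).
Proof.
move=> [ma /(_ (2 * m)%N) [C h]].
apply: (@le_integrable _ _ _ _ _ measurableT _
  (EFin \o (fun z : 'cV[R]_m => C * \prod_(i < m) (oneDsqr (z i ord0))^-1))).
- exact/measurable_EFinP.
- move=> z _; rewrite lee_fin; apply: le_trans (ler_norm _).
  have V0 : 0 <= \prod_(i < m) (oneDsqr (z i ord0))^-1.
    by apply: prodr_ge0 => i _; rewrite invr_ge0 (le_trans ler01) // oneDsqr_ge1.
  rewrite -[leLHS]mulr1; apply: le_trans (ler_wpM2l (normr_ge0 _) (dominator_ge z)) _.
  by rewrite mulrCA mulrC ler_wpM2r.
- exact: (integrableZl measurableT C integrable_dominator).
Qed.

End rapid.

Section trig_integral.
Context (R : realType) (m : nat).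
Local Notation mu := (lebesgue_cV R m).
Implicit Types (a b : 'cV[R]_m -> R).

(** The real part of the integral of exp(-i(z,x)) (a + ib)(z). The family is stable under partial
    derivatives, which send (a, b) to (z_i b, - z_i a); boundedness and differentiability of one
    member therefore give all orders. *)
Definition trig_integral a b (x : 'cV[R]_m) : R :=
  \int[mu]_z (cos (dotp z x) * a z + sin (dotp z x) * b z).

Lemma integrable_cosM a x : mu.-integrable setT (EFin \o a) ->
  mu.-integrable setT (EFin \o (fun z => cos (dotp z x) * a z)).
Proof.
move=> Ia; apply: (bounded_integrableM _ (C := 1)) => //.
- by apply: measurable_cos_comp; exact: measurable_dotpl.
- by move=> z; exact: normr_cos_le1.
Qed.

Lemma integrable_sinM a x : mu.-integrable setT (EFin \o a) ->
  mu.-integrable setT (EFin \o (fun z => sin (dotp z x) * a z)).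
Proof.
move=> Ia; apply: (bounded_integrableM _ (C := 1)) => //.
- by apply: measurable_sin_comp; exact: measurable_dotpl.
- by move=> z; exact: normr_sin_le1.
Qed.

Lemma integrable_trig a b x : mu.-integrable setT (EFin \o a) ->
  mu.-integrable setT (EFin \o b) ->
  mu.-integrable setT (EFin \o (fun z => cos (dotp z x) * a z + sin (dotp z x) * b z)).
Proof.
move=> Ia Ib.
exact: (integrableD measurableT (integrable_cosM x Ia) (integrable_sinM x Ib)).
Qed.

Lemma bounded_trig_integral a b : mu.-integrable setT (EFin \o a) ->
  mu.-integrable setT (EFin \o b) -> bounded_fun (trig_integral a b).
Proof.
move=> Ia Ib; exists (\int[mu]_z (`|a z| + `|b z|)); split; first exact: num_real.
move=> M hM x _; apply: le_trans (ltW hM); apply: le_trans (le_normr_Rintegral _ _) _ => //.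
  exact: integrable_trig.
apply: le_Rintegral => //.
- by apply: integrable_norm; exact: integrable_trig.
- exact: (integrableD measurableT (integrable_norm Ia) (integrable_norm Ib)).
- move=> z _; apply: le_trans (ler_normD _ _) _.
  by apply: lerD; rewrite normrM ler_piMl // ?normr_cos_le1 ?normr_sin_le1.
Qed.

Lemma integrable_norm1sqr a : rapidly_decreasing a ->
  mu.-integrable setT (EFin \o (fun z => norm1 z ^+ 2 * `|a z|)).
Proof.
move=> [ma da]; apply: rapidly_decreasing_integrable; split.
  apply: measurable_funM; last exact: measurableT_comp.
  by apply: measurable_funX; apply: measurable_norm1 => i; exact: measurable_coord.
move=> N; have [C h] := da (N.+2); exists C => z; apply: le_trans (h z).
rewrite normrM normr_id (ger0_norm (sqr_ge0 _)) -(addn2 N) exprD.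
have -> : norm1 z ^+ 2 * `|a z| * (1 + norm1 z) ^+ N = `|a z| * ((1 + norm1 z) ^+ N * norm1 z ^+ 2).
  by ring.
rewrite ler_wpM2l // ler_wpM2l ?exprn_ge0 ?(le_trans ler01) ?oneDnorm1_ge1 //.
by rewrite lerXn2r ?nnegrE ?norm1_ge0 ?(le_trans ler01 (oneDnorm1_ge1 _)) // lerDr.
Qed.

Lemma trig_integral_taylor a b x h : rapidly_decreasing a -> rapidly_decreasing b ->
  `|trig_integral a b (x + h) - trig_integral a b x -
    dotp (\col_i trig_integral (fun z => z i ord0 * b z) (fun z => - (z i ord0 * a z)) x) h|
  <= (\int[mu]_z (norm1 z ^+ 2 * `|a z| + norm1 z ^+ 2 * `|b z|)) * norm1 h ^+ 2.
Proof.
move=> ra rb.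
have Ia := rapidly_decreasing_integrable ra; have Ib := rapidly_decreasing_integrable rb.
have Ii i := rapidly_decreasing_integrable (rapidly_decreasing_coord i rb).
have Ji i := rapidly_decreasing_integrable (rapidly_decreasingN (rapidly_decreasing_coord i ra)).
have Kab : mu.-integrable setT (EFin \o (fun z => norm1 z ^+ 2 * `|a z| + norm1 z ^+ 2 * `|b z|)).
  exact: (integrableD measurableT (integrable_norm1sqr ra) (integrable_norm1sqr rb)).
pose F i z := (cos (dotp z x) * (z i ord0 * b z) + sin (dotp z x) * (- (z i ord0 * a z))) * h i ord0.
have IF i : mu.-integrable setT (EFin \o F i).
  exact: (integrableZr measurableT (h i ord0) (integrable_trig x (Ii i) (Ji i))).
have IS : mu.-integrable setT (EFin \o (fun z => \sum_i F i z)).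
  have -> : EFin \o (fun z => \sum_i F i z) = (fun z => \sum_i (F i z)%:E)%E.
    by apply/funext => z; rewrite /= sumEFin.
  by apply: (integrable_sum measurableT) => i _; exact: IF.
have -> : dotp (\col_i trig_integral (fun z => z i ord0 * b z) (fun z => - (z i ord0 * a z)) x) h =
   \int[mu]_z \sum_i F i z.
  rewrite Rintegral_sum //; apply: eq_bigr => i _; rewrite mxE RintegralZr //.
  exact: integrable_trig.
have IT y := integrable_trig y Ia Ib.
rewrite -RintegralB // -RintegralB //; last exact: (integrableB measurableT (IT (x + h)) (IT x)).
apply: le_trans (le_normr_Rintegral _ _) _ => //.
  exact: (integrableB measurableT (integrableB measurableT (IT (x + h)) (IT x)) IS).
rewrite -RintegralZr //; apply: le_Rintegral => //.
- apply: integrable_norm; exact: (integrableB measurableT (integrableB measurableT (IT (x + h)) (IT x)) IS).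
- exact: (integrableZr measurableT (norm1 h ^+ 2) Kab).
move=> z _; rewrite dotpDr.
have -> : \sum_i F i z = dotp z h * (cos (dotp z x) * b z - sin (dotp z x) * a z).
  by rewrite /dotp [RHS]mulr_suml; apply: eq_bigr => i _; rewrite /F; ring.
set u := dotp z x; set e := dotp z h.
have -> : cos (u + e) * a z + sin (u + e) * b z - (cos u * a z + sin u * b z) -
    e * (cos u * b z - sin u * a z) =
   (cos (u + e) - cos u + e * sin u) * a z + (sin (u + e) - sin u - e * cos u) * b z by ring.
have e2 : e ^+ 2 <= norm1 z ^+ 2 * norm1 h ^+ 2.
  rewrite -exprMn -[e ^+ 2]real_normK ?num_real // lerXn2r ?nnegrE ?mulr_ge0 ?norm1_ge0 //.
  exact: dotp_le_norm1.
apply: le_trans (ler_normD _ _) _; rewrite [leRHS]mulrDl !normrM; apply: lerD.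
- rewrite mulrAC ler_wpM2r //; exact: le_trans (cos_taylor1 _ _) e2.
- rewrite mulrAC ler_wpM2r //; exact: le_trans (sin_taylor1 _ _) e2.
Qed.

Lemma trig_integral_diff a b x : rapidly_decreasing a -> rapidly_decreasing b ->
  differentiable (trig_integral a b) x /\
  forall i, 'D_(delta_mx i ord0) (trig_integral a b) x =
    trig_integral (fun z => z i ord0 * b z) (fun z => - (z i ord0 * a z)) x.
Proof.
move=> ra rb; have [|D E] := differentiable_quadratic_cV
  _ (fun h => trig_integral_taylor x h ra rb).
  by apply: Rintegral_ge0 => z _; rewrite addr_ge0 // mulr_ge0 // sqr_ge0.
by split=> // i; rewrite E mxE.
Qed.

Lemma Cb_infty_trig_integral a b : rapidly_decreasing a -> rapidly_decreasing b ->
  Cb_infty (trig_integral a b).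
Proof.
move=> ra rb s.
have [a' [b' [ra' rb' ->]]] : exists a' b', [/\ rapidly_decreasing a', rapidly_decreasing b'
    & iter_partial s (trig_integral a b) = trig_integral a' b'].
  elim: s => [|i s [a' [b' [ra' rb' /= ->]]]]; first by exists a, b.
  exists (fun z : 'cV[R]_m => z i ord0 * b' z), (fun z : 'cV[R]_m => - (z i ord0 * a' z)); split.
  - exact: rapidly_decreasing_coord.
  - by apply: rapidly_decreasingN; exact: rapidly_decreasing_coord.
  - by apply/funext => x; have [_ ->] := trig_integral_diff x ra' rb'.
split=> [x|]; first by have [] := trig_integral_diff x ra' rb'.
by apply: bounded_trig_integral; exact: rapidly_decreasing_integrable.
Qed.

End trig_integral.

Section fubini_prob.
Context (R : realType) d1 d2 (T1 : measurableType d1) (T2 : measurableType d2).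
Context (P : probability T1 R) (mu : {sigma_finite_measure set T2 -> \bar R}).
Context (f : T1 * T2 -> R) (g : T2 -> R).
Hypothesis mf : measurable_fun setT f.
Hypothesis fg : forall p, `|f p| <= g p.2.
Hypothesis Ig : mu.-integrable setT (EFin \o g).

Let If : (P \x mu)%E.-integrable setT (EFin \o f).
Proof.
have mef : measurable_fun setT (EFin \o f) by exact/measurable_EFinP.
apply/(integrable12ltyP P mu mef).
apply: (@le_lt_trans _ _ (\int[P]_x \int[mu]_y (g y)%:E)%E).
  apply: ge0_le_integral => //.
  - by move=> x _; apply: integral_ge0.
  - have maf : measurable_fun setT (fun p => `|(EFin \o f) p|%E) by exact: measurableT_comp.
    exact: (@measurable_fun_fubini_tonelli_F _ _ _ _ _ mu _ maf).
  - move=> x _; apply: ge0_le_integral => //.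
    + apply: measurableT_comp => //; exact/measurable_EFinP/(measurableT_comp mf (pair1_measurable x)).
    + exact: measurable_int Ig.
    + by move=> y _; rewrite lee_fin; exact: fg (x, y).
rewrite integral_cst //= probability_setT mule1.
by have /fin_numPlt/andP[] := integrable_fin_num measurableT Ig.
Qed.

Lemma Rintegral_exchange_prob :
  \int[P]_x \int[mu]_y f (x, y) = \int[mu]_y \int[P]_x f (x, y).
Proof.
rewrite /Rintegral.
transitivity (fine (\int[P]_x \int[mu]_y (f (x, y))%:E)%E).
  congr fine; apply: eq_integral => x _; rewrite fineK //.
  apply: integrable_fin_num => //.
  apply: (@le_integrable _ _ _ _ _ measurableT _ (EFin \o g)) => //.
    exact/measurable_EFinP/(measurableT_comp mf (pair1_measurable x)).
  move=> y _; rewrite lee_fin; apply: le_trans (fg (x, y)) _; exact: ler_norm.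
rewrite (Fubini If); congr fine; apply: eq_integral => y _; rewrite fineK //.
apply: integrable_fin_num => //.
apply: (bounded_integrable P (C := g y)) => [|x]; last exact: fg (x, y).
exact: (measurableT_comp mf (pair2_measurable y)).
Qed.

End fubini_prob.

Lemma measurable_Rintegral_prob (R : realType) d1 d2 (T1 : measurableType d1)
    (T2 : measurableType d2) (P : probability T1 R) (f : T1 * T2 -> R) (C : R) :
  measurable_fun setT f -> (forall p, `|f p| <= C) ->
  measurable_fun setT (fun y => \int[P]_x f (x, y)).
Proof.
move=> mf fC.
have I y : P.-integrable setT (EFin \o (fun x => f (x, y))).
  apply: (bounded_integrable P (C := C)) => //.
  exact: (measurableT_comp mf (pair2_measurable y)).
(* Adding [C] makes the integrand nonnegative, so that Tonelli provides measurability in the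
   parameter. *)
have -> : (fun y => \int[P]_x f (x, y)) = (fun y => fine (\int[P]_x (f (x, y) + C)%:E)%E - C).
  apply/funext => y.
  have -> : fine (\int[P]_x (f (x, y) + C)%:E)%E = \int[P]_x f (x, y) + \int[P]_(x in setT) C.
    rewrite -RintegralD //.
    by apply: (bounded_integrable P (C := `|C|)).
  by rewrite Rint_cst addrK.
apply: measurable_funB => //; apply: measurableT_comp => //.
apply: (@measurable_fun_fubini_tonelli_G _ _ _ _ _ P (fun p => (f p + C)%:E)).
  by apply/measurable_EFinP; apply: measurable_funD.
move=> p; rewrite lee_fin -lerBlDr sub0r; apply: le_trans (lerNnormlW (fC p)) _ => //.
Qed.

(** * Gaussian mollification *)

Section heat_kernel.
Context (R : realType) (m : nat).
Local Notation mu := (lebesgue_cV R m).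

Lemma normal_peakE (s : R) : 0 < s -> normal_peak s = (s * Num.sqrt (2 * pi))^-1.
Proof.
move=> s0; rewrite /normal_peak -mulr_natr -mulrA (mulrC pi) sqrtrM ?sqr_ge0 //.
by rewrite sqrtr_sqr gtr0_norm.
Qed.

(** The centred Gaussian density of standard deviation 1/s: it concentrates as s grows, and its
    Fourier transform is exp(-|z|^2/(2 s^2)). *)
Definition heat_kernel (s : R) (u : 'cV[R]_m) : R :=
  normal_peak s^-1 ^+ m * expR (- (s ^+ 2 * dotp u u / 2)).

Lemma prod_normal_pdf (s : R) (y x : 'cV[R]_m) : 0 < s ->
  \prod_i normal_pdf (y i ord0) s (x i ord0) =
  normal_peak s ^+ m * expR (- (dotp (x - y) (x - y) / (2 * s ^+ 2))).
Proof.
move=> s0; rewrite /dotp mulr_suml -sumrN expR_sum -[X in _ ^+ X]card_ord -prodr_const -big_split.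
apply: eq_bigr => i _; rewrite normal_pdfE ?gt_eqF // /normal_fun !mxE; congr (_ * expR _).
by rewrite mulNr -mulr_natl expr2.
Qed.

Lemma heat_kernelE (s : R) (y x : 'cV[R]_m) : 0 < s ->
  heat_kernel s (x - y) = \prod_i normal_pdf (y i ord0) s^-1 (x i ord0).
Proof.
move=> s0; rewrite prod_normal_pdf ?invr_gt0 // /heat_kernel; congr (_ * expR (- _)).
by field; rewrite gt_eqF.
Qed.

Lemma gauss_cVE (s : R) (z : 'cV[R]_m) : 0 < s ->
  gauss_cV s z = normal_peak s ^+ m * expR (- (dotp z z / (2 * s ^+ 2))).
Proof.
move=> s0; have := prod_normal_pdf 0 z s0; rewrite subr0 => <-.
by apply: eq_bigr => i _; rewrite mxE.
Qed.

Lemma heat_kernel_ge0 s u : 0 <= heat_kernel s u.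
Proof. by rewrite mulr_ge0 ?expR_ge0 // exprn_ge0 // normal_peak_ge0. Qed.

Lemma measurable_fun_dotp d (T : measurableType d) (f g : T -> 'cV[R]_m) :
  measurable_fun setT f -> measurable_fun setT g -> measurable_fun setT (fun x => dotp (f x) (g x)).
Proof.
move=> /measurable_mxP mf /measurable_mxP mg.
by apply: measurable_sum => i; apply: measurable_funM.
Qed.

Lemma measurable_heat_kernel d (T : measurableType d) (f : T -> 'cV[R]_m) s :
  measurable_fun setT f -> measurable_fun setT (fun x => heat_kernel s (f x)).
Proof.
move=> mf; apply: measurable_funM => //; apply: measurableT_comp => //.
apply: measurableT_comp => //; apply: measurable_funM => //.
by apply: measurable_funM => //; exact: measurable_fun_dotp.
Qed.

Lemma measurable_heat_kernelB s (y : 'cV[R]_m) : measurable_fun setT (fun x : 'cV[R]_m => heat_kernel s (x - y)).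
Proof. by apply: measurable_heat_kernel; exact: measurable_fun_cVB. Qed.

Lemma integral_heat_kernel s y : 0 < s ->
  (\int[mu]_x (heat_kernel s (x - y))%:E = 1)%E.
Proof.
move=> s0; under eq_integral do rewrite heat_kernelE //.
rewrite (ge0_integral_lebesgue_cV_prod (g := fun i => normal_pdf (y i ord0) s^-1) (a := fun=> 1)).
- by rewrite big1.
- by move=> i; exact: measurable_normal_pdf.
- by move=> i x; exact: normal_pdf_ge0.
- by move=> i; exact: integral_normal_pdf.
Qed.

Lemma integrable_heat_kernel s y : 0 < s ->
  mu.-integrable setT (EFin \o (fun x : 'cV[R]_m => heat_kernel s (x - y))).
Proof.
move=> s0; apply: ge0_integrable (integral_heat_kernel y s0).
- exact: measurable_heat_kernelB.
- by move=> x; exact: heat_kernel_ge0.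
Qed.

(* The exponential factor makes the mass of the kernel away from its center small,
   while the wider kernel still has total mass 1. *)
Lemma heat_kernel_half s u : 0 < s ->
  heat_kernel s u = 2 ^+ m * expR (- (s ^+ 2 * dotp u u * (3 / 8))) * heat_kernel (s / 2) u.
Proof.
move=> s0; rewrite /heat_kernel !normal_peakE ?invr_gt0 ?divr_gt0 //.
set c := Num.sqrt _; have c0 : c != 0 by rewrite gt_eqF // sqrtr_gt0 mulr_gt0 ?pi_gt0.
rewrite [RHS]mulrACA -exprMn -expRD; congr (_ ^+ _ * expR _); last by field.
by field; rewrite c0 gt_eqF.
Qed.

Definition heat_mass s (V : set 'cV[R]_m) (y : 'cV[R]_m) : R :=
  \int[mu]_(x in V) heat_kernel s (x - y).

Lemma heat_mass_ge0 s V y : 0 <= heat_mass s V y.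
Proof. by apply: Rintegral_ge0 => x _; exact: heat_kernel_ge0. Qed.

(** Here [r] is a squared distance. The factor 3/8 is 1/2 - 1/8, the difference of the exponents of
    the two kernels, and 2^m the ratio of their peaks. *)
Lemma heat_mass_tail s (V : set 'cV[R]_m) y r : 0 < s -> measurable V ->
  (forall x, V x -> r <= dotp (x - y) (x - y)) ->
  heat_mass s V y <= 2 ^+ m * expR (- (s ^+ 2 * r * (3 / 8))).
Proof.
move=> s0 mV Vr; have s20 : 0 < s / 2 by rewrite divr_gt0.
have I s' : 0 < s' -> mu.-integrable V (EFin \o (fun x => heat_kernel s' (x - y))).
  by move=> s'0; apply: (@integrableS _ _ _ _ setT) => //; exact: integrable_heat_kernel.
set c := 2 ^+ m * _.
have c0 : 0 <= c by rewrite mulr_ge0 ?expR_ge0 // exprn_ge0.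
apply: (@le_trans _ _ (\int[mu]_(x in V) (c * heat_kernel (s / 2) (x - y)))).
  apply: le_Rintegral => //; first exact: I.
    exact: (integrableZl mV c (I _ s20)).
  move=> x Vx; rewrite heat_kernel_half // ler_wpM2r ?heat_kernel_ge0 //.
  rewrite ler_wpM2l ?exprn_ge0 // ler_expR lerN2 ler_wpM2r // ler_wpM2l ?sqr_ge0 //.
  exact: Vr.
rewrite RintegralZl //; last exact: I.
rewrite ler_piMr // -lee_fin fineK; last by apply: integrable_fin_num => //; exact: I.
rewrite -(integral_heat_kernel y s20); apply: ge0_subset_integral => //.
- by apply/measurable_EFinP; exact: measurable_heat_kernelB.
- by move=> x _; rewrite lee_fin heat_kernel_ge0.
Qed.

Lemma heat_massC s (V : set 'cV[R]_m) y : 0 < s -> measurable V ->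
  heat_mass s V y + heat_mass s (~` V) y = 1.
Proof.
move=> s0 mV; rewrite /heat_mass -Rintegral_setU //.
- by rewrite setUv /Rintegral integral_heat_kernel.
- exact: measurableC.
- by rewrite setUv; exact: integrable_heat_kernel.
- by apply/disj_setPS => x [].
Qed.

Lemma heat_mass_le1 s (V : set 'cV[R]_m) y : 0 < s -> measurable V -> heat_mass s V y <= 1.
Proof. by move=> s0 mV; rewrite -(heat_massC y s0 mV) lerDl heat_mass_ge0. Qed.

Lemma expR_sqr_cvg0 (r : R) : 0 < r ->
  2 ^+ m * expR (- (n.+1%:R ^+ 2 * r * (3 / 8))) @[n --> \oo] --> (0 : R).
Proof.
move=> r0; rewrite -[X in _ --> X](mulr0 (2 ^+ m)); apply: cvgMr.
have c0 : 0 < r * (3 / 8) by rewrite mulr_gt0 //; lra.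
apply: (@squeeze_cvgr _ _ _ _ (fun=> 0) (fun n => (r * (3 / 8))^-1 * harmonic n)).
- near=> n; rewrite expR_ge0 expRN -invfM lef_pV2 ?posrE ?expR_gt0 ?mulr_gt0 //=.
  apply: le_trans (expR_ge1Dx _); rewrite ler_wpDl // -mulrA mulrC ler_wpM2r ?(ltW c0) //.
  by rewrite expr2 ler_peMl // ler1n.
- exact: cvg_cst.
- by rewrite -[X in _ --> X](mulr0 (r * (3 / 8))^-1); apply: cvgMr; exact: cvg_harmonic.
Unshelve. all: end_near. Qed.

Lemma open_mx_dotp (V : set 'cV[R]_m) y : open V -> V y ->
  exists2 r, 0 < r & forall x, ~ V x -> r <= dotp (x - y) (x - y).
Proof.
move=> oV Vy; have /nbhs_ballP[e /= e0 eV] : nbhs y V by exact: open_nbhs_nbhs.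
exists (e ^+ 2); first by rewrite exprn_gt0.
move=> x Vx; rewrite leNgt; apply/negP => h; apply: Vx; apply: eV; split=> // i j.
rewrite (ord1 j) /ball /= distrC.
rewrite -(ltr_pXn2r (n := 2)) ?nnegrE // ?(ltW e0) //.
apply: le_lt_trans h; rewrite /dotp (bigD1 i) //= !mxE real_normK ?num_real // expr2 lerDl.
by apply: sumr_ge0 => k _; rewrite -expr2 sqr_ge0.
Qed.

Lemma heat_mass_cvg1 (V : set 'cV[R]_m) y : open V -> V y -> heat_mass n.+1%:R V y @[n --> \oo] --> (1 : R).
Proof.
move=> oV Vy; have [r r0 Vr] := open_mx_dotp oV Vy.
have mV : measurable V by exact: sub_sigma_algebra.
have lo n : 1 - 2 ^+ m * expR (- (n.+1%:R ^+ 2 * r * (3 / 8))) <= heat_mass n.+1%:R V y.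
  rewrite lerBlDr -[leLHS](heat_massC y (ltr0Sn R n) mV) lerD2l.
  by apply: heat_mass_tail => //; exact: measurableC.
apply: (@squeeze_cvgr _ _ _ _ (fun n => 1 - 2 ^+ m * expR (- (n.+1%:R ^+ 2 * r * (3 / 8)))) (fun=> 1)).
- by near=> n; rewrite lo heat_mass_le1.
- by rewrite -[X in _ --> X]subr0; apply: cvgB; [exact: cvg_cst|exact: expR_sqr_cvg0].
- exact: cvg_cst.
Unshelve. all: end_near. Qed.

Lemma heat_mass_cvg0 (V : set 'cV[R]_m) y : measurable V -> ~ closure V y ->
  heat_mass n.+1%:R V y @[n --> \oo] --> (0 : R).
Proof.
move=> mV Vy.
have oC : open (~` closure V) by apply: closed_openC; exact: closed_closure.
have [r r0 Vr] := open_mx_dotp oC Vy.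
apply: (@squeeze_cvgr _ _ _ _ (fun=> 0) (fun n => 2 ^+ m * expR (- (n.+1%:R ^+ 2 * r * (3 / 8))))).
- near=> n; rewrite heat_mass_ge0 heat_mass_tail // => x Vx.
  by apply: Vr => h; apply: h; exact: subset_closure.
- exact: cvg_cst.
- exact: expR_sqr_cvg0.
Unshelve. all: end_near. Qed.

End heat_kernel.

(** * Identification of the law with the inverse Fourier integral *)

Section inversion.
Context (R : realType) (m : nat) disp (Omega : measurableType disp) (P : probability Omega R).
Context (X : Omega -> 'cV[R]_m).
Hypothesis mX : measurable_fun setT X.
Local Notation mu := (lebesgue_cV R m).

Let c (z : 'cV[R]_m) := \int[P]_w cos (dotp z (X w)).
Let s (z : 'cV[R]_m) := \int[P]_w sin (dotp z (X w)).
Hypothesis rc : rapidly_decreasing c.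
Hypothesis rs : rapidly_decreasing s.

Let C0 : R := (2 * pi)^-1 ^+ m.
Let a z := C0 * c z.
Let b z := C0 * s z.
(** The inverse Fourier integral of the characteristic function c + i s, written with real
    integrands. *)
Let p := trig_integral a b.

Let mdot z : measurable_fun setT (fun w => dotp z (X w)).
Proof. exact: (measurableT_comp (measurable_dotp z) mX). Qed.

Let kappa z x : cos (dotp z x) * c z + sin (dotp z x) * s z =
  \int[P]_w cos (dotp z (X w - x)).
Proof.
have Ic : P.-integrable setT (EFin \o (fun w => cos (dotp z (X w)))).
  by apply: (bounded_integrable P (C := 1)) => [|w]; [exact: measurable_cos_comp|exact: normr_cos_le1].
have Is : P.-integrable setT (EFin \o (fun w => sin (dotp z (X w)))).
  by apply: (bounded_integrable P (C := 1)) => [|w]; [exact: measurable_sin_comp|exact: normr_sin_le1].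
rewrite /c /s -!RintegralZl // -RintegralD //.
- by apply: eq_Rintegral => w _; rewrite dotpBr cosB mulrC (mulrC (sin (dotp z x))).
- exact: (integrableZl measurableT (cos (dotp z x)) Ic).
- exact: (integrableZl measurableT (sin (dotp z x)) Is).
Qed.

Let damped r x := \int[mu]_z ((cos (dotp z x) * a z + sin (dotp z x) * b z) *
  expR (- (dotp z z / (2 * r ^+ 2)))).

Let mdampen r : measurable_fun setT (fun z : 'cV[R]_m => expR (- (dotp z z / (2 * r ^+ 2)))).
Proof.
apply: measurableT_comp => //; apply: measurableT_comp => //.
by apply: measurable_funM => //; exact: measurable_fun_dotp.
Qed.

Let mX_fst : measurable_fun setT (fun q : Omega * 'cV[R]_m => X q.1).
Proof. exact: (measurableT_comp mX measurable_fst). Qed.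

(** By the self-duality of Gaussians the damped inversion integral is the density of X plus an
    independent Gaussian of standard deviation 1/r. In particular it is nonnegative, and so is its
    limit [p]. *)
Let mollified r x : 0 < r -> \int[P]_w heat_kernel r (x - X w) = damped r x.
Proof.
move=> r0; have rV0 : 0 < r^-1 by rewrite invr_gt0.
have pk (u : R) : 0 < u -> 0 < normal_peak u by move=> u0; rewrite normal_peak_gt0 // gt_eqF.
(* The peaks of the densities of width r and 1/r have product 1/(2 pi). *)
have kk : C0 / normal_peak r ^+ m = normal_peak r^-1 ^+ m.
  rewrite /C0 -expr_div_n; congr (_ ^+ _); rewrite !normal_peakE //.
  have pi2 : 0 < 2 * pi :> R by rewrite mulr_gt0 // pi_gt0.
  rewrite -{1}(sqr_sqrtr (ltW pi2)).
  have : Num.sqrt (2 * pi) != 0 :> R by rewrite gt_eqF // sqrtr_gt0.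
  by set q := Num.sqrt _ => q0; field; rewrite q0 gt_eqF.
have -> : damped r x = \int[mu]_z \int[P]_w (C0 / normal_peak r ^+ m *
    (cos (dotp z (X w - x)) * gauss_cV r z)).
  apply: eq_Rintegral => z _.
  have -> : cos (dotp z x) * a z + sin (dotp z x) * b z = C0 * \int[P]_w cos (dotp z (X w - x)).
    by rewrite -kappa /a /b; ring.
  have I : P.-integrable setT (EFin \o (fun w => cos (dotp z (X w - x)))).
    apply: (bounded_integrable P (C := 1)) => [|w]; last exact: normr_cos_le1.
    apply: measurable_cos_comp; apply: (measurableT_comp (measurable_dotp z)).
    exact: measurable_fun_cVB.
  rewrite RintegralZl //; last exact: (integrableZr measurableT (gauss_cV r z) I).
  rewrite RintegralZr // gauss_cVE //; field; rewrite expf_neq0 // gt_eqF //; exact: pk.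
rewrite -(@Rintegral_exchange_prob _ _ _ _ _ P mu (fun q => C0 / normal_peak r ^+ m *
    (cos (dotp q.2 (X q.1 - x)) * gauss_cV r q.2)) (fun z => C0 / normal_peak r ^+ m * gauss_cV r z)); first last.
- exact: (integrableZl measurableT _ (integrable_gauss_cV m r)).
- move=> q; have k0 : 0 <= C0 / normal_peak r ^+ m by rewrite kk exprn_ge0 // ltW // pk.
  rewrite normrM (ger0_norm k0) ler_wpM2l // normrM (ger0_norm (gauss_cV_ge0 _ _)).
  by rewrite ler_piMl ?gauss_cV_ge0 // normr_cos_le1.
- apply: measurable_funM => //; apply: measurable_funM.
    by apply: measurable_cos_comp; apply: measurable_fun_dotp => //; exact: measurable_fun_cVB.
  exact: (measurableT_comp (@measurable_gauss_cV R m r) measurable_snd).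
apply: eq_Rintegral => w _ /=.
have -> : \int[mu]_z (C0 / normal_peak r ^+ m * (cos (dotp z (X w - x)) * gauss_cV r z)) =
   C0 / normal_peak r ^+ m * \int[mu]_z (cos (dotp z (X w - x) + 0) * gauss_cV r z).
  rewrite -RintegralZl //.
    by apply: eq_Rintegral => z _; rewrite addr0.
  under eq_fun do rewrite addr0.
  exact: (integrable_cosM (X w - x) (integrable_gauss_cV m r)).
have -> : heat_kernel r (x - X w) =
    normal_peak r^-1 ^+ m * expR (- (r ^+ 2 * dotp (X w - x) (X w - x) / 2)).
  have -> : dotp (X w - x) (X w - x) = dotp (x - X w) (x - X w); last by [].
  by apply: eq_bigr => i _; rewrite !mxE -mulrNN !opprB.
by rewrite Rintegral_cos_gauss_cV // cos0 mul1r kk.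
Qed.

Let Ia : mu.-integrable setT (EFin \o a).
Proof. exact: (integrableZl measurableT C0 (rapidly_decreasing_integrable rc)). Qed.

Let Ib : mu.-integrable setT (EFin \o b).
Proof. exact: (integrableZl measurableT C0 (rapidly_decreasing_integrable rs)). Qed.

Let Iab : mu.-integrable setT (EFin \o (fun z => `|a z| + `|b z|)).
Proof. exact: (integrableD measurableT (integrable_norm Ia) (integrable_norm Ib)). Qed.

Let ab_le z x : `|cos (dotp z x) * a z + sin (dotp z x) * b z| <= `|a z| + `|b z|.
Proof.
apply: le_trans (ler_normD _ _) _.
by apply: lerD; rewrite normrM ler_piMl // ?normr_cos_le1 ?normr_sin_le1.
Qed.

Let dampen_le1 r (z : 'cV[R]_m) : `|expR (- (dotp z z / (2 * r ^+ 2)))| <= 1.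
Proof.
rewrite ger0_norm ?expR_ge0 // -expR0 ler_expR oppr_le0.
by rewrite divr_ge0 ?dotp_ge0 // mulr_ge0 // sqr_ge0.
Qed.

Let damped_le r z x : `|(cos (dotp z x) * a z + sin (dotp z x) * b z) *
  expR (- (dotp z z / (2 * r ^+ 2)))| <= `|a z| + `|b z|.
Proof.
rewrite normrM; apply: le_trans (ab_le z x).
by rewrite ler_piMr // dampen_le1.
Qed.

Let mdamped_int r x : measurable_fun setT (fun z => (cos (dotp z x) * a z + sin (dotp z x) * b z) *
  expR (- (dotp z z / (2 * r ^+ 2)))).
Proof.
apply: measurable_funM; last exact: mdampen.
by apply/measurable_EFinP; exact: measurable_int (integrable_trig x Ia Ib).
Qed.

Let M := \int[mu]_z (`|a z| + `|b z|).

Let damped_bound r x : `|damped r x| <= M.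
Proof.
have I : mu.-integrable setT (EFin \o (fun z => (cos (dotp z x) * a z + sin (dotp z x) * b z) *
    expR (- (dotp z z / (2 * r ^+ 2))))).
  apply: (@le_integrable _ _ _ _ _ measurableT _ (EFin \o (fun z => `|a z| + `|b z|))) => //.
    by apply/measurable_EFinP; exact: mdamped_int.
  by move=> z _; rewrite lee_fin; apply: le_trans (damped_le r z x) (ler_norm _).
apply: le_trans (le_normr_Rintegral _ _) _ => //.
apply: le_Rintegral => //; first exact: integrable_norm.
Qed.

Let damped_cvg x : damped n.+1%:R x @[n --> \oo] --> p x.
Proof.
have := @dominated_convergence _ _ R mu setT measurableT
  (fun n z => ((cos (dotp z x) * a z + sin (dotp z x) * b z) *
    expR (- (dotp z z / (2 * n.+1%:R ^+ 2))))%:E)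
  (fun z => (cos (dotp z x) * a z + sin (dotp z x) * b z)%:E)
  (EFin \o (fun z => `|a z| + `|b z|)); case.
- by move=> n; apply/measurable_EFinP; exact: mdamped_int.
- exact: measurable_int (integrable_trig x Ia Ib).
- apply: aeW => z _; apply: cvg_EFin.
    by near=> n.
  rewrite -[X in _ --> X]mulr1; apply: cvgMr.
  rewrite -[X in _ --> X]expR0; apply: continuous_cvg; first exact: continuous_expR.
  rewrite -oppr0; apply: cvgN; rewrite -[X in _ --> X](mulr0 (dotp z z / 2)).
  have -> : (fun n : nat => dotp z z / (2 * n.+1%:R ^+ 2)) =
            (fun n => dotp z z / 2 * (harmonic n * harmonic n)).
    by apply/funext => n; rewrite /harmonic /= !invfM; ring.
  apply: cvgMr; rewrite -[X in _ --> X](mulr0 0); apply: cvgM; exact: cvg_harmonic.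
- exact: Iab.
- by apply: aeW => z n _; rewrite /= lee_fin; exact: damped_le.
move=> _ _ H; apply: fine_cvg; rewrite /p /trig_integral fineK; first exact: H.
by apply: integrable_fin_num => //; exact: (integrable_trig x Ia Ib).
Unshelve. all: end_near. Qed.

Let p_ge0 x : 0 <= p x.
Proof.
apply: (@ler_cvg_to _ \oo _ R (fun=> 0) (fun n => damped n.+1%:R x) 0 (p x)).
- exact: cvg_cst.
- exact: damped_cvg.
near=> n; rewrite -mollified //; apply: Rintegral_ge0 => w _; exact: heat_kernel_ge0.
Unshelve. all: end_near. Qed.

Let p_le x : `|p x| <= M.
Proof.
have h : `|damped n.+1%:R x| @[n --> \oo] --> `|p x| by apply: cvg_norm; exact: damped_cvg.
apply: (@ler_cvg_to _ \oo _ R (fun n => `|damped n.+1%:R x|) (fun=> M) `|p x| M).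
- exact: h.
- exact: cvg_cst.
by near=> n; exact: damped_bound.
Unshelve. all: end_near. Qed.

Let heat_le r (u : 'cV[R]_m) : 0 < r -> `|heat_kernel r u| <= normal_peak r^-1 ^+ m.
Proof.
move=> r0; rewrite ger0_norm ?heat_kernel_ge0 // /heat_kernel ler_piMr //.
  by rewrite exprn_ge0 // normal_peak_ge0.
by rewrite -expR0 ler_expR oppr_le0 divr_ge0 // mulr_ge0 ?sqr_ge0 // dotp_ge0.
Qed.

Let mheat2 r : measurable_fun setT (fun q : Omega * 'cV[R]_m => heat_kernel r (q.2 - X q.1)).
Proof. by apply: measurable_heat_kernel; exact: measurable_fun_cVB. Qed.

Let mdamped n : measurable_fun setT (damped n.+1%:R).
Proof.
have -> : damped n.+1%:R = (fun x => \int[P]_w heat_kernel n.+1%:R (x - X w)).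
  by apply/funext => x; rewrite mollified.
by apply: (measurable_Rintegral_prob P (mheat2 n.+1%:R)) => q; exact: heat_le.
Qed.

Let mp : measurable_fun setT p.
Proof.
apply: (@measurable_fun_cvg _ _ R setT (fun n => damped n.+1%:R) p) => [n|x _].
- exact: mdamped.
- exact: damped_cvg.
Qed.

Section test_set.
Context (V : set 'cV[R]_m).
Hypothesis mV : measurable V.
Hypothesis Voo : (mu V < +oo)%E.

Let mmass r : measurable_fun setT (fun w => heat_mass r V (X w)).
Proof.
have mf : measurable_fun setT (fun q : Omega * 'cV[R]_m => (\1_V q.2 * heat_kernel r (q.2 - X q.1))%:E).
  apply/measurable_EFinP; apply: measurable_funM; last exact: mheat2.
  by apply: (measurableT_comp _ measurable_snd); exact: measurable_indic.
have f0 q : (0 <= (\1_V q.2 * heat_kernel r (q.2 - X q.1))%:E)%E.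
  by rewrite lee_fin mulr_ge0 // heat_kernel_ge0.
apply: (eq_measurable_fun (fun w => fine (\int[mu]_x (\1_V x * heat_kernel r (x - X w))%:E)%E)).
  by move=> w _; rewrite /heat_mass -Rintegral_indicM.
apply: measurableT_comp => //.
exact: (@measurable_fun_fubini_tonelli_F _ _ _ _ _ mu _ mf f0).
Qed.

Let mass_exchange n : \int[P]_w heat_mass n.+1%:R V (X w) = \int[mu]_(x in V) damped n.+1%:R x.
Proof.
have peak0 : 0 <= normal_peak n.+1%:R^-1 ^+ m :> R by rewrite exprn_ge0 // normal_peak_ge0.
transitivity (\int[P]_w \int[mu]_x (\1_V x * heat_kernel n.+1%:R (x - X w))).
  by apply: eq_Rintegral => w _; rewrite Rintegral_indicM.
rewrite -[RHS]Rintegral_indicM //.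
apply: (etrans (@Rintegral_exchange_prob _ _ _ _ _ P mu (fun q => \1_V q.2 * heat_kernel n.+1%:R (q.2 - X q.1))
  (fun x => normal_peak n.+1%:R^-1 ^+ m * \1_V x) _ _ _)); last first.
- apply: eq_Rintegral => x _ /=; rewrite -mollified // RintegralZl //.
  apply: (bounded_integrable P (C := normal_peak n.+1%:R^-1 ^+ m)).
    exact: (measurableT_comp (mheat2 n.+1%:R) (pair2_measurable x)).
  by move=> w; exact: heat_le.
- have IV : mu.-integrable setT (EFin \o (\1_V : 'cV[R]_m -> R)).
    apply: (@ge0_integrable _ _ _ _ _ (fine (mu V))) => //.
    by rewrite integral_indic // setIT fineK // ge0_fin_numE.
  exact: (integrableZl measurableT _ IV).
- move=> q; rewrite normrM mulrC indicE; case: (_ \in _); last by rewrite normr0 !mulr0.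
  by rewrite normr1 !mulr1; exact: heat_le.
- apply: measurable_funM; last exact: mheat2.
  by apply: (measurableT_comp _ measurable_snd); exact: measurable_indic.
Qed.

Let Vp_integrable : mu.-integrable V (EFin \o p).
Proof.
apply: measurable_bounded_integrable => //; first exact: measurable_funTS.
exists M; split; first exact: num_real.
by move=> y My x _; exact: le_trans (p_le x) (ltW My).
Qed.

Let mass_cvg : \int[P]_w heat_mass n.+1%:R V (X w) @[n --> \oo] --> \int[mu]_(x in V) p x.
Proof.
under eq_fun do rewrite mass_exchange.
have := @dominated_convergence _ _ R mu V mV (fun n => EFin \o damped n.+1%:R) (EFin \o p) (cst M%:E); case.
- by move=> n; apply/measurable_EFinP; apply: measurable_funTS; exact: mdamped.
- by apply/measurable_EFinP; exact: measurable_funTS.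
- by apply: aeW => x Vx; apply: cvg_EFin; [near=> n|exact: damped_cvg].
- have IM : mu.-integrable V (EFin \o cst M).
    apply: measurable_bounded_integrable => //.
    by exists `|M|; split=> [|y My x _]; [exact: num_real|exact: ltW].
  exact: IM.
- by apply: aeW => x n Vx; rewrite /= lee_fin; exact: damped_bound.
move=> _ _ H; apply: fine_cvg; rewrite fineK; first exact: H.
by apply: integrable_fin_num.
Unshelve. all: end_near. Qed.

Let mXV U : measurable U -> measurable (X @^-1` U).
Proof. by move=> mU; rewrite -[A in measurable A]setTI; exact: mX. Qed.

(** The mass that the kernel centred at y gives to V converges to 1 inside an open V and to 0
    outside its closure; on the boundary the limit is unknown. Localising to [U] avoids it and leads
    to the two one-sided bounds below. *)
Let mass_indic_cvg U (l : R) : measurable U ->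
  (forall y, U y -> heat_mass n.+1%:R V y @[n --> \oo] --> l) -> `|l| <= 1 ->
  \int[P]_w (\1_U (X w) * heat_mass n.+1%:R V (X w)) @[n --> \oo] --> l * fine (P (X @^-1` U)).
Proof.
move=> mU Ul l1.
have mI : measurable_fun setT (fun w => \1_U (X w) : R).
  by apply: (measurableT_comp _ mX); exact: measurable_indic.
have -> : l * fine (P (X @^-1` U)) = \int[P]_w (l * \1_U (X w)).
  rewrite RintegralZl //; last by apply: (bounded_integrable P (C := 1)) => // w; exact: normr_indic_le1.
  by rewrite -Rintegral_indic //; exact: mXV.
apply: (Rintegral_cvg_bounded (C := 1)).
- by move=> n; apply: measurable_funM.
- by apply: measurable_funM.
- move=> n w; rewrite normrM mulr_ile1 // ?normr_indic_le1 //.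
  by rewrite ger0_norm ?heat_mass_ge0 // heat_mass_le1.
- apply: aeW => w; rewrite mulrC indicE; case: (boolP (X w \in U)) => [/set_mem Uw|_].
    by apply: cvgMr; exact: Ul.
  by rewrite mul0r; under eq_fun do rewrite mul0r; exact: cvg_cst.
Qed.

Let Imass n : P.-integrable setT (EFin \o (fun w => heat_mass n.+1%:R V (X w))).
Proof.
apply: (bounded_integrable P (C := 1)) => // w.
by rewrite ger0_norm ?heat_mass_ge0 // heat_mass_le1.
Qed.

Lemma density_ge : open V -> (P (X @^-1` V) <= \int[mu]_(x in V) (p x)%:E)%E.
Proof.
move=> oV.
have fV : (\int[mu]_(x in V) (p x)%:E)%E \is a fin_num by exact: integrable_fin_num.
have fP : P (X @^-1` V) \is a fin_num by apply: fin_num_measure; exact: mXV.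
rewrite -(fineK fV) -(fineK fP) lee_fin.
have n1 : `|1 : R| <= 1 by rewrite normr1.
have := @mass_indic_cvg V 1 mV (fun y Vy => heat_mass_cvg1 oV Vy) n1; rewrite mul1r => H1.
apply: (ler_cvg_to H1 mass_cvg); near=> n.
have mI : measurable_fun setT (fun w => \1_V (X w) : R).
  by apply: (measurableT_comp _ mX); exact: measurable_indic.
apply: le_Rintegral => //.
  exact: (bounded_integrableM mI (fun w => normr_indic_le1 R V (X w)) (Imass n)).
by move=> w _; rewrite ler_piMl ?heat_mass_ge0 // (le_trans (ler_norm _)) // normr_indic_le1.
Unshelve. all: end_near. Qed.

Lemma density_le : (\int[mu]_(x in V) (p x)%:E <= P (X @^-1` closure V))%E.
Proof.
have mcl : measurable (closure V).
  rewrite -[closure V]setCK; apply: measurableC; apply: sub_sigma_algebra.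
  by apply: closed_openC; exact: closed_closure.
have fV : (\int[mu]_(x in V) (p x)%:E)%E \is a fin_num by exact: integrable_fin_num.
have fP : P (X @^-1` closure V) \is a fin_num by apply: fin_num_measure; exact: mXV.
rewrite -(fineK fV) -(fineK fP) lee_fin.
have n0 : `|0 : R| <= 1 by rewrite normr0.
have := @mass_indic_cvg (~` closure V) 0 (measurableC mcl) (fun y Vy => heat_mass_cvg0 mV Vy) n0.
rewrite mul0r => H0.
have H1 : fine (P (X @^-1` closure V)) +
    \int[P]_w (\1_(~` closure V) (X w) * heat_mass n.+1%:R V (X w)) @[n --> \oo] -->
    fine (P (X @^-1` closure V)).
  by rewrite -[A in _ --> A]addr0; apply: cvgD => //; exact: cvg_cst.
apply: (ler_cvg_to mass_cvg H1); near=> n.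
have mI U : measurable U -> measurable_fun setT (fun w => \1_U (X w) : R).
  by move=> mU; apply: (measurableT_comp _ mX); exact: measurable_indic.
have I1 U : measurable U -> P.-integrable setT (EFin \o (fun w => \1_U (X w) : R)).
  by move=> mU; apply: (bounded_integrable P (C := 1)) => [|w]; [exact: mI|exact: normr_indic_le1].
have I2 := bounded_integrableM (mI _ (measurableC mcl))
  (fun w => normr_indic_le1 R (~` closure V) (X w)) (Imass n).
have -> : fine (P (X @^-1` closure V)) = \int[P]_w \1_(closure V) (X w).
  by rewrite -Rintegral_indic //; exact: mXV.
rewrite -RintegralD //; last exact: I1.
apply: le_Rintegral => //; first exact: (integrableD measurableT (I1 _ mcl) I2).
move=> w _; rewrite !indicE in_setC; case: (_ \in _).
  by rewrite /= mul0r addr0 heat_mass_le1.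
by rewrite /= mul1r add0r.
Unshelve. all: end_near. Qed.

End test_set.

(** Open sets of finite volume that increase to an open [U] and whose closures stay in [U], so that
    the two one-sided bounds meet in the limit. The strict inequality on the radius makes them
    open. *)
Let inner (U : set 'cV[R]_m) n : set 'cV[R]_m :=
  [set x | exists2 e, n.+1%:R^-1 < e & ball x e `<=` U] `&` ball (0 : 'cV[R]_m) n.+1%:R.

Let open_inner U n : open (inner U n).
Proof.
apply: openI; last exact: ball_open.
rewrite openE => x [e ne eU]; have [u [v [u0 v0 ve]]] : exists u v, [/\ 0 < u, n.+1%:R^-1 < v & e = u + v].
  move: ne; set t := _^-1 => ne; exists ((e - t) / 2), ((e + t) / 2).
  by split; [lra|lra|field].
apply/nbhs_ballP; exists u => //=.
move=> y xy; exists v => // z yz; apply: eU; rewrite ve.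
exact: ball_triangle xy yz.
Qed.

Let closure_inner U n : closure (inner U n) `<=` U.
Proof.
move=> x /(_ (ball x n.+1%:R^-1)) []; first exact: nbhsx_ballx.
move=> y [[[e ne eU] _] xy]; apply: eU; apply: ball_sym; apply: le_ball xy.
exact: ltW.
Qed.

Let inner_lty U n : (mu (inner U n) < +oo)%E.
Proof.
pose I : set R := `]- n.+1%:R, n.+1%:R[%classic.
have mI : measurable (I : set (measurableTypeR R)) by exact: measurable_itv.
pose box : set 'cV[R]_m := [set v | forall i, I (v i ord0)].
have mbox : measurable box.
  have -> : box = \bigcap_(i in [set: 'I_m]) (fun v : 'cV[R]_m => v i ord0) @^-1` I.
    by apply/seteqP; split=> v /= h i; [move=> _; exact: h|exact: (h i Logic.I)].
  apply: fin_bigcap_measurable => // i _; rewrite -[A in measurable A]setTI.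
  exact: measurable_coord.
apply: (@le_lt_trans _ _ (mu box)).
  apply: le_measure; rewrite ?inE.
  - by apply: sub_sigma_algebra; exact: open_inner.
  - exact: mbox.
  - move=> x [_ [_ h]] i; have := h i ord0; rewrite /ball /= mxE sub0r normrN ltr_norml.
    by rewrite /I /= in_itv.
rewrite (lebesgue_cV_box (U := fun=> I)) // big_const card_ord.
have -> : lebesgue_measure I = (n.+1%:R - - n.+1%:R)%:E.
  by apply: etrans (lebesgue_measure_itv _) _; rewrite /= lte_fin gtrN.
by elim: m => [|k IH] /=; rewrite ?ltry // lte_mul_pinfty.
Qed.

Let inner_nd U : nondecreasing_seq (inner U).
Proof.
move=> i j ij; apply/subsetPset => x [[e ie eU] xi].
have le_ij : i.+1%:R <= j.+1%:R :> R by rewrite ler_nat ltnS.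
split; last exact: le_ball xi.
by exists e => //; apply: le_lt_trans ie; rewrite lef_pV2 ?posrE.
Qed.

Let bigcup_inner U : open U -> \bigcup_n inner U n = U.
Proof.
move=> oU; apply/seteqP; split=> [x [n _] xn|x Ux].
  by apply: (@closure_inner U n); exact: subset_closure.
have /nbhs_ballP[e /= e0 eU] : nbhs x U by exact: open_nbhs_nbhs.
have [N1 _ /(_ N1 (leqnn N1)) /= H1] := near_infty_natSinv_lt (PosNum e0).
have x0 : 0 < norm1 x + 1 by rewrite ltr_wpDl // norm1_ge0.
have xV0 : 0 < (norm1 x + 1)^-1 by rewrite invr_gt0.
have [N2 _ /(_ N2 (leqnn N2)) /= H2] := near_infty_natSinv_lt (PosNum xV0).
exists (maxn N1 N2) => //; split.
  exists e => //; apply: le_lt_trans H1; by rewrite lef_pV2 ?posrE // ler_nat ltnS leq_maxl.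
split=> // i j; rewrite (ord1 j) /ball /= mxE sub0r normrN.
apply: le_lt_trans (coord_le_norm1 x i) _.
apply: (@lt_le_trans _ _ N2.+1%:R); last by rewrite ler_nat ltnS leq_maxr.
by move: H2; rewrite ltf_pV2 ?posrE //; apply: lt_trans; rewrite ltrDl.
Qed.

Let density_open U : open U -> P (X @^-1` U) = (\int[mu]_(x in U) (p x)%:E)%E.
Proof.
move=> oU.
have mU : measurable U by exact: sub_sigma_algebra.
have mi n : measurable (inner U n) by apply: sub_sigma_algebra; exact: open_inner.
have mXU A : measurable A -> measurable (X @^-1` A).
  by move=> mA; rewrite -[B in measurable B]setTI; exact: mX.
have sU n : inner U n `<=` U by apply: subset_trans (@closure_inner U n); exact: subset_closure.
have mep : measurable_fun setT (EFin \o p) by exact/measurable_EFinP.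
apply/eqP; rewrite eq_le; apply/andP; split.
- have cv : P (X @^-1` inner U n) @[n --> \oo] --> P (X @^-1` U).
    rewrite -{2}(bigcup_inner oU) preimage_bigcup.
    apply: (nondecreasing_cvg_mu (F := fun n => X @^-1` inner U n)).
    + by move=> n; exact: mXU.
    + by rewrite -preimage_bigcup bigcup_inner //; exact: mXU.
    + by move=> i j ij; apply/subsetPset; apply: preimage_subset; exact/subsetPset/inner_nd.
  apply: (@lee_cvg_to _ \oo _ R _ (fun=> \int[mu]_(x in U) (p x)%:E)%E) cv _ _.
    exact: cvg_cst.
  near=> n; apply: le_trans (density_ge (mi n) (@inner_lty U n) (@open_inner U n)) _.
  apply: ge0_subset_integral => //; first exact: measurable_funTS.
  by move=> x _; rewrite lee_fin.
- have cv := ge0_nondecreasing_set_cvg_integral (inner_nd U) mi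
    (fun n => measurable_funTS mep) (mu := mu) (fun i x _ => (p_ge0 x : (0 <= (p x)%:E)%E)).
  rewrite (bigcup_inner oU) in cv.
  apply: (@lee_cvg_to _ \oo _ R _ (fun=> P (X @^-1` U))) cv _ _.
    exact: cvg_cst.
  near=> n; apply: le_trans (density_le (mi n) (@inner_lty U n)) _.
  apply: le_measure; rewrite ?inE; [apply: mXU|exact: mXU|].
    rewrite -[A in measurable A]setCK; apply: measurableC; apply: sub_sigma_algebra.
    by apply: closed_openC; exact: closed_closure.
  by apply: preimage_subset; exact: closure_inner.
Unshelve. all: end_near. Qed.

Let nu (A : set 'cV[R]_m) : \bar R := (\int[mu]_(x in A) (p x)%:E)%E.
Let nu0 : nu set0 = 0%E. Proof. exact: integral_set0. Qed.
Let nu_ge0 A : (0 <= nu A)%E.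
Proof. by apply: integral_ge0 => x _; rewrite lee_fin. Qed.
Let nu_sigma : semi_sigma_additive nu.
Proof.
by apply: semi_sigma_additive_nng_induced => [|x]; [exact/measurable_EFinP|rewrite lee_fin].
Qed.
HB.instance Definition _ := isMeasure.Build _ _ _ nu nu0 nu_ge0 nu_sigma.

Lemma fourier_inversion :
  exists q : 'cV[R]_m -> R, has_density (pushforward P X) q /\ Cb_infty q.
Proof.
pose law := pushforward P X : {measure set 'cV[R]_m -> \bar R}.
exists p; split.
  split=> // U mU.
  have law_nu A : open A -> law mX A = nu A by exact: density_open.
  have law_fin (k : nat) : (law mX setT < +oo)%E.
    by rewrite /law /= /pushforward preimage_setT probability_setT ltry.
  have cover : \bigcup_(k : nat) [set: 'cV[R]_m] = setT by apply: bigcup_const; exists 0%N.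
  (* Open sets are stable under intersection and generate the Borel sets, and the law is finite, so
     agreement on open sets is enough. *)
  exact: (measure_unique (@open 'cV[R]_m) (fun=> setT) erefl
    (fun A B => @openI _ A B) (fun=> openT) cover (law mX) nu law_nu law_fin U mU).
by apply: Cb_infty_trig_integral; exact: rapidly_decreasingZ.
Qed.

End inversion.

(** * Decay of the characteristic function of the solution *)

Section decay.
Context (R : realType) (m : nat) disp (Omega : measurableType disp) (P : probability Omega R).

Lemma mod2_le2 (Y : Omega -> R) : measurable_fun setT Y -> mod2 P Y <= 2.
Proof.
move=> mY.
have H (f : R -> R) : (forall x, `|f x| <= 1) -> measurable_fun setT (fun w => f (Y w)) ->
    (\int[P]_w f (Y w)) ^+ 2 <= 1.
  move=> f1 mf; rewrite -[X in X <= _]real_normK ?num_real // expr_le1 //.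
  have <- : \int[P]_(w in setT) (1 : R) = 1 := Rint_cst P 1.
  have I := bounded_integrable P mf (fun w => f1 (Y w)).
  apply: le_trans (le_normr_Rintegral measurableT I) _; apply: le_Rintegral => //.
  - exact: integrable_norm.
  - by apply: (bounded_integrable P (C := 1)) => // w; rewrite normr1.
rewrite /mod2 (_ : 2 = 1 + 1 :> R) //; apply: lerD; apply: H.
- exact: normr_cos_le1.
- exact: measurable_cos_comp.
- exact: normr_sin_le1.
- exact: measurable_sin_comp.
Qed.

Lemma smooth_density_of_decay (X : Omega -> 'cV[R]_m) : measurable_fun setT X ->
  (forall N, exists C, forall z, mod2 P (fun w => dotp z (X w)) * (1 + norm1 z) ^+ N <= C) ->
  exists q, has_density (pushforward P X) q /\ Cb_infty q.
Proof.
move=> mX H.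
have mXz : measurable_fun setT (fun q : Omega * 'cV[R]_m => dotp q.2 (X q.1)).
  apply: measurable_fun_dotp => //; exact: (measurableT_comp mX measurable_fst).
have K (f : 'cV[R]_m -> R) : measurable_fun setT f ->
    (forall z, f z ^+ 2 <= mod2 P (fun w => dotp z (X w))) -> rapidly_decreasing f.
  (* The decay is that of the squared modulus, hence 2N powers for N; from a^2 <= C follows a <= C +
     1. *)
  move=> mf fm; split=> // N; have [C hC] := H (2 * N)%N; exists (C + 1) => z.
  have a0 : 0 <= `|f z| * (1 + norm1 z) ^+ N.
    by rewrite mulr_ge0 // exprn_ge0 // (le_trans ler01) // oneDnorm1_ge1.
  have a2 : (`|f z| * (1 + norm1 z) ^+ N) ^+ 2 <= C.
    apply: le_trans (hC z); rewrite exprMn real_normK ?num_real // -exprM mulnC.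
    by rewrite ler_wpM2r // exprn_ge0 // (le_trans ler01) // oneDnorm1_ge1.
  move: a0 a2; set a := _ * _ => a0 a2.
  have [a1|a1] := leP a 1; first by have := sqr_ge0 a; lra.
  have : a <= a ^+ 2 by rewrite expr2 ler_peMl // ltW.
  by lra.
apply: fourier_inversion => //; apply: K.
- apply: (measurable_Rintegral_prob P (f := fun q => cos (dotp q.2 (X q.1))) (C := 1)).
    exact: measurable_cos_comp.
  by move=> q; exact: normr_cos_le1.
- by move=> z; rewrite lerDl sqr_ge0.
- apply: (measurable_Rintegral_prob P (f := fun q => sin (dotp q.2 (X q.1))) (C := 1)).
    exact: measurable_sin_comp.
  by move=> q; exact: normr_sin_le1.
- by move=> z; rewrite lerDr sqr_ge0.
Qed.

End decay.

Lemma norm_le_norm1 (R : realType) m (h : 'cV[R]_m) : `|h| <= norm1 h.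
Proof.
rewrite [leLHS]mx_normrE; apply: bigmax_le => [|[i j] _ /=]; first exact: norm1_ge0.
by rewrite (ord1 j) coord_le_norm1.
Qed.

Lemma cvg_mulmx (R : realType) T (F : set_system T) (FF : Filter F) m n (B : 'M[R]_(m, n))
    (f : T -> 'cV[R]_n) (l : 'cV[R]_n) :
  f x @[x --> F] --> l -> B *m f x @[x --> F] --> B *m l.
Proof.
move=> /cvgrPdist_le fl; apply/cvgrPdist_le => e e0.
have c0 : 0 <= mnorm B * n%:R by rewrite mulr_ge0 // mnorm_ge0.
near=> x.
rewrite -mulmxBr; apply: le_trans (norm_le_norm1 _) _; apply: le_trans (norm1_mulmx _ _) _.
have : `|l - f x| <= e / (mnorm B * n%:R + 1).
  by near: x; apply: fl; rewrite divr_gt0 // ltr_wpDl.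
rewrite ler_pdivlMr; last by rewrite ltr_wpDl.
move=> h; apply: (@le_trans _ _ (mnorm B * (n%:R * `|l - f x|))).
  by rewrite ler_wpM2l ?mnorm_ge0 // norm1_le_norm.
by apply: le_trans h; rewrite mulrA mulrDr mulr1 mulrC lerDl.
Unshelve. all: end_near. Qed.

Lemma sum_ge_block (R : realDomainType) (F : nat -> R) n e L a :
  (forall i, 0 <= F i) -> (e + L <= n)%N -> (forall j, (e <= j < e + L)%N -> a <= F j) ->
  L%:R * a <= \sum_(j < n) F j.
Proof.
move=> F0 eLn Fa; rewrite -(big_mkord xpredT F) (@big_cat_nat _ _ _ e) //=; last first.
  by apply: leq_trans eLn; exact: leq_addr.
rewrite [X in _ + X](@big_cat_nat _ _ _ (e + L)) //=; last exact: leq_addr.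
apply: (@le_trans _ _ (\sum_(e <= i < e + L) F i)).
  rewrite mulr_natl -[L in _ *+ L](addKn e) -sumr_const_nat.
  by apply: ler_sum_nat => i; exact: Fa.
by rewrite addrCA lerDl addr_ge0 // sumr_ge0.
Qed.

Lemma within_cvg_at_right (R : realType) n (f : R -> 'cV[R]_n) s : 0 <= s ->
  {within `[0, +oo[, continuous f} -> f x @[x --> s^'+] --> f s.
Proof.
move=> s0 /(_ s); rewrite /continuous_at.
have As : (`[0, +oo[%classic : set R) s by rewrite /= in_itv /= andbT.
rewrite /prop_for /continuous_at => h; apply: cvg_trans h; apply: cvg_fmap2.
rewrite -nbhs_subspace_in // => A; rewrite /within /= => hA.
apply: filterS hA => x hx sx; apply: hx.
by rewrite in_itv /= andbT (le_trans s0) // ltW.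
Qed.

(** At time 0 all jump integrals run over an empty interval, so the small jump part has zero second
    moment. The Euler scheme needs this start at 0. *)
Lemma jump_levy_process0 (R : realType) disp (Omega : measurableType disp)
    (P : probability Omega R) d (Pi : {measure set 'cV[R]_d -> \bar R})
    (nu : R.-ker Omega ~> (R * 'cV[R]_d)%type) (Z : R -> Omega -> 'cV[R]_d) :
  jump_levy_process P Pi nu Z -> {ae P, forall w, Z 0 w = 0}.
Proof.
move=> [_ _ /(_ 0 (lexx 0))[Y [mY Y0] ZY]].
have set0E (S : set 'cV[R]_d) : (`]0, 0]%classic : set R) `*` S = set0.
  by rewrite set_itvoc0 set0X.
have int0 w (S : set 'cV[R]_d) : cV_integral (nu w) (`]0, 0] `*` S) snd = 0.
  by apply/matrixP => i j; rewrite !mxE set0E Rintegral_set0.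
have cj e w : compensated_jumps Pi nu e 0 w = 0.
  by rewrite /compensated_jumps int0 scale0r subr0.
have IY : (\int[P]_w (enorm (Y w) ^+ 2)%:E = 0)%E.
  have E : (fun e : R => (\int[P]_w (enorm (Y w - compensated_jumps Pi nu e 0 w) ^+ 2)%:E)%E) =
      (fun=> (\int[P]_w (enorm (Y w) ^+ 2)%:E)%E).
    by apply/funext => e; apply: eq_integral => w _; rewrite cj subr0.
  rewrite E in Y0.
  have C : (\int[P]_w (enorm (Y w) ^+ 2)%:E)%E @[_ --> (0:R)^'+] --> (\int[P]_w (enorm (Y w) ^+ 2)%:E)%E.
    exact: cvg_cst.
  apply: (cvg_unique _ C) => //.
have mE : measurable_fun setT (fun w => (enorm (Y w) ^+ 2)%:E).
  apply/measurable_EFinP; apply: measurable_funX.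
  exact: (measurableT_comp (@measurable_enorm R d) mY).
have : ae_eq P setT (fun w => (enorm (Y w) ^+ 2)%:E) (cst 0%E).
  apply/(ae_eq_integral_abs P measurableT mE); rewrite -[RHS]IY.
  by apply: eq_integral => w _; rewrite gee0_abs // lee_fin sqr_ge0.
move=> H; apply: filterS2 H ZY => w /(_ Logic.I)[Yw] ->.
rewrite /large_jumps int0 add0r; apply/matrixP => i j; rewrite (ord1 j) mxE.
apply/eqP; rewrite -normr_le0; apply: le_trans (coord_le_enorm _ _) _.
by rewrite le_eqVlt -sqrf_eq0 Yw eqxx.
Qed.

Lemma trmx_euler_step (R : realType) m (A : 'M[R]_m) s : (euler_step A s)^T = euler_step A^T s.
Proof. by rewrite /euler_step linearD /= trmx1 linearZ. Qed.

Lemma dotp_mulmx (R : realType) m n (M : 'M[R]_(m, n)) z v :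
  dotp z (M *m v) = dotp (M^T *m z) v.
Proof.
rewrite /dotp; under eq_bigr do rewrite mxE mulr_sumr.
rewrite exchange_big; apply: eq_bigr => j _; rewrite mxE mulr_suml.
by apply: eq_bigr => i _; rewrite mxE mulrA (mulrC (z i _)).
Qed.

Lemma dotp_sumr (R : realType) m n (z : 'cV[R]_m) (F : 'I_n -> 'cV[R]_m) :
  dotp z (\sum_i F i) = \sum_i dotp z (F i).
Proof.
rewrite /dotp; under eq_bigr do rewrite summxE mulr_sumr.
by rewrite exchange_big.
Qed.

Lemma norm1_le_enorm (R : realType) m (u : 'cV[R]_m) : norm1 u <= m%:R * enorm u.
Proof.
rewrite /norm1 mulr_natl -[X in _ *+ X]card_ord -sumr_const.
by apply: ler_sum => i _; exact: coord_le_enorm.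
Qed.

Lemma tail_exponent_ge0 (R : realType) d (Pi : {measure set 'cV[R]_d -> \bar R}) e q :
  0 <= tail_exponent Pi e q.
Proof. by apply: Rintegral_ge0 => u _; rewrite subr_ge0 cos_le1. Qed.

Section solution.
Context (R : realType) (m k d : nat) (m_gt0 : (0 < m)%N) (A : 'M[R]_m)
  (B : 'M[R]_(m, k)) (D : 'M[R]_(m, d)) disp (Omega : measurableType disp)
  (P : probability Omega R) (W : R -> Omega -> 'cV[R]_k)
  (Pi : {measure set 'cV[R]_d -> \bar R}) (nu : R.-ker Omega ~> (R * 'cV[R]_d)%type)
  (Z : R -> Omega -> 'cV[R]_d) (X : R -> Omega -> 'cV[R]_m).
Hypothesis W_wiener : wiener_process P W.
Hypothesis Pi_levy : levy_measure Pi.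
Hypothesis nu_poisson : poisson_random_measure P (jump_intensity Pi) nu.
Hypothesis W_nu : independent_systems P (process_sigma W) (random_measure_sigma nu).
Hypothesis Z_levy : jump_levy_process P Pi nu Z.
Hypothesis X_solution : linear_sde_solution P A B D W Z X.
Hypothesis Pi_directional : directional_moment_condition Pi.
Hypothesis rank_condition : \rank (controllability_mx A B D) = m.
Context (t : R) (t_gt0 : 0 < t).

Let V s w := B *m W s w + D *m Z s w.
Let tt n (j : nat) : R := j%:R * (t / n.+1%:R).
Let y n z (j : nat) : 'cV[R]_k := B^T *m (euler_step A^T (t / n.+1%:R) ^+ j *m z).
Let q n z (j : nat) : 'cV[R]_d := D^T *m (euler_step A^T (t / n.+1%:R) ^+ j *m z).
Let noise n z w :=
  \sum_(i < n.+1) dotp (y n z (n.+1 - i.+1)) (W (tt n i.+1) w - W (tt n i) w) +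
  \sum_(i < n.+1) dotp (q n z (n.+1 - i.+1)) (Z (tt n i.+1) w - Z (tt n i) w).

Let h_gt0 n : 0 < t / n.+1%:R. Proof. by rewrite divr_gt0. Qed.

Let noiseE n z w : dotp z (euler_sum A (V ^~ w) t n n.+1) = noise n z w.
Proof.
rewrite /euler_sum dotp_sumr /noise -big_split; apply: eq_bigr => i _.
rewrite dotp_mulmx trmx_exp trmx_euler_step -/(tt n i) -/(tt n i.+1).
have -> : V (tt n i.+1) w - V (tt n i) w =
    B *m (W (tt n i.+1) w - W (tt n i) w) + D *m (Z (tt n i.+1) w - Z (tt n i) w).
  by rewrite /V !mulmxBr opprD addrACA.
by rewrite [LHS]dotpDr !dotp_mulmx.
Qed.

Let mnoise n z : measurable_fun setT (noise n z).
Proof.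
have [mW _ _ _] := W_wiener; have [mZ _ _] := Z_levy.
have tt0 j : 0 <= tt n j by rewrite mulr_ge0 // ltW.
apply: measurable_funD; apply: measurable_sum => i;
  apply: (measurableT_comp (measurable_dotp _)); apply: measurable_fun_cVB.
- exact: mW.
- exact: mW.
- exact: mZ.
- exact: mZ.
Qed.

(** The Euler scheme is applied path by path, off the null sets where W, Z or the equation
    misbehave. *)
Let noise_cvg z : {ae P, forall w, noise n z w @[n --> \oo] --> dotp z (X t w)}.
Proof.
have [_ aeW0 _ _] := W_wiener; have [_ aeZc _] := Z_levy; have [_ aeX] := X_solution.
have aeZ0 := jump_levy_process0 Z_levy.
near=> w.
have [W0 cW] : W 0 w = 0 /\ {within `[0, +oo[, continuous (fun t => W t w)} by near: w.
have [rZ _] : cadlag (fun t => Z t w) by near: w.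
have Z0 : Z 0 w = 0 by near: w.
have [bX mX Xeq] : [/\ forall t : R, 0 <= t -> [bounded X s w | s in `[0, t]],
        forall t : R, 0 <= t -> measurable_fun (`[0, t] : set R) (fun s => X s w)
      & forall t, 0 <= t ->
          X t w = cV_integral lebesgue_measure `[0, t] (fun s => A *m X s w)
                  + B *m W t w + D *m Z t w] by near: w.
have ec : norm1 (X t w - euler_sum A (V ^~ w) t n n.+1) @[n --> \oo] --> (0 : R).
  apply: (euler_cvg (V := V ^~ w) (X := X ^~ w)) => //.
  - by move=> s s0 st; rewrite Xeq // /V addrA.
  - exact: bX (ltW t_gt0).
  - exact: mX (ltW t_gt0).
  - move=> s s0 st; apply: cvgD; apply: cvg_mulmx.
      exact: within_cvg_at_right.
    exact: rZ.
  - by rewrite /V W0 Z0 !mulmx0 addr0.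
apply/cvgrPdist_le => e e0.
have e1 : 0 < e / (norm1 z + 1) by rewrite divr_gt0 // ltr_wpDl // norm1_ge0.
have /cvgrPdist_le/(_ _ e1) := ec; apply: filterS => n.
rewrite sub0r normrN ger0_norm ?norm1_ge0 // ler_pdivlMr; last by rewrite ltr_wpDl // norm1_ge0.
move=> h; rewrite -noiseE -dotpBr; apply: le_trans (dotp_le_norm1 _ _) _.
by apply: le_trans h; rewrite mulrC mulrDr mulr1 lerDl norm1_ge0.
Unshelve. all: end_near. Qed.

Lemma mod2_solution_decay N :
  exists C, forall z, mod2 P (fun w => dotp z (X t w)) * (1 + norm1 z) ^+ N <= C.
Proof.
have [mXt _] := X_solution.
have mX z : measurable_fun setT (fun w => dotp z (X t w)).
  by apply: (measurableT_comp (measurable_dotp z)); exact: mXt (ltW t_gt0).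
have [c c0 obs] := controllability_observable rank_condition.
pose g u := norm1 (B^T *m u) + norm1 (D^T *m u).
have [] := @euler_observable R m A^T g (mnorm B^T + mnorm D^T) c t m_gt0 t_gt0 _ c0 _ _ _ _ obs.
- by rewrite addr_ge0 // mnorm_ge0.
- move=> u v; rewrite /g !mulmxBr addrACA; apply: lerD; exact: norm1B.
- by move=> e u; rewrite /g -!scalemxAr !norm1Z mulrDr.
- by move=> u; rewrite addr_ge0 // norm1_ge0.
- by move=> u; rewrite mulrDl; apply: lerD; exact: norm1_mulmx.
move=> dl [kap [dl0 kap0 [n0 Hobs]]].
(* A block of kap (n+1) steps of weight t/(n+1), each contributing 2 K ln, then yields exactly the
   exponent N + 1, whatever n is; N + 1 instead of N keeps K positive. *)
pose K : R := N.+1%:R / (2 * t * kap).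
have K0 : 0 < K by rewrite divr_gt0 // !mulr_gt0.
have [r0 r01 texp] := tail_exponent_ge Pi_levy Pi_directional K0.
(* Beyond 2K the quadratic contribution of W dominates the logarithm: 2 K ln x <= x^2, since ln x <=
   x. *)
pose r1 := Num.max r0 (2 * K).
have r1_gt1 : 1 < r1 by rewrite lt_max r01.
have kd0 : 0 < (k + d)%:R + 1 :> R by rewrite ltr_wpDl.
(* The 2 selects the larger of the two noises, the rest passes from the l^1 to the Euclidean norm;
   the 1 keeps the denominator positive. *)
pose sg := dl / (2 * ((k + d)%:R + 1)).
have sg0 : 0 < sg by rewrite divr_gt0 // mulr_gt0.
(* At each index of the block, one of the two noises is excited at scale [sg * norm1 z]. *)
have large n z j : dl * norm1 z <= g (euler_step A^T (t / n.+1%:R) ^+ j *m z) ->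
    sg * norm1 z <= enorm (y n z j) \/ sg * norm1 z <= enorm (q n z j).
  rewrite /g -/(y n z j) -/(q n z j) => H.
  have ny := norm1_le_enorm (y n z j); have nq := norm1_le_enorm (q n z j).
  have hk : k%:R <= (k + d)%:R + 1 :> R by rewrite natrD -addrA lerDl addr_ge0.
  have hd : d%:R <= (k + d)%:R + 1 :> R by rewrite natrD addrAC lerDr addr_ge0.
  have ny' : norm1 (y n z j) <= ((k + d)%:R + 1) * enorm (y n z j).
    by apply: le_trans ny _; rewrite ler_wpM2r // enorm_ge0.
  have nq' : norm1 (q n z j) <= ((k + d)%:R + 1) * enorm (q n z j).
    by apply: le_trans nq _; rewrite ler_wpM2r // enorm_ge0.
  have sgE : sg * norm1 z * ((k + d)%:R + 1) = dl * norm1 z / 2.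
    by rewrite /sg; field; rewrite gt_eqF.
  have [h|h] := leP (dl * norm1 z / 2) (norm1 (y n z j)); [left|right].
    by rewrite -(ler_pM2r kd0) sgE [leRHS]mulrC (le_trans h).
  rewrite -(ler_pM2r kd0) sgE [leRHS]mulrC; apply: le_trans nq'.
  by lra.
(* A lower bound for the jump exponent valid for every weight: logarithmic above the threshold,
   trivial below it. *)
pose b n z j : R := if r0 < enorm (q n z j) then K * ln (enorm (q n z j)) else 0.
have b0 n z j : 0 <= b n z j.
  rewrite /b; case: ltP => // h; rewrite mulr_ge0 ?(ltW K0) // ln_ge0 // ltW //.
  exact: lt_trans h.
have btail n z j : \forall e \near 0^'+, b n z j <= tail_exponent Pi e (q n z j).
  rewrite /b; case: ltP => h; first exact: texp.
  by apply: nearW => e; exact: tail_exponent_ge0.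
have term n z j : r1 < sg * norm1 z ->
    dl * norm1 z <= g (euler_step A^T (t / n.+1%:R) ^+ j *m z) ->
    2 * K * ln (sg * norm1 z) <= dotp (y n z j) (y n z j) + 2 * b n z j.
  rewrite gt_max => /andP[rs Ks] /large[] h.
    have x0 : 0 < sg * norm1 z by apply: lt_trans rs; apply: lt_trans r01.
    apply: (@le_trans _ _ (dotp (y n z j) (y n z j))); last by rewrite lerDl mulr_ge0.
    rewrite -enorm_sqr; apply: (@le_trans _ _ ((sg * norm1 z) ^+ 2)); last first.
      by rewrite lerXn2r // nnegrE ?enorm_ge0 // ltW.
    have lnx : ln (sg * norm1 z) <= sg * norm1 z.
      exact/ltW/ln_sublinear.
    rewrite expr2; apply: ler_pM => //.
    - by rewrite mulr_ge0 // ltW.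
    - by rewrite ln_ge0 // ltW // (lt_trans r01).
    - exact: ltW.
  have rq : r0 < enorm (q n z j) by apply: lt_le_trans h.
  rewrite /b rq -[leLHS]add0r; apply: lerD; first exact: dotp_ge0.
  rewrite -mulrA ler_pM2l // ler_pM2l // ler_ln ?posrE //.
    by apply: lt_trans rs; apply: lt_trans r01.
  by apply: lt_trans rq; apply: lt_trans r01.
have bound n z : (n0 <= n)%N -> r1 < sg * norm1 z ->
    mod2 P (noise n z) <= expR (- (N.+1%:R * ln (sg * norm1 z))).
  move=> n0n rz.
  have ttS i : tt n i < tt n i.+1 by rewrite ltr_pM2r // ltr_nat.
  have tt0 : 0 <= tt n 0 by rewrite /tt mul0r.
  have := mod2_increments W_wiener Pi_levy nu_poisson W_nu Z_levy
    (fun i : 'I_n.+1 => y n z (n.+1 - i.+1)) tt0 ttS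
    (fun i : 'I_n.+1 => btail n z (n.+1 - i.+1)%N).
  move=> /le_trans; apply.
  rewrite ler_expR lerN2.
  pose F j := (t / n.+1%:R) * (dotp (y n z j) (y n z j) + 2 * b n z j).
  have -> : \sum_(i < n.+1) (tt n i.+1 - tt n i) *
      (dotp (y n z (n.+1 - i.+1)) (y n z (n.+1 - i.+1)) + 2 * b n z (n.+1 - i.+1)%N) =
      \sum_(i < n.+1) F i.
    (* The increment number i carries the power n - i of the Euler step, so the sum is reversed to
       run over powers. *)
    rewrite [RHS](reindex_inj rev_ord_inj); apply: eq_bigr => i _ /=; rewrite /F /tt.
    by rewrite -mulrBl -natrB // subSnn mul1r.
  have [e0 [L [eL kL Hj]]] := Hobs n n0n z.
  have ln0 : 0 <= ln (sg * norm1 z) by rewrite ln_ge0 // ltW // (lt_trans r1_gt1).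
  have FL : L%:R * (t / n.+1%:R * (2 * K * ln (sg * norm1 z))) <= \sum_(i < n.+1) F i.
    apply: (sum_ge_block _ eL).
    - by move=> i; rewrite mulr_ge0 ?(ltW (h_gt0 n)) // addr_ge0 ?dotp_ge0 // mulr_ge0.
    - by move=> j /Hj hj; rewrite ler_pM2l // term.
  apply: le_trans FL.
  have -> : N.+1%:R * ln (sg * norm1 z) =
      kap * n.+1%:R * (t / n.+1%:R * (2 * K * ln (sg * norm1 z))).
    by rewrite /K; field; rewrite !gt_eqF.
  apply: ler_wpM2r => //; apply: mulr_ge0; first exact/ltW/h_gt0.
  by rewrite mulr_ge0 // mulr_ge0 // ltW.
have lim z : r1 < sg * norm1 z ->
    mod2 P (fun w => dotp z (X t w)) <= expR (- (N.+1%:R * ln (sg * norm1 z))).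
  move=> rz.
  have cv := mod2_cvg (P := P) (X_ := fun n => noise n z) (fun n => mnoise n z) (mX z) (noise_cvg z).
  apply: (@ler_cvg_to _ \oo _ R (fun n => mod2 P (noise n z))
    (fun=> expR (- (N.+1%:R * ln (sg * norm1 z)))) _ _ cv); first exact: cvg_cst.
  by exists n0 => // n /= n0n; exact: bound.
(* The first term covers bounded frequencies, where the squared modulus is at most 2; the second
   bounds ((1 + |z|)/(sg |z|))^(N+1) for sg |z| > 1. *)
exists (2 * (1 + r1 / sg) ^+ N + (1 + sg^-1) ^+ N.+1) => z.
have r10 : 0 <= r1 / sg by rewrite divr_ge0 // ltW // (lt_trans ltr01).
have rho1 := oneDnorm1_ge1 z.
have rho0 : 0 <= 1 + norm1 z by exact: le_trans rho1.
have sV0 : 0 <= 1 + sg^-1 by rewrite addr_ge0 // invr_ge0 ltW.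
have [rz|rz] := leP (sg * norm1 z) r1.
  rewrite -[leLHS]addr0; apply: lerD; last by rewrite exprn_ge0.
  apply: ler_pM => //; first by rewrite addr_ge0 // sqr_ge0.
  - by rewrite exprn_ge0.
  - exact: mod2_le2.
  - apply: lerXn2r; rewrite ?nnegrE //; first by rewrite addr_ge0.
    by rewrite lerD2l ler_pdivlMr // mulrC.
rewrite -[leLHS]add0r; apply: lerD; first by rewrite mulr_ge0 // exprn_ge0 // addr_ge0.
have x1 : 1 < sg * norm1 z by exact: lt_trans rz.
have x0 : 0 < sg * norm1 z by exact: lt_trans x1.
apply: (@le_trans _ _ (expR (- (N.+1%:R * ln (sg * norm1 z))) * (1 + norm1 z) ^+ N.+1)).
  apply: ler_pM; rewrite ?addr_ge0 ?sqr_ge0 ?exprn_ge0 ?lim //.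
  by rewrite exprS ler_peMl // exprn_ge0.
rewrite expRN mulrC ler_pdivrMr ?expR_gt0 // expRM_natl lnK ?posrE // -exprMn.
apply: lerXn2r; rewrite ?nnegrE //; first by rewrite mulr_ge0 // ltW.
have -> : (1 + sg^-1) * (sg * norm1 z) = sg * norm1 z + norm1 z by field; rewrite gt_eqF.
by rewrite lerD2r ltW.
Qed.

End solution.

Theorem theorem2 (R : realType) (m k d : nat)
    (m_gt0 : (0 < m)%N) (k_gt0 : (0 < k)%N) (d_gt0 : (0 < d)%N)
    (A : 'M[R]_m) (B : 'M[R]_(m, k)) (D : 'M[R]_(m, d))
    (disp : measure_display) (Omega : measurableType disp)
    (P : probability Omega R)
    (W : R -> Omega -> 'cV[R]_k)
    (Pi : {measure set 'cV[R]_d -> \bar R})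
    (nu : R.-ker Omega ~> (R * 'cV[R]_d)%type)
    (Z : R -> Omega -> 'cV[R]_d)
    (X : R -> Omega -> 'cV[R]_m)
    (W_wiener : wiener_process P W)
    (Pi_levy : levy_measure Pi)
    (Pi_nondegenerate : ess_lin_nondegenerate Pi)
    (nu_poisson : poisson_random_measure P (jump_intensity Pi) nu)
    (W_nu_independent :
      independent_systems P (process_sigma W) (random_measure_sigma nu))
    (Z_levy : jump_levy_process P Pi nu Z)
    (X_solution : linear_sde_solution P A B D W Z X)
    (Pi_directional : directional_moment_condition Pi)
    (rank_condition : \rank (controllability_mx A B D) = m)
    (t : R) (t_gt0 : 0 < t) :
  exists p : 'cV[R]_m -> R, has_density (pushforward P (X t)) p /\ Cb_infty p.
Proof.
apply: smooth_density_of_decay; first by have [mX _] := X_solution; exact: mX (ltW t_gt0).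
exact: (mod2_solution_decay m_gt0 W_wiener Pi_levy nu_poisson W_nu_independent Z_levy
  X_solution Pi_directional rank_condition t_gt0).
Qed.
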